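(* Let $c>0$, and let $c_1,\dots,c_N>0$ be fixed arbitrary positive constants (entering the weight $w$ defined in the context). Assume $1\le \kappa\le 2$ and $\mu>0$. (i) Let $G=G(t,x)$ be a smooth function, and let $u$ be the solution to $$\square_c u=G\quad\text{in }(0,\infty)\times\mathbb{R}^3$$ with initial data $u=\partial_t u=0$ at $t=0$. Then there exists a positive constant $C$, depending on $\kappa$ and $\mu$ (with $c,c_1,\dots,c_N$ fixed; $C$ does not depend on $G$), such that $$\langle |x|\rangle\,\langle t+|x|\rangle\,\langle ct-|x|\rangle^{\kappa-1}\,\bigl\{\log(2+t+|x|)\bigr\}^{-1}\,|D_{+,c}u(t,x)|\le C\,A_{\kappa,\mu,2}[G;c](t,x)$$ for all $(t,x)\in(0,\infty)\times\mathbb{R}^3$ with $x\neq 0$. Moreover, if $1<\kappa<2$, then for any $\delta>0$ there exists a constant $C$, depending on $\kappa$, $\mu$ and $\delta$ (with $c,c_1,\dots,c_N$ fixed; $C$ does not depend on $G$), such that $$\langle t+|x|\rangle^{2}\,\langle ct-|x|\rangle^{\kappa-1}\,|D_{+,c}u(t,x)|\le C\,A_{\kappa,\mu,2}[G;c](t,x)$$ for all $(t,x)\in(0,\infty)\times\mathbb{R}^3$ satisfying $|x|>\delta t$. (ii) Let $\phi,\psi$ be smooth functions on $\mathbb{R}^3$, and let $u^*$ be the solution to $$\square_c u^*=0\quad\text{in }(0,\infty)\times\mathbb{R}^3$$ with initial data $u^*=\phi$ and $\partial_t u^*=\psi$ at $t=0$. Then there is a positive constant $C$, depending on $\kappa$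 and $\mu$ (with $c$ fixed; $C$ does not depend on $\phi,\psi$), such that $$\langle |x|\rangle\,\langle t+|x|\rangle\,\langle ct-|x|\rangle^{\kappa-1}\,|D_{+,c}u^*(t,x)|\le C\,B_{\kappa+\mu+1,2}[\phi,\psi;c](t,x)$$ for all $(t,x)\in(0,\infty)\times\mathbb{R}^3$ with $x\neq0$.
   Context: Coordinates are $(t,x)\in[0,\infty)\times\mathbb{R}^3$, with $\partial_0=\partial_t$, $\partial_j=\partial/\partial x_j$ ($j=1,2,3$), and $\square_c=\partial_t^2-c^2\Delta_x$. For $x\neq0$, $\partial_r=\sum_{j=1}^3\frac{x_j}{|x|}\partial_j$ and $D_{+,c}=\partial_t+c\,\partial_r$. For $a\in\mathbb{R}$, $\langle a\rangle=\sqrt{1+a^2}$. Vector fields: $\Omega_{jk}=x_j\partial_k-x_k\partial_j$ ($1\le j<k\le3$), and $Z=\{Z_1,\dots,Z_7\}=\{(\partial_a)_{0\le a\le3},(\Omega_{jk})_{1\le j<k\le3}\}$. For a multi-index $\alpha=(\alpha_1,\dots,\alpha_7)$, $Z^\alpha=Z_1^{\alpha_1}\cdots Z_7^{\alpha_7}$. For a function $v=v(t,x)$ and a nonnegative integer $s$, $|v(t,x)|_s=\sum_{|\alpha|\le s}|Z^\alpha v(t,x)|$. The same notation is used for functions of $x$ only, regarded as functions of $(t,x)$ independent of $t$. Weight: with $c_0=0$, $w(t,r)=w(t,r;c_1,\dots,c_N)=\min_{0\le j\le N}\langle c_jt-r\rangle$. For $\rho,\mu\ge0$, a nonnegative integer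 $s$ and smooth $G=G(t,x)$, $$A_{\rho,\mu,s}[G;c](t,x)=\sup_{(\tau,y)\in\Lambda_c(t,x)}|y|\,\langle\tau+|y|\rangle^{\rho}\,w(\tau,|y|)^{1+\mu}\,|G(\tau,y)|_s,$$ where $\Lambda_c(t,x)=\{(\tau,y)\in[0,t]\times\mathbb{R}^3:\ |y-x|\le c(t-\tau)\}$. For $\rho\ge0$, a nonnegative integer $s$ and smooth $\phi,\psi$ on $\mathbb{R}^3$, $$B_{\rho,s}[\phi,\psi;c](t,x)=\sup_{y\in\Lambda'_c(t,x)}\langle|y|\rangle^{\rho}\bigl(|\phi(y)|_{s+1}+|\psi(y)|_s\bigr),$$ where $\Lambda'_c(t,x)=\{y\in\mathbb{R}^3:\ |y-x|\le ct\}$. *)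

(* Defs.v *)
From HB Require Import structures.
From mathcomp Require Import all_boot all_order all_algebra.
From mathcomp Require Import all_classical all_reals all_analysis.

Set Implicit Arguments.
Unset Strict Implicit.
Unset Printing Implicit Defensive.

Import Order.TTheory GRing.Theory Num.Theory.
Import numFieldNormedType.Exports.

Local Open Scope classical_set_scope.
Local Open Scope ring_scope.

(* Relative derivatives: the increments h are restricted to those for which
   p + h v stays in A.  On the closed half-space {t >= 0} this yields one-sided
   time derivatives at t = 0 and the usual derivatives ('D_v) for t > 0. *)
Section Smoothness.
Context {R : realType} {V : normedModType R}.
Implicit Types (A : set V) (f : V -> R) (p v : V).

Definition diff_quotient_within A f p v : set_system R :=
  (h^-1 * (f (h *: v + p) - f p)) @[h --> within [set h : R | A (h *: v + p)] 0^'].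

Definition derivable_within A f p v : Prop := cvg (diff_quotient_within A f p v).

Definition derive_within A f v p : R := lim (diff_quotient_within A f p v).

Definition smooth_on A f : Prop :=
  forall vs : seq V, let g := foldr (fun v g => derive_within A g v) f vs in
    {within A, continuous g} /\
    (forall p v, A p -> derivable_within A g p v).

End Smoothness.

Section Wave.
Context {R : realType}.


(* The library norm on 'rV[R]_3 is the sup norm, hence a separate definition. *)
Definition enorm (x : 'rV[R]_3) : R := Num.sqrt (\sum_(j < 3) x 0 j ^+ 2).

Definition japanese (a : R) : R := Num.sqrt (1 + a ^+ 2).

Definition halfspace : set (R * 'rV[R]_3) := [set p | 0 <= p.1].

Implicit Types (f G u : R * 'rV[R]_3 -> R) (phi psi : 'rV[R]_3 -> R).

Definition smooth f : Prop := smooth_on halfspace f.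

Definition pdt f : R * 'rV[R]_3 -> R := derive_within halfspace f (1, 0).

Definition pdx (j : 'I_3) f : R * 'rV[R]_3 -> R :=
  derive_within halfspace f (0, delta_mx 0 j).

Definition rotation (j k : 'I_3) f : R * 'rV[R]_3 -> R :=
  fun p => p.2 0 j * pdx k f p - p.2 0 k * pdx j f p.

Definition dalembertian (c : R) f : R * 'rV[R]_3 -> R :=
  fun p => pdt (pdt f) p - c ^+ 2 * \sum_(j < 3) pdx j (pdx j f) p.

Definition pdr f : R * 'rV[R]_3 -> R :=
  fun p => \sum_(j < 3) p.2 0 j / enorm p.2 * pdx j f p.

Definition Dplus (c : R) f : R * 'rV[R]_3 -> R :=
  fun p => pdt f p + c * pdr f p.

Definition Zop (i : 'I_7) : (R * 'rV[R]_3 -> R) -> (R * 'rV[R]_3 -> R) :=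
  tnth [tuple pdt; pdx 0; pdx 1; pdx 2;
              rotation 0 1; rotation 0 2; rotation 1 2] i.

Definition Zpow (alpha : 'I_7 -> nat) f : R * 'rV[R]_3 -> R :=
  foldr (fun i g => iter (alpha i) (Zop i) g) f (enum 'I_7).

(* Multi-indices of length at most s have entries at most s, so they are
   enumerated by the finite type {ffun 'I_7 -> 'I_s.+1}. *)
Definition Znorm (s : nat) f (p : R * 'rV[R]_3) : R :=
  \sum_(alpha : {ffun 'I_7 -> 'I_s.+1} | (\sum_i alpha i <= s)%N)
    `|Zpow (fun i => alpha i) f p|.

(* |.|_s of a function of x only is that of its t-independent extension. *)
Definition static phi : R * 'rV[R]_3 -> R := fun p => phi p.2.

(* The initial value of the iterated minimum is the term for c_0 = 0. *)
Definition weight (N : nat) (cs : 'I_N -> R) (t r : R) : R :=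
  \big[Num.min/japanese (0 * t - r)]_(j < N) japanese (cs j * t - r).

Definition cone (c : R) (t : R) (x : 'rV[R]_3) : set (R * 'rV[R]_3) :=
  [set q | 0 <= q.1 <= t /\ enorm (q.2 - x) <= c * (t - q.1)].

Definition normA (N : nat) (cs : 'I_N -> R) (rho mu : R) (s : nat) G (c : R)
    (t : R) (x : 'rV[R]_3) : \bar R :=
  ereal_sup [set (enorm q.2 * japanese (q.1 + enorm q.2) `^ rho *
                  weight cs q.1 (enorm q.2) `^ (1 + mu) * Znorm s G q)%:E
            | q in cone c t x].

Definition base (c : R) (t : R) (x : 'rV[R]_3) : set 'rV[R]_3 :=
  [set y | enorm (y - x) <= c * t].

Definition normB (rho : R) (s : nat) phi psi (c : R)
    (t : R) (x : 'rV[R]_3) : \bar R :=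
  ereal_sup [set (japanese (enorm y) `^ rho *
                  (Znorm s.+1 (static phi) (0, y) + Znorm s (static psi) (0, y)))%:E
            | y in base c t x].

(* Classical solutions smooth up to t = 0; among these the solution is unique. *)
Definition solves_wave (c : R) G phi psi u : Prop :=
  [/\ smooth u,
      forall t x, 0 < t -> dalembertian c u (t, x) = G (t, x),
      forall x, u (0, x) = phi x
    & forall x, pdt u (0, x) = psi x].

End Wave.

(* Main.v *)
Require Import Defs.
From HB Require Import structures.
From mathcomp Require Import all_boot all_order all_algebra.
From mathcomp Require Import all_classical all_reals all_analysis.
From mathcomp Require Import ring lra.

Set Implicit Arguments.
Unset Strict Implicit.
Unset Printing Implicit Defensive.

Import Order.TTheory GRing.Theory Num.Theory.
Import numFieldNormedType.Exports.

Local Open Scope classical_set_scope.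
Local Open Scope ring_scope.

(** Why the theorem holds.  Write r = |x|.  Everything is reduced to ordinary
    differential inequalities along rays, so the only integrals that occur are
    differences of primitives of one-variable functions.

    For a smooth solution v of the wave equation with speed c and source g, let
    rho (v_t + c w . grad v) + c v, with rho = c (T - s), be the momentum of v at
    the point (s, z + rho w) of the incoming ray with direction w and tip (T, z).
    Its derivative in s is rho g plus c^2 / rho times the Laplacian of v over the
    sphere of radius rho about z.  This identity is used twice.

    First, with tip (t, x), averaged over all directions w.  The spherical
    Laplacian has mean zero, which gives Kirchhoff's formula in the form of the
    estimate kirchhoff_bound.  A function of the distance lambda to the origin is
    integrated over a sphere by means of sin th dth = - lambda dlambda / (r rho)
    (sphere_bound), which removes the singular factor 1/|y| that the weight allows.
    If |y| |g| <= A <s+|y|>^-kappa w^-(1+mu), two ways of integrating in time (over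
    slices, gaining 1/r, and over strips, gaining 1/<ct-r>) combine to
    <t+r> |v| <= C A <ct-r>^(1-kappa), with a logarithm if kappa = 1
    (source_decay).  Data of order <y>^-(kappa+mu+1) give the same bound
    (data_decay, and velocity_decay for a velocity that is singular at the origin).

    Secondly, with z = 0, w = x/r and tip time t + r/c: this single ray passes
    through (t, x), where its momentum is r D_+ v + c v, and the Laplacian over the
    spheres about the origin is the sum of the squares of the rotation fields
    (ray_momentum_origin).  Since the rotations commute with the wave operator, the
    first step applied to their squares bounds the integrand, and ray_estimate
    bounds r |D_+ v| by c |v|, the initial momentum and an integral along the ray.
    With q = cs - rho the inequality <ct-r> <= <q> + 2 rho turns
    <q>^(1-kappa) / rho into <ct-r>^(1-kappa) times 1/rho + 2/<q> (interpolation),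
    and these two critical terms are what produces the logarithm.  If |x| > delta t,
    rho is comparable to t + r, and for 1 < kappa < 2 the integral of
    <q>^(1-kappa) grows only like <t+r>^(2-kappa), so that no logarithm appears.  For
    the free equation a part of the surplus mu of decay makes the critical terms
    integrable.

    This is effective for r >= 1.  For r < 1 each first derivative of the solution is
    itself a solution to which the first step applies; the time derivative of a
    solution with zero data has the source at time 0 as its initial velocity. *)

(** * Calculus in one variable *)

Section OneVariable.
Context {R : realType}.
Implicit Types (f g F K df dK : R -> R) (a b s d : R).

Lemma is_derive_continuous f s d : is_derive s 1 f d -> {for s, continuous f}.
Proof.
by move=> df; apply: differentiable_continuous; apply/derivable1_diffP; exact: ex_derive.
Qed.

Lemma continuous_pair (X Y Z : topologicalType) (f : X -> Y) (g : X -> Z) :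
  continuous f -> continuous g -> continuous (fun x => (f x, g x)).
Proof. by move=> cf cg x; apply: cvg_pair; [exact: cf|exact: cg]. Qed.

Lemma continuous_compose (X Y Z : topologicalType) (f : Y -> Z) (g : X -> Y) :
  continuous f -> continuous g -> continuous (fun x => f (g x)).
Proof. by move=> cf cg x; apply: continuous_comp; [exact: cg|exact: cf]. Qed.

Lemma continuous_section (X Y Z : topologicalType) (g : X -> Y -> Z) (x : X) :
  continuous (fun p : X * Y => g p.1 p.2) -> continuous (g x).
Proof.
move=> cg; apply: (continuous_compose (g := fun y => (x, y)) cg).
by apply: continuous_pair; [move=> y; exact: cvg_cst|move=> y; exact: cvg_id].
Qed.

Lemma cont_cst (X : topologicalType) (k : R) : continuous (fun _ : X => k).
Proof. by move=> x; exact: cvg_cst. Qed.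

Lemma cont_add (X : topologicalType) (f g : X -> R) :
  continuous f -> continuous g -> continuous (fun x => f x + g x).
Proof. by move=> cf cg x; apply: cvgD; [exact: cf|exact: cg]. Qed.

Lemma cont_sub (X : topologicalType) (f g : X -> R) :
  continuous f -> continuous g -> continuous (fun x => f x - g x).
Proof. by move=> cf cg x; apply: cvgB; [exact: cf|exact: cg]. Qed.

Lemma cont_opp (X : topologicalType) (f : X -> R) :
  continuous f -> continuous (fun x => - f x).
Proof. by move=> cf x; apply: cvgN; exact: cf. Qed.

Lemma cont_mul (X : topologicalType) (f g : X -> R) :
  continuous f -> continuous g -> continuous (fun x => f x * g x).
Proof. by move=> cf cg x; apply: cvgM; [exact: cf|exact: cg]. Qed.

Lemma isd_eq f s d d' : is_derive s 1 f d -> d = d' -> is_derive s 1 f d'.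
Proof. by move=> H <-. Qed.

Lemma isd_comp f g s d d' : is_derive (g s) 1 f d -> is_derive s 1 g d' ->
  is_derive s 1 (fun x => f (g x)) (d * d').
Proof. exact: is_derive1_comp. Qed.

Lemma isd_id s : is_derive s 1 (fun x : R => x) 1.
Proof. exact: (is_derive_id s 1). Qed.

Lemma isd_cst a s : is_derive s 1 (fun=> a) 0.
Proof. exact: (is_derive_cst a s 1). Qed.

Lemma isd_opp f s d : is_derive s 1 f d -> is_derive s 1 (fun x => - f x) (- d).
Proof. exact: is_deriveN. Qed.

Lemma isd_add f g s d d' : is_derive s 1 f d -> is_derive s 1 g d' ->
  is_derive s 1 (fun x => f x + g x) (d + d').
Proof. exact: is_deriveD. Qed.

Lemma isd_sub f g s d d' : is_derive s 1 f d -> is_derive s 1 g d' ->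
  is_derive s 1 (fun x => f x - g x) (d - d').
Proof. exact: is_deriveB. Qed.

Lemma isd_mul f g s d d' : is_derive s 1 f d -> is_derive s 1 g d' ->
  is_derive s 1 (fun x => f x * g x) (d * g s + f s * d').
Proof.
move=> Hf Hg; have H := is_deriveM Hf Hg.
by apply: (isd_eq H); rewrite addrC /GRing.scale /= [d * _]mulrC.
Qed.

Lemma isd_mull a f s d : is_derive s 1 f d -> is_derive s 1 (fun x => a * f x) (a * d).
Proof.
by move=> Hf; apply: (isd_eq (isd_mul (isd_cst a s) Hf)); rewrite mul0r add0r.
Qed.

(** This replaces the integration of an inequality: K stands for an integral of the
    bound of the derivative, and any function with the right derivative will do. *)
Lemma mean_value_bound f K df dK a b : a <= b ->
  {within `[a, b], continuous f} -> {within `[a, b], continuous K} ->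
  (forall s, a < s < b -> is_derive s 1 f (df s)) ->
  (forall s, a < s < b -> is_derive s 1 K (dK s)) ->
  (forall s, a < s < b -> `|df s| <= dK s) ->
  `|f b - f a| <= K b - K a.
Proof.
move=> ab cf cK Hf HK le_d.
have key g (dg : R -> R) : {within `[a, b], continuous g} ->
    (forall s, a < s < b -> is_derive s 1 g (dg s)) ->
    (forall s, a < s < b -> dg s <= dK s) -> g b - g a <= K b - K a.
  move=> cg Hg le_g.
  have cKg : {within `[a, b], continuous (K - g)}.
    exact: within_continuousB.
  have HKg x : x \in `]a, b[ -> is_derive x 1 (K - g) (dK x - dg x).
    by rewrite in_itv /= => xab; have := HK _ xab; have := Hg _ xab => ? ?; exact: is_deriveB.
  have dKg : K b - g b - (K a - g a) >= 0.
    move: ab; rewrite le_eqVlt => /predU1P[->|ab]; first by rewrite subrr.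
    have [c' c'in e] := @MVT _ _ _ _ _ ab HKg cKg.
    rewrite !fctE in e; rewrite e; apply: mulr_ge0; rewrite ?subr_ge0 ?(ltW ab) //.
    by apply: le_g; move: c'in; rewrite in_itv.
  lra.
rewrite ler_norml; apply/andP; split.
  have := key (cst 0 - f) (fun s => 0 - df s); rewrite !fctE.
  have cN : {within `[a, b], continuous (cst 0 - f)}.
    by apply: within_continuousB => // x; exact: cst_continuous.
  have HN s : a < s < b -> is_derive s 1 (cst 0 - f) (0 - df s).
    by move=> sab; have := Hf _ sab => ?; exact: is_deriveB.
  have leN s : a < s < b -> 0 - df s <= dK s.
    by move=> /le_d; rewrite ler_norml => /andP[]; lra.
  by move=> /(_ cN HN leN); lra.
by apply: (key f df) => // s /le_d; rewrite ler_norml => /andP[].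
Qed.

Lemma zero_derivative f a b : a <= b ->
  (forall s, a <= s <= b -> is_derive s 1 f 0) -> f a = f b.
Proof.
move=> ab Hf.
have cf : {within `[a, b], continuous f}.
  apply: derivable_within_continuous => x; rewrite in_itv /= => /Hf ?.
  exact: ex_derive.
have c0 : {within `[a, b], continuous (fun _ : R => 0 : R)}.
  by move=> x; exact: cst_continuous.
have := @mean_value_bound f (fun _ => 0) (fun _ => 0) (fun _ => 0) a b ab cf c0.
move=> H; apply/esym/eqP; rewrite -subr_eq0 -normr_le0 -[leRHS](subrr 0); apply: H.
- by move=> s /andP[/ltW? /ltW?]; apply: Hf; apply/andP.
- by move=> s _; rewrite normr0.
Qed.

Lemma antiderivative_right f a : continuous f ->
  exists F, forall s, a < s -> is_derive s 1 F (f s).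
Proof.
move=> cf; exists (fun x => \int[lebesgue_measure]_(t in [set` `[a, x]]) f t) => s as_.
have ss1 : s < s + 1 by rewrite ltrDl.
have ci : lebesgue_measure.-integrable `[a, s + 1] (EFin \o f).
  apply: continuous_compact_integrable; first exact: segment_compact.
  exact: continuous_subspaceT.
have [df dfE] := @continuous_FTC1_closed _ f a s _ ss1 ci as_ (cf s).
by apply: DeriveDef; [exact: df|rewrite -derive1E dfE].
Qed.

Lemma is_derive_comp_opp F s d : is_derive (- s) 1 F d ->
  is_derive s 1 (fun x => - F (- x)) d.
Proof.
move=> HF; apply: (isd_eq (isd_opp (isd_comp HF (isd_opp (isd_id s))))).
by rewrite mulrN1 opprK.
Qed.

(** The fundamental theorem of calculus yields primitives on half-lines that are bounded
    below; one for f and a reflected one for x |-> f (- x) are glued at 0. *)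
Lemma antiderivative_exists f : continuous f ->
  exists F, forall s, is_derive s 1 F (f s).
Proof.
move=> cf.
have [F HF] := @antiderivative_right f (-1) cf.
have cfN : continuous (f \o -%R).
  by move=> x; apply: continuous_comp; [exact: opp_continuous|exact: cf].
have [H HH] := @antiderivative_right (f \o -%R) (-1) cfN.
pose G := fun x => - H (- x).
have HG s : s < 1 -> is_derive s 1 G (f s).
  move=> s1; apply: is_derive_comp_opp; have := HH (- s); rewrite /= opprK.
  by apply; rewrite ltrN2.
have FG s : -1 < s < 1 -> F s - F 0 = G s - G 0.
  move=> /andP[s1 s2].
  have HFG (x : R) : -1 < x < 1 -> is_derive x 1 (F - G) 0.
    move=> /andP[/HF HF' /HG HG']; rewrite -(subrr (f x)); exact: is_deriveB.
  have : (F - G) s = (F - G) 0.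
    have [s0|s0] := leP 0 s.
      apply/esym/zero_derivative => // x /andP[x0 xs]; apply: HFG; apply/andP; split; lra.
    apply: zero_derivative => [|x /andP[x0 xs]]; first exact: ltW.
    by apply: HFG; apply/andP; split; lra.
  by rewrite !fctE; lra.
exists (fun x => if 0 < x then F x - F 0 else G x - G 0) => s.
have [s0|s0] := ltP (-1) s.
  apply: (@near_eq_is_derive _ _ _ (fun x => F x - F 0)); last first.
    have := HF _ s0 => ?; rewrite -[f s]subr0.
    by apply: (is_deriveB _ (is_derive_cst (F 0) _ _)).
  near=> x; case: ifPn => //; rewrite -leNgt => x0.
  apply: FG; apply/andP; split; last lra.
  near: x; exact: lt_nbhsr.
apply: (@near_eq_is_derive _ _ _ (fun x => G x - G 0)); last first.
  have s1 : s < 1 by lra.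
  have := HG _ s1 => ?; rewrite -[f s]subr0.
  by apply: (is_deriveB _ (is_derive_cst (G 0) _ _)).
near=> x; rewrite ifF //; apply/negbTE; rewrite -leNgt ltW //.
near: x; apply: lt_nbhsl; lra.
Unshelve. all: by end_near. Qed.

(** The chosen primitive lives on the whole line, so that every bound of an integral
    is an instance of mean_value_bound. *)
Definition primitive f : R -> R := get [set F | forall s, is_derive s 1 F (f s)].

Definition integ a b f : R := primitive f b - primitive f a.

Lemma primitiveP f s : continuous f -> is_derive s 1 (primitive f) (f s).
Proof.
move=> cf; have [F HF] := antiderivative_exists cf.
by have := @getI _ [set F | forall s, is_derive s 1 F (f s)] F HF; apply.
Qed.

Lemma int_primitive F f a b : a <= b -> continuous f ->
  (forall s, is_derive s 1 F (f s)) -> integ a b f = F b - F a.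
Proof.
move=> ab cf HF; rewrite /integ.
have : F a - primitive f a = F b - primitive f b.
  apply: (@zero_derivative (fun x => F x - primitive f x)) => // s _.
  by apply: (isd_eq (isd_sub (HF s) (primitiveP s cf))); rewrite subrr.
by lra.
Qed.

Lemma int_eq F f a b d : a <= b -> continuous f ->
  (forall s, is_derive s 1 F (f s)) -> F b - F a = d -> integ a b f = d.
Proof. by move=> ab cf HF <-; exact: int_primitive. Qed.

Lemma int_sub f g a b : a <= b -> continuous f -> continuous g ->
  integ a b (fun x => f x - g x) = integ a b f - integ a b g.
Proof.
move=> ab cf cg.
have c : continuous (fun x => f x - g x).
  by move=> x; apply: continuousB; [exact: cf|exact: cg].
have H s : is_derive s 1 (fun x => primitive f x - primitive g x) (f s - g s) by apply: isd_sub; exact: primitiveP.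
by rewrite (int_primitive ab c H) /integ; lra.
Qed.

Lemma int_add f g a b : a <= b -> continuous f -> continuous g ->
  integ a b (fun x => f x + g x) = integ a b f + integ a b g.
Proof.
move=> ab cf cg.
have c : continuous (fun x => f x + g x).
  by move=> x; apply: continuousD; [exact: cf|exact: cg].
have H s : is_derive s 1 (fun x => primitive f x + primitive g x) (f s + g s) by apply: isd_add; exact: primitiveP.
by rewrite (int_primitive ab c H) /integ; lra.
Qed.

Lemma int_scale k f a b : a <= b -> continuous f ->
  integ a b (fun x => k * f x) = k * integ a b f.
Proof.
move=> ab cf.
have c : continuous (fun x => k * f x).
  by apply: cont_mul cf; exact: cont_cst.
have H s : is_derive s 1 (fun x => k * primitive f x) (k * f s) by apply: isd_mull; exact: primitiveP.
by rewrite (int_primitive ab c H) /integ; lra.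
Qed.

Lemma int_le f K dK a b : a <= b -> continuous f ->
  {within `[a, b], continuous K} ->
  (forall s, a < s < b -> is_derive s 1 K (dK s)) ->
  (forall s, a < s < b -> `|f s| <= dK s) ->
  `|integ a b f| <= K b - K a.
Proof.
move=> ab cf cK HK le_f; apply: (@mean_value_bound (primitive f) K f dK) => //.
- apply: continuous_subspaceT => x.
  exact: (is_derive_continuous (primitiveP x cf)).
- by move=> s _; exact: primitiveP.
Qed.

Lemma int_le_const f m a b : a <= b -> continuous f ->
  (forall s, a <= s <= b -> `|f s| <= m) -> `|integ a b f| <= m * (b - a).
Proof.
move=> ab cf le_f; rewrite mulrBr.
apply: (@int_le f (fun x => m * x) (fun=> m)) => //.
- by apply: continuous_subspaceT => x; exact: mulrl_continuous.
- by move=> s _; apply: (isd_eq (isd_mull m (isd_id s))); rewrite mulr1.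
- by move=> s /andP[? ?]; apply: le_f; rewrite !ltW.
Qed.

Lemma near_uniformly (X : topologicalType) (g : X -> R -> R) a b (x : X) (e : R) :
  0 < e -> continuous (fun p : X * R => g p.1 p.2) ->
  \forall x' \near x, forall y, a <= y <= b -> `|g x' y - g x y| <= e.
Proof.
move=> e0 cg.
have cab : compact `[a, b]%classic by exact: segment_compact.
have H : \forall x' \near x, `[a, b]%classic `<=` (fun y => `|g x' y - g x y| <= e).
  apply: (compact_near_coveringP _).1 (cab) _ _ (fun (x' : X) (y : R) => `|g x' y - g x y| <= e) _ _ => y _.
  have e2 : 0 < e / 2 by rewrite divr_gt0.
  have /cvgrPdist_le/(_ _ e2) H1 := cg (x, y).
  have H2 : \forall y' \near y, `|g x y - g x y'| <= e / 2.
    by have /cvgrPdist_le/(_ _ e2) := @continuous_section _ _ _ g x cg y.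
  case: H1 => -[A B] /= [nA nB] sAB.
  exists (B `&` [set y' | `|g x y - g x y'| <= e / 2], A) => /=.
    by split => //; exact: filterI.
  move=> [y' x'] /= [[By' gy'] Ax'].
  have -> : g x' y' - g x y' = (g x y - g x y') - (g x y - g x' y') by lra.
  rewrite (le_trans (ler_normB _ _)) // [leRHS](splitr e) lerD //.
  exact: (sAB (x', y')).
by apply: filterS H => x' H y yab; apply: H; rewrite /= in_itv.
Qed.

Lemma int_continuous (X : topologicalType) (g : X -> R -> R) a b : a <= b ->
  continuous (fun p : X * R => g p.1 p.2) -> continuous (fun x => integ a b (g x)).
Proof.
move=> ab cg x; apply/cvgrPdist_le => e e0.
have ba1 : 0 < b - a + 1 by lra.
have e1 : 0 < e / (b - a + 1) by rewrite divr_gt0.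
near=> x'.
rewrite -int_sub //; try exact: continuous_section.
apply: le_trans (int_le_const (m := e / (b - a + 1)) ab _ _) _.
- by move=> y; apply: continuousB; exact: continuous_section.
- move=> y yab; rewrite distrC; move: y yab; near: x'.
  exact: near_uniformly.
- by rewrite -mulrA ler_piMr ?(ltW e0)// mulrC ler_pdivrMr // mul1r; lra.
Unshelve. all: by end_near. Qed.

(** Differentiation under the integral: by the mean value theorem the difference
    quotient is a value of the derivative at a nearby time, and compactness of
    the interval makes its continuity uniform. *)
Lemma int_derive (g g' : R -> R -> R) a b s1 s2 : a <= b ->
  (forall s, s1 < s < s2 -> forall y, is_derive s 1 (fun s => g s y) (g' s y)) ->
  (forall s, continuous (g s)) ->
  continuous (fun p : R * R => g' p.1 p.2) ->
  forall s, s1 < s < s2 -> is_derive s 1 (fun s => integ a b (g s)) (integ a b (g' s)).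
Proof.
move=> ab Hg cg cg' s /andP[s1s ss2].
have cg's s' : continuous (g' s') by exact: continuous_section.
have ba1 : 0 < b - a + 1 by lra.
suff H : h^-1 *: (integ a b (g (h *: (1 : R) + s)) - integ a b (g s)) @[h --> 0^'] --> integ a b (g' s).
  by apply: DeriveDef; [apply/cvg_ex; exists (integ a b (g' s))|apply: cvg_lim].
apply/cvgrPdist_le => e e0.
have e1 : 0 < e / (b - a + 1) by rewrite divr_gt0.
have := near_uniformly a b s e1 cg'.
move=> /nbhs_ballP[d /= d0 Hd].
near=> h.
have h0 : h != 0 by near: h; exact: nbhs_dnbhs_neq.
have hd : `|h| < Num.min d (Num.min (s - s1) (s2 - s)).
  by near: h; apply: dnbhs0_lt; rewrite !lt_min d0 !subr_gt0 s1s ss2.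
move: hd; rewrite !lt_min => /and3P[hd hs1 hs2].
rewrite scaler1 /GRing.scale /=.
have cd : continuous (fun y => g (h + s) y - g s y).
  by move=> y; apply: continuousB; exact: cg.
have cq : continuous (fun y => h^-1 * (g (h + s) y - g s y)).
  by apply: cont_mul cd; exact: cont_cst.
rewrite -int_sub // -int_scale // -int_sub //.
apply: le_trans (int_le_const (m := e / (b - a + 1)) ab _ _) _.
- by apply: cont_sub => //; exact: cg's.
- move=> y yab.
  have [xi xiin ->] : exists2 xi, `|xi - s| < d & h^-1 * (g (h + s) y - g s y) = g' xi y.
    have Hd' z : `|z - s| <= `|h| -> s1 < z < s2.
      by rewrite ler_distl => /andP[? ?]; apply/andP; split; lra.
    have Hc u v : (forall z, u <= z <= v -> `|z - s| <= `|h|) ->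
        {within `[u, v], continuous (fun s => g s y)}.
      move=> Huv; apply: derivable_within_continuous => z; rewrite in_itv /= => /Huv/Hd' zz.
      by have := Hg _ zz y => ?; exact: ex_derive.
    have [hp|hn] : 0 < h \/ h < 0 by case: (ltgtP h 0) h0 => //; auto.
      have Hin z : s <= z <= h + s -> `|z - s| <= `|h|.
        by move=> /andP[z1 z2]; rewrite ger0_norm ?gtr0_norm; lra.
      have lt1 : s < h + s by lra.
      have [||xi xiin E] := @MVT _ (fun s => g s y) (fun s => g' s y) s (h + s) lt1.
      - move=> z; rewrite in_itv /= => /andP[? ?]; apply: Hg; apply: Hd'; apply: Hin.
        by apply/andP; split; lra.
      - exact: Hc.
      move: xiin; rewrite in_itv /= => /andP[? ?].
      exists xi; first by apply: le_lt_trans hd; apply: Hin; apply/andP; split; lra.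
      by rewrite E; field.
    have Hin z : h + s <= z <= s -> `|z - s| <= `|h|.
      by move=> /andP[z1 z2]; rewrite ler0_norm ?ltr0_norm; lra.
    have lt1 : h + s < s by lra.
    have [||xi xiin E] := @MVT _ (fun s => g s y) (fun s => g' s y) (h + s) s lt1.
    - move=> z; rewrite in_itv /= => /andP[? ?]; apply: Hg; apply: Hd'; apply: Hin.
      by apply/andP; split; lra.
    - exact: Hc.
    move: xiin; rewrite in_itv /= => /andP[? ?].
    exists xi; first by apply: le_lt_trans hd; apply: Hin; apply/andP; split; lra.
    by rewrite -opprB E; field.
  by rewrite distrC; apply: Hd => //; rewrite /ball /= distrC.
- by rewrite -mulrA ler_piMr ?(ltW e0)// mulrC ler_pdivrMr // mul1r; lra.
Unshelve. all: by end_near. Qed.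

End OneVariable.

(** * One-sided calculus on the closed half-space *)

Section HalfSpace.
Context {R : realType}.
Local Notation PT := (R * 'rV[R]_3)%type.
Local Notation H := (@halfspace R).
Local Notation D v f := (derive_within H f v).
Implicit Types (f g : PT -> R) (p v w : PT) (j k : 'I_3).

Definition quotient_filter p v : set_system R :=
  within [set h : R | H (h *: v + p)] 0^'.

Instance quotient_filter_filter p v : Filter (quotient_filter p v).
Proof. exact: within_filter. Qed.

Lemma quotient_filter_near p v (P : R -> Prop) :
  (forall h, h != 0 -> H (h *: v + p) -> P h) -> \forall h \near quotient_filter p v, P h.
Proof. by move=> PP; apply: (@filterE _ (nbhs (0 : R))) => h h0 Hh; exact: PP. Qed.

Lemma quotient_filter_proper p v : H p -> ProperFilter (quotient_filter p v).
Proof.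
move=> Hp; apply: Build_ProperFilter_ex => B.
rewrite /quotient_filter /within /= => /nbhs_ballP[d /= d0 Hd].
have d2 : 0 < d / 2 by rewrite divr_gt0.
have bd h : `|h| = d / 2 -> ball (0 : R) d h.
  move=> hd; rewrite /ball /= sub0r normrN hd.
  by rewrite ltr_pdivrMr // ltr_pMr // ltr1n.
have [v0|v0] := leP 0 v.1.
  exists (d / 2); apply: Hd; [apply: bd; exact: gtr0_norm|exact: lt0r_neq0|].
  by rewrite /halfspace /=; apply: addr_ge0 => //; apply: mulr_ge0 => //; exact: ltW.
exists (- (d / 2)); apply: Hd.
- by apply: bd; rewrite normrN; exact: gtr0_norm.
- by rewrite /= oppr_eq0; exact: lt0r_neq0.
- rewrite /halfspace /=; apply: addr_ge0 => //.
  by rewrite /GRing.scale /= mulNr -mulrN; apply: mulr_ge0; [exact: ltW|rewrite oppr_ge0 ltW].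
Qed.

Lemma quotient_filter_full p v :
  (\forall h \near 0^', H (h *: v + p)) -> quotient_filter p v = 0^'.
Proof.
move=> near_H; rewrite eqEsubset; split=> B /=.
  by move=> HB; apply: filterS2 near_H HB => h Hh; apply.
by move=> HB; apply: filterS HB => h Bh _.
Qed.

Lemma quotient_filter_interior p v : 0 < p.1 -> quotient_filter p v = 0^'.
Proof.
move=> p0; apply: quotient_filter_full.
have lim : (fun h : R => h * v.1 + p.1) @ (0 : R) --> 0 * v.1 + p.1.
  by apply: cvgD; [apply: cvgM; [exact: cvg_id|exact: cvg_cst]|exact: cvg_cst].
rewrite mul0r add0r in lim.
apply: nbhs_dnbhs; apply: (lim (fun y => 0 <= y)).
by apply: filterS (lt_nbhsr p0) => y; exact: ltW.
Qed.

Lemma diff_quotientE f p v : diff_quotient_within H f p v =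
  (fun h => h^-1 * (f (h *: v + p) - f p)) @ quotient_filter p v.
Proof. by []. Qed.

Lemma derive_within_unique f p v (l : R) : H p ->
  diff_quotient_within H f p v --> l -> D v f p = l.
Proof.
by move=> Hp cvl; have PF := quotient_filter_proper v Hp; apply: cvg_lim.
Qed.

Lemma diff_quotient_congr f g p v : H p -> (forall q, H q -> f q = g q) ->
  diff_quotient_within H f p v = diff_quotient_within H g p v.
Proof.
move=> Hp fg; rewrite !diff_quotientE eqEsubset.
have near_eq : \forall h \near quotient_filter p v,
    h^-1 * (f (h *: v + p) - f p) = h^-1 * (g (h *: v + p) - g p).
  by apply: quotient_filter_near => h _ Hh; rewrite !fg.
split; apply: near_eq_cvg => //.
by apply: filterS near_eq => h ->.
Qed.

Lemma derive_within_congr f g p v : H p -> (forall q, H q -> f q = g q) ->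
  D v f p = D v g p.
Proof. by move=> Hp fg; rewrite /derive_within (diff_quotient_congr v Hp fg). Qed.

Definition iterated f (vs : seq PT) := foldr (fun v g => D v g) f vs.

Lemma smooth_continuous f : smooth f -> {within H, continuous f}.
Proof. by move=> /(_ [::]) []. Qed.

Lemma smooth_cvg f p v : smooth f -> H p -> diff_quotient_within H f p v --> D v f p.
Proof. by move=> /(_ [::]) [_ df] Hp; exact: (df p v Hp). Qed.

Lemma smooth_derive f v : smooth f -> smooth (D v f).
Proof.
move=> sf vs /=; have := sf (rcons vs v).
by rewrite foldr_rcons.
Qed.

(** Smoothness can be shown by exhibiting a class of functions that is stable,
    up to the values outside the half-space, under all directional derivatives. *)
Lemma smooth_class (C : (PT -> R) -> Prop) f :
  (forall g, C g -> {within H, continuous g}) ->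
  (forall g, C g -> forall v, exists2 g', C g' &
     forall p, H p -> diff_quotient_within H g p v --> g' p) ->
  C f -> smooth f.
Proof.
move=> cont_C der_C Cf.
have rep vs : exists2 g, C g & forall p, H p -> iterated f vs p = g p.
  elim: vs => [|v vs [g Cg fg]] /=; first by exists f.
  have [g' Cg' gg'] := der_C g Cg v.
  exists g' => // p Hp; apply: derive_within_unique => //.
  by rewrite (diff_quotient_congr v Hp fg); exact: gg'.
move=> vs; have [g Cg fg] := rep vs; split=> [|p v Hp].
  apply: (subspace_eq_continuous (f := g)); last exact: cont_C.
  by move=> p; rewrite inE => Hp; rewrite -fg.
have [g' _ gg'] := der_C g Cg v; apply/cvg_ex; exists (g' p).
by rewrite (diff_quotient_congr v Hp fg); exact: gg'.
Qed.

Inductive smooth_combination : (PT -> R) -> Prop :=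
| combination_smooth f : smooth f -> smooth_combination f
| combination_add f g : smooth_combination f -> smooth_combination g ->
    smooth_combination (fun p => f p + g p)
| combination_scale a f : smooth_combination f -> smooth_combination (fun p => a * f p)
| combination_coord j f : smooth_combination f ->
    smooth_combination (fun p => p.2 0 j * f p).

Lemma coord_continuous_within j : {within H, continuous (fun p : PT => p.2 0 j)}.
Proof.
apply: continuous_subspaceT => p.
apply: (@continuous_comp _ _ _ (fun q : PT => q.2) (fun x : 'rV[R]_3 => x 0 j)).
  exact: cvg_snd.
exact: coord_continuous.
Qed.

Lemma quotient_continuous f p v : H p -> {within H, continuous f} ->
  f (h *: v + p) @[h --> quotient_filter p v] --> f p.
Proof.
move=> Hp cf.
have cfp : f @ within H (nbhs p) --> f p.
  by have := cf p; rewrite /continuous_at /= nbhs_subspace_in.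
apply: cvg_trans cfp => B HB.
rewrite /quotient_filter /within /=.
have lin : (fun h : R => h *: v + p) @ (0 : R) --> 0 *: v + p.
  by apply: cvgD; [apply: cvgZ; [exact: cvg_id|exact: cvg_cst]|exact: cvg_cst].
rewrite scale0r add0r in lin.
apply: nbhs_dnbhs.
exact: (lin _ HB).
Qed.

Lemma combination_continuous f : smooth_combination f -> {within H, continuous f}.
Proof.
elim=> {f} [f /smooth_continuous //|f g _ cf _ cg|a f _ cf|j f _ cf].
- exact: within_continuousD.
- by move=> p; apply: cvgM; [exact: cvg_cst|exact: cf].
- by move=> p; apply: cvgM; [exact: coord_continuous_within|exact: cf].
Qed.

Lemma smooth_of_combination f : smooth_combination f -> smooth f.
Proof.
apply: smooth_class => // [g /combination_continuous //|g].
elim=> {g} [g sg|g1 g2 s1 IH1 s2 IH2|a g sg IH|j g sg IH] v.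
- exists (D v g); first by apply: combination_smooth; exact: smooth_derive.
  by move=> p; exact: smooth_cvg.
- have [d1 c1 H1] := IH1 v; have [d2 c2 H2] := IH2 v.
  exists (fun p => d1 p + d2 p); first exact: combination_add.
  move=> p Hp; rewrite diff_quotientE.
  under eq_fun => h do rewrite opprD addrACA mulrDr.
  by apply: cvgD; [exact: H1|exact: H2].
- have [d c1 H1] := IH v.
  exists (fun p => a * d p); first exact: combination_scale.
  move=> p Hp; rewrite diff_quotientE.
  under eq_fun => h do rewrite -mulrBr mulrCA.
  by apply: cvgM; [exact: cvg_cst|exact: H1].
- have [d c1 H1] := IH v.
  exists (fun p => v.2 0 j * g p + p.2 0 j * d p).
    by apply: combination_add; [exact: combination_scale|exact: combination_coord].
  move=> p Hp; rewrite diff_quotientE.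
  have lim : v.2 0 j * g (h *: v + p) + p.2 0 j * (h^-1 * (g (h *: v + p) - g p))
      @[h --> quotient_filter p v] --> v.2 0 j * g p + p.2 0 j * d p.
    apply: cvgD; apply: cvgM; try exact: cvg_cst; last exact: H1.
    by apply: quotient_continuous => //; exact: combination_continuous.
  apply: cvg_trans lim; apply: near_eq_cvg.
  by apply: quotient_filter_near => h h0 _; rewrite /= !mxE; field.
Qed.

Lemma is_derive_interior f p v : smooth f -> 0 < p.1 -> is_derive p v f (D v f p).
Proof.
move=> sf p0; have := smooth_cvg (v := v) sf (ltW p0 : H p).
rewrite diff_quotientE (quotient_filter_interior v p0) => cvD.
by apply: DeriveDef; [apply/cvg_ex; exists (D v f p)|apply: cvg_lim].
Qed.

Definition clamp p : PT := (Num.max 0 p.1, p.2).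

(** Negative times are replaced by 0.  A function that is continuous on the half-space
    becomes continuous everywhere, so that it can be integrated along rays and
    over spheres without tracking the sign of the time. *)
Definition extend f : PT -> R := fun p => f (clamp p).

Lemma clamp_in p : H (clamp p).
Proof. by rewrite /halfspace /= le_max lexx. Qed.

Lemma clamp_id p : H p -> clamp p = p.
Proof. by case: p => t x /= ; rewrite /halfspace /clamp /= => /max_r ->. Qed.

Lemma extendE f p : H p -> extend f p = f p.
Proof. by move=> Hp; rewrite /extend clamp_id. Qed.

Lemma clamp_continuous : continuous clamp.
Proof.
apply: continuous_pair => p; last exact: cvg_snd.
apply: (@continuous_comp _ _ _ (fun q : PT => q.1) (fun t => Num.max 0 t)).
  exact: cvg_fst.
by apply: continuous_max; [exact: cvg_cst|exact: cvg_id].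
Qed.

Lemma extend_continuous f : {within H, continuous f} -> continuous (extend f).
Proof.
move=> cf p B.
have cfp : f @ within H (nbhs (clamp p)) --> f (clamp p).
  by have := cf (clamp p); rewrite /continuous_at /= nbhs_subspace_in //; exact: clamp_in.
move=> /cfp HB.
have HB' : nbhs (clamp p) [set q | H q -> B (f q)] := HB.
apply: (@filterS _ (nbhs p) _ [set q | H (clamp q) -> B (f (clamp q))]).
  by move=> q /=; apply; exact: clamp_in.
exact: (@clamp_continuous p _ HB').
Qed.

Lemma smooth_extend_continuous f : smooth f -> continuous (extend f).
Proof. by move/smooth_continuous/extend_continuous. Qed.

Lemma interior_near p : 0 < p.1 -> nbhs p [set q : PT | 0 < q.1].
Proof.
move=> p0; have lim : (fun q : PT => q.1) @ p --> p.1 by exact: cvg_fst.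
exact: (lim _ (lt_nbhsr p0)).
Qed.

Lemma smooth_continuous_at f p : smooth f -> 0 < p.1 -> {for p, continuous f}.
Proof.
move=> sf p0; have c := smooth_extend_continuous sf (x := p).
rewrite /prop_for /continuous_at -[X in _ --> X](extendE _ (ltW p0 : H p)).
apply: cvg_trans c; apply: near_eq_cvg.
by apply: filterS (interior_near p0) => q q0; rewrite extendE //; exact: ltW.
Qed.

Lemma smooth_near f p (e : R) : smooth f -> 0 < p.1 -> 0 < e ->
  nbhs p [set q : PT | `|f p - f q| <= e].
Proof. by move=> sf p0 e0; have /cvgrPdist_le := smooth_continuous_at sf p0; apply. Qed.

(** A point of the boundary is a limit of interior points in the time direction. *)
Lemma boundary_limit f g : {within H, continuous f} -> {within H, continuous g} ->
  (forall p, 0 < p.1 -> f p = g p) -> forall p, H p -> f p = g p.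
Proof.
move=> cf cg fg p Hp.
have [p0|p0] := ltP 0 p.1; first exact: fg.
have PF := quotient_filter_proper (1, 0) Hp.
have F := @quotient_continuous _ p (1, 0) Hp cf.
have G := @quotient_continuous _ p (1, 0) Hp cg.
apply: (cvg_unique (@norm_hausdorff _ R) F) => /=.
apply: cvg_trans G; apply: near_eq_cvg.
apply: quotient_filter_near => h h0; rewrite /halfspace /= => hp; apply/esym/fg.
have p10 : p.1 = 0 by apply/eqP; rewrite eq_le p0.
by move: hp; rewrite /= p10 addr0 scaler1 le_eqVlt eq_sym (negbTE h0).
Qed.

Lemma is_derive_line f q v (t l : R) : is_derive (t *: v + q) v f l ->
  is_derive t 1 (fun t => f (t *: v + q)) l.
Proof.
move=> [dv vE].
have E : (fun h : R => h^-1 *: (((fun t => f (t *: v + q)) \o shift t) (h *: 1) - f (t *: v + q)))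
       = (fun h : R => h^-1 *: ((f \o shift (t *: v + q)) (h *: v) - f (t *: v + q))).
  by apply/funext => h /=; rewrite scaler1 scalerDl addrA.
by apply: DeriveDef; rewrite /derivable /derive E.
Qed.

(** The mean value theorem on the segment from q to a v + q; the estimate is uniform in
    the base point q because the directional derivative is continuous. *)
Lemma increment_along f p v (e : R) : smooth f -> 0 < p.1 -> 0 < e ->
  \forall q \near p & a \near (0 : R), `|f (a *: v + q) - f q - a * D v f p| <= e * `|a|.
Proof.
move=> sf p0 e0.
have cD := smooth_continuous_at (smooth_derive v sf) p0.
have near_D : \forall q \near p, 0 < q.1 /\ `|D v f p - D v f q| <= e.
  by apply: filterI; [exact: interior_near|move/cvgrPdist_le: cD => /(_ _ e0)].
have lin : (fun z : PT * R => z.2 *: v + z.1) @ (p, 0 : R) --> 0 *: v + p.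
  apply: cvgD; last exact: cvg_fst.
  by apply: cvgZ; [exact: cvg_snd|exact: cvg_cst].
rewrite scale0r add0r in lin.
have [[A B] /= [nA nB] sAB] := lin _ near_D.
move/nbhs_ballP: nB => [d /= d0 Hd].
exists (A, ball 0 d) => /=; first by split => //; exact: nbhsx_ballx.
move=> [q a] /= [Aq ad].
pose phi t := f (t *: v + q).
have in_d (t : R) : `|t| <= `|a| -> ball 0 d t.
  move=> ta; move: ad; rewrite /ball /= !sub0r !normrN; exact: le_lt_trans.
have Hphi (t : R) : `|t| <= `|a| -> is_derive t 1 phi (D v f (t *: v + q)).
  move=> ta; have [/= q0 _] := sAB (q, t) (conj Aq (Hd _ (in_d _ ta))).
  exact: (is_derive_line (@is_derive_interior f (t *: v + q) v sf q0)).
have in_le0 (t : R) : `|t| <= `|a| -> `|D v f p - D v f (t *: v + q)| <= e.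
  by move=> ta; have [/= _ ] := sAB (q, t) (conj Aq (Hd _ (in_d _ ta))).
have c_phi (u w : R) : (forall t, u <= t <= w -> `|t| <= `|a|) -> {within `[u, w], continuous phi}.
  move=> uw; apply: derivable_within_continuous => t; rewrite in_itv /= => /uw/Hphi ?.
  exact: ex_derive.
have phi0 : phi 0 = f q by rewrite /phi scale0r add0r.
have [xi xia E] : exists2 xi, `|xi| <= `|a| & phi a - phi 0 = D v f (xi *: v + q) * a.
  have [a0|a0] := leP 0 a.
    have in_a (t : R) : 0 <= t <= a -> `|t| <= `|a|.
      by move=> /andP[t0 ta]; rewrite !ger0_norm.
    have [|xi xiin E] := @MVT_segment _ phi (fun t => D v f (t *: v + q)) 0 a a0 _ (c_phi _ _ in_a).
      by move=> t; rewrite in_itv /= => /andP[/ltW ? /ltW ?]; apply/Hphi/in_a/andP.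
    by exists xi; [apply: in_a; move: xiin; rewrite in_itv|rewrite E subr0].
  have in_a (t : R) : a <= t <= 0 -> `|t| <= `|a|.
    by move=> /andP[t0 ta]; rewrite !ler0_norm ?lerN2 // ltW.
  have [|xi xiin E] := @MVT_segment _ phi (fun t => D v f (t *: v + q)) a 0 (ltW a0) _ (c_phi _ _ in_a).
    by move=> t; rewrite in_itv /= => /andP[/ltW ? /ltW ?]; apply/Hphi/in_a/andP.
  exists xi; first by apply: in_a; move: xiin; rewrite in_itv.
  by rewrite -opprB E sub0r mulrN opprK.
rewrite -/(phi a) -phi0 E -[a * _]mulrC -mulrBl normrM ler_wpM2r // distrC.
exact: in_le0.
Qed.

Lemma increment_cvg f p v (q : R -> PT) (a : R -> R) (l : R) : smooth f -> 0 < p.1 ->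
  q @ 0^' --> p -> a @ 0^' --> (0 : R) -> h^-1 * a h @[h --> 0^'] --> l ->
  h^-1 * (f (a h *: v + q h) - f (q h)) @[h --> 0^'] --> l * D v f p.
Proof.
move=> sf p0 cq ca cl.
have cl' : h^-1 * a h * D v f p @[h --> 0^'] --> l * D v f p.
  by apply: cvgM => //; exact: cvg_cst.
rewrite -[X in _ --> X]add0r.
have -> : (fun h : R => h^-1 * (f (a h *: v + q h) - f (q h))) =
  (fun h => h^-1 * (f (a h *: v + q h) - f (q h) - a h * D v f p) + h^-1 * a h * D v f p).
  by apply/funext => h; ring.
apply: cvgD cl'.
apply/cvgrPdist_le => e e0.
have l1 : 0 < `|l| + 1 by rewrite ltr_wpDl.
have e1 : 0 < e / (`|l| + 1) by rewrite divr_gt0.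
have pr : (fun h : R => (q h, a h)) @ 0^' --> (p, 0 : R) by exact: (cvg_pair cq ca).
have near_inc := pr _ (increment_along v sf p0 e1).
move/cvgrPdist_le: cl => /(_ 1 ltr01) near_l.
near=> h; rewrite sub0r normrN normrM.
have inc : `|f (a h *: v + q h) - f (q h) - a h * D v f p| <= e / (`|l| + 1) * `|a h|.
  by near: h; exact: near_inc.
have lh : `|h^-1 * a h| <= `|l| + 1.
  have : `|l - h^-1 * a h| <= 1 by near: h.
  have := ler_normB l (l - h^-1 * a h); rewrite opprB addrCA subrr addr0; lra.
apply: (@le_trans _ _ (e / (`|l| + 1) * `|h^-1 * a h|)).
  by rewrite [X in _ <= _ * X]normrM mulrCA ler_wpM2l.
by rewrite -mulrA ler_piMr ?(ltW e0) // mulrC ler_pdivrMr // mul1r.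
Unshelve. all: by end_near. Qed.

Lemma ord3P (j : 'I_3) : [\/ j = 0, j = 1 | j = 2].
Proof.
by case: j => -[|[|[|//]]] i; [apply: Or31|apply: Or32|apply: Or33]; apply: val_inj.
Qed.

Lemma sum3 (F : 'I_3 -> R) : \sum_j F j = F 0 + F 1 + F 2.
Proof.
rewrite !big_ord_recl big_ord0 addr0 addrA; congr (_ + F _ + F _); exact: val_inj.
Qed.

(** An increment in space-time is a sum of four increments parallel to the axes; each
    is differentiable uniformly in its base point, by increment_along. *)
Lemma chain_rule f (tau : R -> R) (gam : R -> 'rV[R]_3) (s dtau : R) (dgam : 'I_3 -> R) :
  smooth f -> 0 < tau s -> is_derive s 1 tau dtau ->
  (forall j, is_derive s 1 (fun s => gam s 0 j) (dgam j)) ->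
  is_derive s 1 (fun s => f (tau s, gam s))
    (dtau * pdt f (tau s, gam s) + \sum_j dgam j * pdx j f (tau s, gam s)).
Proof.
move=> sf t0 Htau Hgam; set p := (tau s, gam s).
have incr (b : R -> R) (db : R) : is_derive s 1 b db ->
    h^-1 * (b (h + s) - b s) @[h --> 0^'] --> db /\ b (h + s) - b s @[h --> 0^'] --> (0 : R).
  move=> Hb; split.
    have [/cvg_ex[l cl] E] := Hb.
    have El : db = l by rewrite -E; apply: cvg_lim.
    rewrite El; move: cl; apply: cvg_trans; apply: near_eq_cvg; near=> h.
    by rewrite /= scaler1.
  rewrite -[X in _ --> X](subrr (b s)); apply: cvgD; last exact: cvg_cst.
  have cb := is_derive_continuous Hb.
  have lin : (fun h : R => h + s) @ 0^' --> s.
    rewrite -[X in _ --> X]add0r; apply: cvgD; last exact: cvg_cst.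
    exact: nbhs_dnbhs.
  exact: (cvg_comp _ _ lin cb).
pose b j := fun h => gam (h + s) 0 j - gam s 0 j.
pose a0 := fun h => tau (h + s) - tau s.
pose q0 := fun h : R => a0 h *: ((1, 0) : PT) + p.
pose q1 := fun h : R => b 0 h *: ((0, delta_mx 0 0) : PT) + q0 h.
pose q2 := fun h : R => b 1 h *: ((0, delta_mx 0 1) : PT) + q1 h.
pose q3 := fun h : R => b 2 h *: ((0, delta_mx 0 2) : PT) + q2 h.
have [l0 c0] := incr _ _ Htau.
have lj j := proj1 (incr _ _ (Hgam j)).
have cj j := proj2 (incr _ _ (Hgam j)).
have cv (q : R -> PT) (c : R -> R) v : q @ 0^' --> p -> c @ 0^' --> (0 : R) ->
    c h *: v + q h @[h --> 0^'] --> p.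
  move=> cq cc; rewrite -[X in _ --> X]add0r -(scale0r v).
  by apply: cvgD => //; apply: cvgZ => //; exact: cvg_cst.
have cp : (fun _ : R => p) @ 0^' --> p by exact: cvg_cst.
have cq0 : q0 @ 0^' --> p by exact: cv.
have cq1 : q1 @ 0^' --> p by exact: (cv _ _ _ cq0 (cj 0)).
have cq2 : q2 @ 0^' --> p by exact: (cv _ _ _ cq1 (cj 1)).
have q3E h : q3 h = (tau (h + s), gam (h + s)).
  rewrite /q3 /q2 /q1 /q0 /p /a0 /b /=; congr pair.
    by rewrite /= !scaler0 !add0r scaler1 subrK.
  by apply/rowP => j; case: (ord3P j) => ->; rewrite !mxE /= ?mulr0 ?mulr1 ?add0r ?addr0 subrK.
pose A (q q' : R -> PT) (h : R) := h^-1 * (f (q' h) - f (q h)).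
have I0 : A (fun=> p) q0 @ 0^' --> dtau * pdt f p.
  exact: (increment_cvg (v := (1, 0)) sf (t0 : 0 < p.1) cp c0 l0).
have I1 : A q0 q1 @ 0^' --> dgam 0 * pdx 0 f p.
  exact: (increment_cvg (v := (0, delta_mx 0 0)) sf (t0 : 0 < p.1) cq0 (cj 0) (lj 0)).
have I2 : A q1 q2 @ 0^' --> dgam 1 * pdx 1 f p.
  exact: (increment_cvg (v := (0, delta_mx 0 1)) sf (t0 : 0 < p.1) cq1 (cj 1) (lj 1)).
have I3 : A q2 q3 @ 0^' --> dgam 2 * pdx 2 f p.
  exact: (increment_cvg (v := (0, delta_mx 0 2)) sf (t0 : 0 < p.1) cq2 (cj 2) (lj 2)).
have L : h^-1 *: (f (tau (h + s), gam (h + s)) - f p) @[h --> 0^'] -->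
    dtau * pdt f p + \sum_j dgam j * pdx j f p.
  rewrite sum3 !addrA.
  have -> : (fun h : R => h^-1 *: (f (tau (h + s), gam (h + s)) - f p)) =
      (fun h => A (fun=> p) q0 h + A q0 q1 h + A q1 q2 h + A q2 q3 h).
    by apply/funext => h; rewrite -q3E /A /GRing.scale /=; ring.
  by apply: cvgD I3; apply: cvgD I2; apply: cvgD I1.
have E : (fun h : R => h^-1 *: (((fun s => f (tau s, gam s)) \o shift s) (h *: 1) - f p)) =
   (fun h : R => h^-1 *: (f (tau (h + s), gam (h + s)) - f p)).
  by apply/funext => h /=; rewrite scaler1.
apply: DeriveDef; rewrite /derivable /derive -/p E; last exact: cvg_lim.
by apply/cvg_ex; eexists; exact: L.
Unshelve. all: by end_near. Qed.

Lemma mvt_line f q v (h : R) : smooth f -> 0 < h ->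
  (forall t, 0 <= t <= h -> 0 < (t *: v + q).1) ->
  exists2 t, 0 <= t <= h & f (h *: v + q) - f q = h * D v f (t *: v + q).
Proof.
move=> sf h0 Hq.
have Hphi (t : R) : 0 <= t <= h -> is_derive t 1 (fun t => f (t *: v + q)) (D v f (t *: v + q)).
  by move=> th; apply: is_derive_line; apply: is_derive_interior => //; exact: Hq.
have [||t tin E] := @MVT_segment _ (fun t => f (t *: v + q)) (fun t => D v f (t *: v + q)) 0 h (ltW h0).
- by move=> t; rewrite in_itv /= => /andP[/ltW ? /ltW ?]; apply/Hphi/andP.
- apply: derivable_within_continuous => t; rewrite in_itv /= => /Hphi ?; exact: ex_derive.
exists t; first by move: tin; rewrite in_itv.
by move: E; rewrite scale0r add0r subr0 mulrC.
Qed.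

Lemma second_difference f p v w (h : R) : smooth f -> 0 < h ->
  (forall a b, 0 <= a <= h -> 0 <= b <= h -> 0 < (a *: v + (b *: w + p)).1) ->
  exists a b, [/\ 0 <= a <= h, 0 <= b <= h &
    f (h *: v + (h *: w + p)) - f (h *: w + p) - f (h *: v + p) + f p =
    h * h * D v (D w f) (a *: v + (b *: w + p))].
Proof.
move=> sf h0 Hin.
have h00 : 0 <= h <= h by rewrite lexx ltW.
have z00 : 0 <= (0 : R) <= h by rewrite lexx ltW.
pose g := fun q : PT => f (h *: v + q) - f q.
have Hphi (t : R) : 0 <= t <= h ->
    is_derive t 1 (fun t => g (t *: w + p)) (D w f (h *: v + (t *: w + p)) - D w f (t *: w + p)).
  move=> th; rewrite /g; apply: isd_sub.
    have -> : (fun t : R => f (h *: v + (t *: w + p))) = (fun t : R => f (t *: w + (h *: v + p))).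
      by apply/funext => u; rewrite addrCA.
    rewrite (addrCA (h *: v)); apply: is_derive_line; apply: is_derive_interior => //.
    by rewrite addrCA; exact: Hin.
  apply: is_derive_line; apply: is_derive_interior => //.
  by have := Hin 0 t z00 th; rewrite scale0r add0r.
have [||b bin E] := @MVT_segment _ (fun t => g (t *: w + p))
  (fun t => D w f (h *: v + (t *: w + p)) - D w f (t *: w + p)) 0 h (ltW h0).
- by move=> t; rewrite in_itv /= => /andP[/ltW ? /ltW ?]; apply/Hphi/andP.
- apply: derivable_within_continuous => t; rewrite in_itv /= => /Hphi ?; exact: ex_derive.
have {}bin : 0 <= b <= h by move: bin; rewrite in_itv.
have [a ain Ea] := mvt_line (smooth_derive w sf) h0 (fun a ah => Hin a b ah bin).
exists a, b; split => //.
move: E; rewrite Ea /g scale0r add0r subr0 => E.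
by rewrite [RHS]mulrAC -E; ring.
Qed.

(** Both mixed derivatives are limits of the second difference over small
    parallelograms, which is symmetric in the two directions. *)
Lemma derive_commute_interior f p v w : smooth f -> 0 < p.1 ->
  D v (D w f) p = D w (D v f) p.
Proof.
move=> sf p0; apply/eqP; rewrite -subr_eq0 -normr_le0; apply/ler_addgt0Pl => /= e e0; rewrite addr0.
have e2 : 0 < e / 2 by rewrite divr_gt0.
pose good (q : PT) : Prop := [/\ 0 < q.1, `|D v (D w f) p - D v (D w f) q| <= e / 2 &
   `|D w (D v f) p - D w (D v f) q| <= e / 2].
have near_good : nbhs p [set q : PT | good q].
  have H0 := interior_near p0.
  have H1 := smooth_near (smooth_derive v (smooth_derive w sf)) p0 e2.
  have H2 := smooth_near (smooth_derive w (smooth_derive v sf)) p0 e2.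
  refine (filterS3 _ _ H0 H1 H2).
  move=> q q0 q1 q2.
  exact: (And3 q0 q1 q2).
have lin : (fun z : R * R => z.1 *: v + (z.2 *: w + p)) @ (0 : R, 0 : R) --> 0 *: v + (0 *: w + p).
  apply: cvgD; first by apply: cvgZ; [exact: cvg_fst|exact: cvg_cst].
  by apply: cvgD; [apply: cvgZ; [exact: cvg_snd|exact: cvg_cst]|exact: cvg_cst].
rewrite !scale0r !add0r in lin.
have /nbhs_ballP[d /= d0 Hd] := lin _ near_good.
have h0 : 0 < d / 2 by rewrite divr_gt0.
have hd : d / 2 < d by rewrite ltr_pdivrMr // ltr_pMr // ltr1n.
have Hin a b : 0 <= a <= d / 2 -> 0 <= b <= d / 2 -> good (a *: v + (b *: w + p)).
  move=> /andP[a0 ah] /andP[b0 bh]; apply: (Hd (a, b)).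
  by split; rewrite /ball /= sub0r normrN ger0_norm //; exact: le_lt_trans hd.
have [|a [b [ain bin E1]]] := @second_difference f p v w _ sf h0.
  by move=> a b ain bin; have [] := Hin a b ain bin.
have [|a' [b' [ain' bin' E2]]] := @second_difference f p w v _ sf h0.
  by move=> b' a' ? ?; rewrite addrCA; have [] := Hin a' b'.
have [_ G1 _] := Hin a b ain bin.
have [_ _ G2] := Hin b' a' bin' ain'.
rewrite [b' *: v + _]addrCA in G2.
rewrite [d / 2 *: w + (d / 2 *: v + p)]addrCA in E2.
have tri (X Y X' Y' : R) : `|X - X'| <= e / 2 -> `|Y - Y'| <= e / 2 -> X' = Y' -> `|X - Y| <= e.
  move=> XX' YY' E; have -> : X - Y = (X - X') - (Y - Y') by rewrite E; ring.
  by rewrite (le_trans (ler_normB _ _)) // [leRHS](splitr e) lerD.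
have hh : d / 2 * (d / 2) != 0 by apply: lt0r_neq0; rewrite mulr_gt0.
refine (tri _ _ _ _ G1 G2 _); apply: (mulfI hh).
by refine (etrans (esym E1) (etrans _ E2)); ring.
Qed.

Lemma derive_commute f p v w : smooth f -> H p -> D v (D w f) p = D w (D v f) p.
Proof.
move=> sf; move: p; apply: boundary_limit.
- exact: smooth_continuous (smooth_derive v (smooth_derive w sf)).
- exact: smooth_continuous (smooth_derive w (smooth_derive v sf)).
- move=> p p0; exact: (derive_commute_interior _ _ sf p0).
Qed.

Lemma smooth_add f g : smooth f -> smooth g -> smooth (fun p => f p + g p).
Proof.
by move=> sf sg; apply: smooth_of_combination; apply: combination_add; exact: combination_smooth.
Qed.

Lemma smooth_scale a f : smooth f -> smooth (fun p => a * f p).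
Proof.
by move=> sf; apply: smooth_of_combination; apply: combination_scale; exact: combination_smooth.
Qed.

Lemma smooth_coord j f : smooth f -> smooth (fun p => p.2 0 j * f p).
Proof.
by move=> sf; apply: smooth_of_combination; apply: combination_coord; exact: combination_smooth.
Qed.

Lemma smooth_sub f g : smooth f -> smooth g -> smooth (fun p => f p - g p).
Proof.
move=> sf sg; have -> : (fun p => f p - g p) = (fun p => f p + -1 * g p).
  by apply/funext => p; rewrite mulN1r.
by apply: smooth_add => //; exact: smooth_scale.
Qed.

End HalfSpace.

(** * Vector fields and the Cauchy problem *)

Definition axis {R : realType} (i : option 'I_3) : R * 'rV[R]_3 :=
  if i is Some j then (0, delta_mx 0 j) else (1, 0).

(** None is the time direction.  The definition is locked because unification would
    otherwise unfold it to a limit. *)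
HB.lock Definition partial {R : realType} (i : option 'I_3) (f : R * 'rV[R]_3 -> R)
  : R * 'rV[R]_3 -> R := derive_within halfspace f (axis i).

Notation dt := (partial None).
Notation dx j := (partial (Some j)).

Section Partials.
Context {R : realType}.
Local Notation PT := (R * 'rV[R]_3)%type.
Local Notation H := (@halfspace R).
Implicit Types (f g v Phi Psi : PT -> R) (p : PT) (j k l : 'I_3) (i : option 'I_3).

Lemma partialE i f : partial i f = derive_within H f (axis i).
Proof. by rewrite partial.unlock. Qed.

Lemma pdtE f : pdt f = dt f.
Proof. by rewrite partialE. Qed.

Lemma pdxE j f : pdx j f = dx j f.
Proof. by rewrite partialE. Qed.

Lemma smooth_partial i f : smooth f -> smooth (partial i f).
Proof. by rewrite partialE; exact: smooth_derive. Qed.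

Lemma partial_commute f i i' p : smooth f -> H p ->
  partial i (partial i' f) p = partial i' (partial i f) p.
Proof. by rewrite !partialE; exact: derive_commute. Qed.

Lemma partial_congr f g i p : H p -> (forall q, H q -> f q = g q) ->
  partial i f p = partial i g p.
Proof. by rewrite !partialE; exact: derive_within_congr. Qed.

Lemma partial_unique f i p (l : R) : H p ->
  diff_quotient_within H f p (axis i) --> l -> partial i f p = l.
Proof. by rewrite partialE; exact: derive_within_unique. Qed.

Lemma partial_vanish i f p : H p -> (forall q, H q -> f q = 0) -> partial i f p = 0.
Proof.
move=> Hp f0; rewrite (partial_congr (g := fun=> 0) i Hp f0).
apply: partial_unique => //; rewrite diff_quotientE.
by under eq_fun do rewrite subrr mulr0; exact: cvg_cst.
Qed.

Lemma partial_cvg f i p : smooth f -> H p ->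
  (fun h => h^-1 * (f (h *: axis i + p) - f p)) @ quotient_filter p (axis i) -->
  partial i f p.
Proof. by rewrite partialE => sf Hp; exact: (smooth_cvg sf Hp). Qed.

Lemma partial_add f g i p : smooth f -> smooth g -> H p ->
  partial i (fun q => f q + g q) p = partial i f p + partial i g p.
Proof.
move=> sf sg Hp; apply: partial_unique => //; rewrite diff_quotientE.
under eq_fun => h do rewrite opprD addrACA mulrDr.
by apply: cvgD; exact: partial_cvg.
Qed.

Lemma partial_scale a f i p : smooth f -> H p ->
  partial i (fun q => a * f q) p = a * partial i f p.
Proof.
move=> sf Hp; apply: partial_unique => //; rewrite diff_quotientE.
under eq_fun => h do rewrite -mulrBr mulrCA.
by apply: cvgM; [exact: cvg_cst|exact: partial_cvg].
Qed.

Lemma partial_sub f g i p : smooth f -> smooth g -> H p ->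
  partial i (fun q => f q - g q) p = partial i f p - partial i g p.
Proof.
move=> sf sg Hp; have -> : (fun p => f p - g p) = (fun p => f p + -1 * g p).
  by apply/funext => q; rewrite mulN1r.
by rewrite partial_add ?partial_scale ?mulN1r //; exact: smooth_scale.
Qed.

Lemma axis_coord i j : (@axis R i).2 0 j = (i == Some j)%:R.
Proof.
case: i => [k|] /=; last by rewrite mxE.
by rewrite mxE eqxx /= eq_sym.
Qed.

Lemma partial_coord j f i p : smooth f -> H p ->
  partial i (fun q => q.2 0 j * f q) p = (i == Some j)%:R * f p + p.2 0 j * partial i f p.
Proof.
move=> sf Hp; apply: partial_unique => //; rewrite diff_quotientE -axis_coord.
have lim : (axis i).2 0 j * f (h *: axis i + p) +
    p.2 0 j * (h^-1 * (f (h *: axis i + p) - f p))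
    @[h --> quotient_filter p (axis i)] --> (axis i).2 0 j * f p + p.2 0 j * partial i f p.
  apply: cvgD; apply: cvgM; try exact: cvg_cst; last exact: partial_cvg.
  by apply: quotient_continuous => //; exact: smooth_continuous.
apply: cvg_trans lim; apply: near_eq_cvg.
by apply: quotient_filter_near => h h0 _; rewrite /= !mxE; field.
Qed.

Definition rotf j k f : PT -> R := fun p => p.2 0 j * dx k f p - p.2 0 k * dx j f p.

Definition box (c : R) f : PT -> R := fun p =>
  dt (dt f) p - c ^+ 2 * (dx 0 (dx 0 f) p + dx 1 (dx 1 f) p + dx 2 (dx 2 f) p).

Lemma rotationE j k f : rotation j k f = rotf j k f.
Proof. by apply/funext => p; rewrite /rotation !pdxE. Qed.

Lemma dalembertianE c f : dalembertian c f = box c f.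
Proof. by apply/funext => p; rewrite /dalembertian sum3 !pdxE !pdtE. Qed.

Lemma smooth_rot j k f : smooth f -> smooth (rotf j k f).
Proof. by move=> sf; apply: smooth_sub; apply: smooth_coord; exact: smooth_partial. Qed.

Lemma rot_congr j k f g p : H p -> (forall q, H q -> f q = g q) -> rotf j k f p = rotf j k g p.
Proof. by move=> Hp fg; rewrite /rotf !(partial_congr _ Hp fg). Qed.

Lemma partial_rot i j k f p : smooth f -> H p ->
  partial i (rotf j k f) p =
  rotf j k (partial i f) p + (i == Some j)%:R * dx k f p - (i == Some k)%:R * dx j f p.
Proof.
move=> sf Hp; have sj := smooth_partial (Some j) sf; have sk := smooth_partial (Some k) sf.
rewrite /rotf partial_sub //; try exact: smooth_coord.
rewrite !partial_coord //.
rewrite (partial_commute i (Some k) sf Hp) (partial_commute i (Some j) sf Hp).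
ring.
Qed.

Lemma smooth_box c f : smooth f -> smooth (box c f).
Proof.
move=> sf; have s2 i := smooth_partial i (smooth_partial i sf).
apply: (@smooth_sub _ (dt (dt f))); first exact: s2.
by apply: smooth_scale; apply: smooth_add; [apply: smooth_add|]; exact: s2.
Qed.

Lemma partial_box i c f p : smooth f -> H p -> partial i (box c f) p = box c (partial i f) p.
Proof.
move=> sf Hp; have s2 i := smooth_partial i (smooth_partial i sf).
have s3 : smooth (fun q => dx 0 (dx 0 f) q + dx 1 (dx 1 f) q).
  by apply: smooth_add; exact: s2.
have s4 : smooth (fun q => dx 0 (dx 0 f) q + dx 1 (dx 1 f) q + dx 2 (dx 2 f) q).
  by apply: (smooth_add s3); exact: s2.
rewrite /box partial_sub //; last exact: smooth_scale.
rewrite partial_scale // partial_add // partial_add //.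
have comm2 (l : option 'I_3) : partial i (partial l (partial l f)) p = partial l (partial l (partial i f)) p.
  rewrite (partial_commute i l (smooth_partial l sf) Hp).
  by apply: partial_congr => // q Hq; exact: partial_commute.
by rewrite !comm2.
Qed.

(** The rotations are symmetries of the Laplacian: the commutators with the second
    derivatives in the two directions of the rotation cancel. *)
Lemma box_rot c j k f p : smooth f -> H p -> j != k -> box c (rotf j k f) p = rotf j k (box c f) p.
Proof.
move=> sf Hp jk.
have s1 i := smooth_partial i sf.
have s2 i := smooth_partial i (s1 i).
have E i : partial i (partial i (rotf j k f)) p = rotf j k (partial i (partial i f)) p +
    (i == Some j)%:R * (dx k (partial i f) p *+ 2) - (i == Some k)%:R * (dx j (partial i f) p *+ 2).
  have Ei : forall q, H q -> partial i (rotf j k f) q = rotf j k (partial i f) q +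
      (i == Some j)%:R * dx k f q - (i == Some k)%:R * dx j f q.
    by move=> q Hq; exact: partial_rot.
  rewrite (partial_congr i Hp Ei) partial_sub //; last by apply: smooth_scale; exact: s1.
    rewrite partial_add ?partial_scale //; last by apply: smooth_scale; exact: s1.
      rewrite partial_rot // (partial_commute i (Some k) sf Hp) (partial_commute i (Some j) sf Hp).
      by ring.
    exact: smooth_rot.
  apply: smooth_add; first exact: smooth_rot.
  by apply: smooth_scale; exact: s1.
rewrite /box !E /rotf.
have Er (l : option 'I_3) : partial l (box c f) p = partial l (dt (dt f)) p - c ^+ 2 * (partial l (dx 0 (dx 0 f)) p
   + partial l (dx 1 (dx 1 f)) p + partial l (dx 2 (dx 2 f)) p).
  have s3 : smooth (fun q => dx 0 (dx 0 f) q + dx 1 (dx 1 f) q).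
    by apply: smooth_add; exact: s2.
  have s4 : smooth (fun q => dx 0 (dx 0 f) q + dx 1 (dx 1 f) q + dx 2 (dx 2 f) q).
    by apply: (smooth_add s3); exact: s2.
  rewrite /box partial_sub //; last exact: smooth_scale.
  by rewrite partial_scale // partial_add // partial_add.
rewrite -/(box c f) !Er.
have C := partial_commute (Some j) (Some k) sf Hp.
move: jk C E.
by case: (ord3P j) => ->; case: (ord3P k) => -> //= _ C _; rewrite C; ring.
Qed.

Lemma static_smooth (phi : 'rV[R]_3 -> R) : smooth_on setT phi -> smooth (static phi).
Proof.
move=> sphi.
pose C (g : PT -> R) := exists2 phi, smooth_on setT phi & g = static phi.
apply: (@smooth_class _ C); last by exists phi.
  move=> g [{}phi {}sphi ->]; apply: continuous_subspaceT.
  have [cphi _] := sphi [::].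
  have {}cphi : continuous phi by exact/continuous_subspace_setT.
  by apply: (continuous_compose cphi) => p; exact: cvg_snd.
move=> g [{}phi {}sphi ->] v; exists (static (derive_within setT phi v.2)).
  exists (derive_within setT phi v.2) => //.
  by move=> vs; have := sphi (rcons vs v.2); rewrite foldr_rcons.
move=> p Hp; have [_ /(_ p.2 v.2 Logic.I)] := sphi [::].
rewrite /= /derivable_within => dphi.
rewrite diff_quotientE /static => B HB; have := dphi B HB.
move=> HB2.
have HB3 : nbhs (0 : R) [set h : R | h != 0 -> True ->
  B (h^-1 * (phi (h *: v.2 + p.2) - phi p.2))] := HB2.
by apply: (filterS _ HB3) => h /= + hn _; apply.
Qed.

Lemma dx_trace j f g x : (forall y, f (0, y) = g (0, y)) -> dx j f (0, x) = dx j g (0, x).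
Proof.
move=> fg; rewrite !partialE /derive_within !diff_quotientE.
have E h : f (h *: axis (Some j) + (0, x)) = g (h *: axis (Some j) + (0, x)).
  have -> : h *: axis (Some j) + (0, x) = (0, h *: delta_mx 0 j + x) :> PT.
    by congr pair; rewrite /= scaler0 add0r.
  exact: fg.
by under eq_fun => h do rewrite E fg.
Qed.

(** The data are traces at time 0 of functions on the half-space, so that the vector
    fields act on them as well. *)
Definition cauchy_problem c g Phi Psi v :=
  [/\ smooth v, forall p, H p -> box c v p = g p,
      forall x, v (0, x) = Phi (0, x) & forall x, dt v (0, x) = Psi (0, x)].

Lemma H0 (x : 'rV[R]_3) : H (0, x).
Proof. by rewrite /halfspace /=. Qed.

Lemma cauchy_dx c g Phi Psi v j : smooth g -> cauchy_problem c g Phi Psi v ->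
  cauchy_problem c (dx j g) (dx j Phi) (dx j Psi) (dx j v).
Proof.
move=> sg [sv eqv v0 v1]; split.
- exact: smooth_partial.
- by move=> p Hp; rewrite -partial_box //; exact: partial_congr.
- by move=> x; exact: dx_trace.
- move=> x; rewrite (partial_commute _ _ sv (H0 x)); exact: dx_trace.
Qed.

Lemma rot_trace j k f g x : (forall y, f (0, y) = g (0, y)) -> rotf j k f (0, x) = rotf j k g (0, x).
Proof. by move=> fg; rewrite /rotf !(dx_trace _ _ fg). Qed.

Lemma cauchy_rot c g Phi Psi v j k : smooth g -> j != k -> cauchy_problem c g Phi Psi v ->
  cauchy_problem c (rotf j k g) (rotf j k Phi) (rotf j k Psi) (rotf j k v).
Proof.
move=> sg jk [sv eqv v0 v1]; split.
- exact: smooth_rot.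
- by move=> p Hp; rewrite box_rot //; exact: rot_congr.
- by move=> x; exact: rot_trace.
- move=> x; rewrite partial_rot //= ?mul0r ?addr0 ?subr0; last exact: H0.
  exact: rot_trace.
Qed.

(** The second time derivative at time 0 is read off from the equation. *)
Lemma cauchy_dt c g Phi Psi v : smooth g -> cauchy_problem c g Phi Psi v ->
  cauchy_problem c (dt g) Psi (fun p => g p + c ^+ 2 *
    (dx 0 (dx 0 Phi) p + dx 1 (dx 1 Phi) p + dx 2 (dx 2 Phi) p)) (dt v).
Proof.
move=> sg [sv eqv v0 v1]; split => //.
- exact: smooth_partial.
- by move=> p Hp; rewrite -partial_box //; exact: partial_congr.
- move=> x; have := eqv _ (H0 x); rewrite /box.
  have E j : dx j (dx j v) (0, x) = dx j (dx j Phi) (0, x).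
    by apply: dx_trace => y; exact: dx_trace.
  by rewrite !E => <-; ring.
Qed.

(** By continuity the equation holds at time 0 as well, which is needed to find the
    initial velocity of the time derivative. *)
Lemma cauchy_of_solution c G phi psi u : smooth G -> solves_wave c G phi psi u ->
  cauchy_problem c G (static phi) (static psi) u.
Proof.
move=> sG [su eqG u0 u1]; split => //.
- apply: boundary_limit.
  + by apply: smooth_continuous; exact: smooth_box.
  + exact: smooth_continuous.
  + by move=> [t x] /= t0; rewrite -dalembertianE eqG.
- by move=> x; rewrite -pdtE u1.
Qed.

Lemma smooth_cst0 : smooth (fun _ : PT => 0 : R).
Proof.
apply: (@smooth_class _ (fun g => g = fun=> 0)) => //.
- by move=> g ->; apply: continuous_subspaceT => x; exact: cvg_cst.
- move=> g -> v; exists (fun=> 0) => // p Hp; rewrite diff_quotientE.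
  by under eq_fun => h do rewrite subrr mulr0; exact: cvg_cst.
Qed.

Lemma partial_chain f (tau : R -> R) (gam : R -> 'rV[R]_3) (s dtau : R) (dgam : 'I_3 -> R) :
  smooth f -> 0 < tau s -> is_derive s 1 tau dtau ->
  (forall j, is_derive s 1 (fun s => gam s 0 j) (dgam j)) ->
  is_derive s 1 (fun s => f (tau s, gam s))
    (dtau * dt f (tau s, gam s) + (dgam 0 * dx 0 f (tau s, gam s) +
      dgam 1 * dx 1 f (tau s, gam s) + dgam 2 * dx 2 f (tau s, gam s))).
Proof.
by move=> sf t0 Ht Hg; have := chain_rule sf t0 Ht Hg; rewrite sum3 !pdtE !pdxE.
Qed.

End Partials.

(** * Momentum along incoming rays *)

Section Sphere.
Context {R : realType}.
Local Notation PT := (R * 'rV[R]_3)%type.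
Local Notation H := (@halfspace R).
Implicit Types (f g v : PT -> R) (p : PT) (j k l : 'I_3) (i : option 'I_3).
Implicit Types (z w e : 'rV[R]_3) (s th ph rho : R).

Lemma cont_vadd (X : topologicalType) (f g : X -> 'rV[R]_3) :
  continuous f -> continuous g -> continuous (fun x => f x + g x).
Proof. by move=> cf cg x; apply: cvgD; [exact: cf|exact: cg]. Qed.

Lemma cont_vscale (X : topologicalType) (f : X -> R) (g : X -> 'rV[R]_3) :
  continuous f -> continuous g -> continuous (fun x => f x *: g x).
Proof. by move=> cf cg x; apply: cvgZ; [exact: cf|exact: cg]. Qed.

Lemma cont_vcst (X : topologicalType) z : continuous (fun _ : X => z).
Proof. by move=> x; exact: cvg_cst. Qed.

Lemma cont_cos (X : topologicalType) (f : X -> R) :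
  continuous f -> continuous (fun x => cos (f x)).
Proof. by move=> cf; apply: (continuous_compose (f := cos)) => //; exact: continuous_cos. Qed.

Lemma cont_sin (X : topologicalType) (f : X -> R) :
  continuous f -> continuous (fun x => sin (f x)).
Proof. by move=> cf; apply: (continuous_compose (f := sin)) => //; exact: continuous_sin. Qed.

Lemma cont_fst (X Y Z : topologicalType) (f : X -> Y * Z) :
  continuous f -> continuous (fun x => (f x).1).
Proof. by move=> cf; apply: (continuous_compose (f := fst)) => //; move=> p; exact: cvg_fst. Qed.

Lemma cont_snd (X Y Z : topologicalType) (f : X -> Y * Z) :
  continuous f -> continuous (fun x => (f x).2).
Proof. by move=> cf; apply: (continuous_compose (f := snd)) => //; move=> p; exact: cvg_snd. Qed.

Lemma cont_id (X : topologicalType) : continuous (fun x : X => x).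
Proof. by move=> x; exact: cvg_id. Qed.

Lemma extend_chain f (tau : R -> R) (gam : R -> 'rV[R]_3) (s dtau : R) (dgam : 'I_3 -> R) :
  smooth f -> 0 < tau s -> is_derive s 1 tau dtau ->
  (forall j, is_derive s 1 (fun s => gam s 0 j) (dgam j)) ->
  is_derive s 1 (fun s => extend f (tau s, gam s))
    (dtau * extend (dt f) (tau s, gam s) + (dgam 0 * extend (dx 0 f) (tau s, gam s) +
      dgam 1 * extend (dx 1 f) (tau s, gam s) + dgam 2 * extend (dx 2 f) (tau s, gam s))).
Proof.
move=> sf t0 Ht Hg.
have Hs : H (tau s, gam s) by exact: ltW.
have := partial_chain sf t0 Ht Hg.
rewrite !(extendE _ Hs); apply: near_eq_is_derive.
have ct := is_derive_continuous Ht.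
have tn : nbhs s [set y | 0 < tau y] := ct _ (lt_nbhsr t0).
apply: (filterS _ tn) => y /= y0.
by rewrite extendE //; exact: ltW.
Qed.

Definition ray z w rho : 'rV[R]_3 := z + rho *: w.

Definition grad v (w : 'rV[R]_3) p : R :=
  w 0 0 * extend (dx 0 v) p + w 0 1 * extend (dx 1 v) p + w 0 2 * extend (dx 2 v) p.

Definition hess v (w w' : 'rV[R]_3) p : R :=
  w 0 0 * grad (dx 0 v) w' p + w 0 1 * grad (dx 1 v) w' p + w 0 2 * grad (dx 2 v) w' p.

(** This is (d_t + c d_rho) (rho v) on the incoming ray with tip (T, z); rho v satisfies
    a wave equation in one space variable up to angular derivatives. *)
Definition ray_momentum (c T : R) z v w s : R :=
  let rho := c * (T - s) in let p := (s, ray z w rho) in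
  rho * (extend (dt v) p + c * grad v w p) + c * extend v p.

Definition ray_momentum' (c T : R) z v w s : R :=
  let rho := c * (T - s) in let p := (s, ray z w rho) in
  rho * (extend (dt (dt v)) p - c ^+ 2 * hess v w w p) - c ^+ 2 * (2 * grad v w p).

Lemma ray_coord z w rho j : ray z w rho 0 j = z 0 j + rho * w 0 j.
Proof. by rewrite !mxE. Qed.

Lemma radius_derive (c T s : R) : is_derive s 1 (fun s => c * (T - s)) (- c).
Proof.
apply: (isd_eq (isd_mull c (isd_sub (isd_cst T s) (isd_id s)))).
by rewrite sub0r mulrN1.
Qed.

Lemma extend_ray_derive (c T s : R) z v w : smooth v -> 0 < s ->
  is_derive s 1 (fun s => extend v (s, ray z w (c * (T - s))))
    (extend (dt v) (s, ray z w (c * (T - s))) - c * grad v w (s, ray z w (c * (T - s)))).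
Proof.
move=> sv s0.
have Hg j : is_derive s 1 (fun s => ray z w (c * (T - s)) 0 j) (- c * w 0 j).
  have -> : (fun s => ray z w (c * (T - s)) 0 j) = (fun s => z 0 j + c * (T - s) * w 0 j).
    by apply/funext => s'; rewrite ray_coord.
  apply: (isd_eq (isd_add (isd_cst (z 0 j) s) (isd_mul (radius_derive c T s) (isd_cst (w 0 j) s)))).
  by rewrite mulr0 addr0 add0r.
apply: (isd_eq (extend_chain (tau := id) sv s0 (isd_id s) Hg)).
by rewrite /grad; ring.
Qed.

Lemma ray_momentum_derive (c T s : R) z v w : smooth v -> 0 < s ->
  is_derive s 1 (ray_momentum c T z v w) (ray_momentum' c T z v w s).
Proof.
move=> sv s0; rewrite /ray_momentum.
have D f : smooth f -> _ := fun sf => @extend_ray_derive c T s z f w sf s0.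
have Dt := D _ (smooth_partial None sv).
have Dx j := D _ (smooth_partial (Some j) sv).
apply: (isd_eq (isd_add (isd_mul (radius_derive c T s) (isd_add Dt (isd_mull c
  (isd_add (isd_add (isd_mull (w 0 0) (Dx 0)) (isd_mull (w 0 1) (Dx 1))) (isd_mull (w 0 2) (Dx 2))))))
  (isd_mull c (D _ sv)))).
rewrite /ray_momentum' /hess.
have C j : extend (dt (dx j v)) (s, ray z w (c * (T - s))) = extend (dx j (dt v)) (s, ray z w (c * (T - s))).
  by apply: (partial_commute _ _ sv); exact: clamp_in.
rewrite !C /grad; ring.
Qed.

(** Completeness of the frame e1, e2, e3: the sum of the squares of its components
    is the identity. *)
Definition complete_frame (e1 e2 e3 : 'rV[R]_3) :=
  forall j k, e1 0 j * e1 0 k + e2 0 j * e2 0 k + e3 0 j * e3 0 k = (j == k)%:R.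

Definition sphere e1 e2 e3 th ph : 'rV[R]_3 :=
  cos th *: e1 + (sin th * cos ph) *: e2 + (sin th * sin ph) *: e3.

Definition meridian e1 e2 e3 th ph : 'rV[R]_3 :=
  - sin th *: e1 + (cos th * cos ph) *: e2 + (cos th * sin ph) *: e3.

Definition parallel e2 e3 ph : 'rV[R]_3 := - sin ph *: e2 + cos ph *: e3.

Lemma sphere_coord e1 e2 e3 th ph j : sphere e1 e2 e3 th ph 0 j =
  cos th * e1 0 j + sin th * cos ph * e2 0 j + sin th * sin ph * e3 0 j.
Proof. by rewrite !mxE. Qed.

Lemma meridian_coord e1 e2 e3 th ph j : meridian e1 e2 e3 th ph 0 j =
  - sin th * e1 0 j + cos th * cos ph * e2 0 j + cos th * sin ph * e3 0 j.
Proof. by rewrite !mxE. Qed.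

Lemma parallel_coord e2 e3 ph j : parallel e2 e3 ph 0 j = - sin ph * e2 0 j + cos ph * e3 0 j.
Proof. by rewrite !mxE. Qed.

(** The radial, meridian and parallel directions form an orthonormal frame again, so that
    the Laplacian is the trace of the Hessian in this frame. *)
Lemma moving_frame e1 e2 e3 th ph j k : complete_frame e1 e2 e3 ->
  let w := sphere e1 e2 e3 th ph in let a := meridian e1 e2 e3 th ph in
  let b := parallel e2 e3 ph in
  w 0 j * w 0 k + a 0 j * a 0 k + b 0 j * b 0 k = (j == k)%:R.
Proof.
move=> /(_ j k) on; rewrite /= !sphere_coord !meridian_coord !parallel_coord -on.
have c1 := sin2cos2 th; have c2 := sin2cos2 ph.
have c1' : sin th ^+ 2 = 1 - cos th ^+ 2 by lra.
have c2' : sin ph ^+ 2 = 1 - cos ph ^+ 2 by lra.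
ring: c1' c2'.
Qed.

Definition T (h : R -> R -> R) : R := integ 0 pi (fun th => integ 0 (2 * pi) (h th)).

Lemma cont_coord (X : topologicalType) (f : X -> 'rV[R]_3) j :
  continuous f -> continuous (fun x => f x 0 j).
Proof.
move=> cf; apply: (continuous_compose (f := fun w : 'rV[R]_3 => w 0 j)) => //.
exact: coord_continuous.
Qed.

Lemma cont_extend_point (X : topologicalType) f (p : X -> PT) :
  smooth f -> continuous p -> continuous (fun x => extend f (p x)).
Proof. by move=> sf cp; apply: continuous_compose => //; exact: smooth_extend_continuous. Qed.

Lemma cont_grad (X : topologicalType) f (w : X -> 'rV[R]_3) (p : X -> PT) :
  smooth f -> continuous w -> continuous p -> continuous (fun x => grad f (w x) (p x)).
Proof.
move=> sf cw cp; have cf j := cont_extend_point (smooth_partial (Some j) sf) cp.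
have wj j := cont_coord (j := j) cw.
by apply: cont_add; [apply: cont_add|]; apply: cont_mul; rewrite ?cf ?wj.
Qed.

Lemma cont_hess (X : topologicalType) f (w w' : X -> 'rV[R]_3) (p : X -> PT) :
  smooth f -> continuous w -> continuous w' -> continuous p ->
  continuous (fun x => hess f (w x) (w' x) (p x)).
Proof.
move=> sf cw cw' cp; have cf j := cont_grad (smooth_partial (Some j) sf) cw' cp.
have wj j := cont_coord (j := j) cw.
by apply: cont_add; [apply: cont_add|]; apply: cont_mul; rewrite ?cf ?wj.
Qed.

Lemma cont_ray (X : topologicalType) z (w : X -> 'rV[R]_3) (rho : X -> R) :
  continuous w -> continuous rho -> continuous (fun x => ray z (w x) (rho x)).
Proof. by move=> cw cr; apply: cont_vadd; [exact: cont_vcst|exact: cont_vscale]. Qed.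

Lemma cont_sphere (X : topologicalType) e1 e2 e3 (th ph : X -> R) :
  continuous th -> continuous ph -> continuous (fun x => sphere e1 e2 e3 (th x) (ph x)).
Proof.
move=> ct cp; have cc := cont_vcst; have cs := cont_sin ct; have co := cont_cos ct.
have cs' := cont_sin cp; have co' := cont_cos cp.
apply: cont_vadd; [apply: cont_vadd|]; apply: cont_vscale => //; try exact: cont_vcst;
  exact: cont_mul.
Qed.

Lemma cont_meridian (X : topologicalType) e1 e2 e3 (th ph : X -> R) :
  continuous th -> continuous ph -> continuous (fun x => meridian e1 e2 e3 (th x) (ph x)).
Proof.
move=> ct cp; have cc := cont_vcst; have cs := cont_sin ct; have co := cont_cos ct.
have cs' := cont_sin cp; have co' := cont_cos cp.
apply: cont_vadd; [apply: cont_vadd|]; apply: cont_vscale => //; try exact: cont_vcst;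
  try exact: cont_mul.
exact: cont_opp.
Qed.

Lemma cont_parallel (X : topologicalType) e2 e3 (ph : X -> R) :
  continuous ph -> continuous (fun x => parallel e2 e3 (ph x)).
Proof.
move=> cp; have cs' := cont_sin cp; have co' := cont_cos cp.
apply: cont_vadd; apply: cont_vscale => //; try exact: cont_vcst.
exact: cont_opp.
Qed.

End Sphere.

Ltac smooth_step := repeat (first [assumption | apply: smooth_partial]).

(** One step of a syntax-directed proof that an expression in sums, products, sines,
    cosines, frames and derivatives of smooth functions is continuous. *)
Ltac cont_step :=
  lazymatch goal with
  | |- continuous (fun x => x) => exact: cont_id
  | |- continuous (fun x => GRing.add (@?a x) (GRing.opp (@?b x))) =>
      apply: (@cont_sub _ _ a b)
  | |- continuous (fun x => GRing.add (@?a x) (@?b x)) => apply: (@cont_add _ _ a b)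
  | |- continuous (fun x => GRing.opp (@?a x)) => apply: (@cont_opp _ _ a)
  | |- continuous (fun x => GRing.mul (@?a x) (@?b x)) => apply: (@cont_mul _ _ a b)
  | |- continuous cos => exact: continuous_cos
  | |- continuous sin => exact: continuous_sin
  | |- continuous (fun x => cos (@?a x)) => apply: (@cont_cos _ _ a)
  | |- continuous (fun x => sin (@?a x)) => apply: (@cont_sin _ _ a)
  | |- continuous (fun x => extend ?f (@?p x)) => apply: (@cont_extend_point _ _ f p); first smooth_step
  | |- continuous (fun x => grad ?f (@?w x) (@?p x)) =>
      apply: (@cont_grad _ _ f w p); first smooth_step
  | |- continuous (fun x => hess ?f (@?w x) (@?w' x) (@?p x)) =>
      apply: (@cont_hess _ _ f w w' p); first smooth_step
  | |- continuous (fun x => ray ?z (@?w x) (@?r x)) => apply: (@cont_ray _ _ z w r)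
  | |- continuous (fun x => sphere ?e1 ?e2 ?e3 (@?a x) (@?b x)) =>
      apply: (@cont_sphere _ _ e1 e2 e3 a b)
  | |- continuous (fun x => meridian ?e1 ?e2 ?e3 (@?a x) (@?b x)) =>
      apply: (@cont_meridian _ _ e1 e2 e3 a b)
  | |- continuous (fun x => parallel ?e2 ?e3 (@?a x)) => apply: (@cont_parallel _ _ e2 e3 a)
  | |- continuous (fun x => pair (@?a x) (@?b x)) => apply: (@continuous_pair _ _ _ a b)
  | |- continuous (fun x => fst (@?a x)) => apply: (@cont_fst _ _ _ a)
  | |- continuous (fun x => snd (@?a x)) => apply: (@cont_snd _ _ _ a)
  | |- _ => exact: cont_cst
  end.

Ltac cont := repeat cont_step.

(** * Spherical means and Kirchhoff's formula *)

Section SphericalMeans.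
Context {R : realType}.
Local Notation PT := (R * 'rV[R]_3)%type.
Local Notation H := (@halfspace R).
Implicit Types (f g v : PT -> R) (p : PT) (j k l : 'I_3) (i : option 'I_3).
Implicit Types (z w e : 'rV[R]_3) (s th ph rho : R).

Definition joint (h : R -> R -> R) := continuous (fun p : R * R => h p.1 p.2).

Lemma joint_outer h : joint h -> continuous (fun th => integ 0 (2 * pi) (h th)).
Proof. by move=> jh; apply: int_continuous => //; rewrite mulr_ge0 // pi_ge0. Qed.

Lemma two_pi_ge0 : 0 <= 2 * pi :> R.
Proof. by rewrite mulr_ge0 // pi_ge0. Qed.

Lemma T_add h h' : joint h -> joint h' -> T (fun th ph => h th ph + h' th ph) = T h + T h'.
Proof.
move=> jh jh'; rewrite /T -int_add ?pi_ge0 //; try exact: joint_outer.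
congr integ; apply/funext => th; rewrite int_add ?two_pi_ge0 //; exact: continuous_section.
Qed.

Lemma T_scale (a : R) h : joint h -> T (fun th ph => a * h th ph) = a * T h.
Proof.
move=> jh; rewrite /T -int_scale ?pi_ge0 //; try exact: joint_outer.
congr integ; apply/funext => th; rewrite int_scale ?two_pi_ge0 //; exact: continuous_section.
Qed.

Lemma T_bound h (Psi dPsi : R -> R) : joint h -> {within `[0, pi], continuous Psi} ->
  (forall th, 0 < th < pi -> is_derive th 1 Psi (dPsi th)) ->
  (forall th ph, 0 < th < pi -> `|h th ph| <= dPsi th) ->
  `|T h| <= 2 * pi * (Psi pi - Psi 0).
Proof.
move=> jh cPsi HPsi le_h; rewrite mulrBr.
apply: (@int_le _ _ (fun th => 2 * pi * Psi th) (fun th => 2 * pi * dPsi th)).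
- exact: pi_ge0.
- exact: joint_outer.
- by move=> th; apply: cvgM; [exact: cvg_cst|exact: cPsi].
- by move=> th /HPsi HP; exact: isd_mull.
- move=> th thin; rewrite [leRHS]mulrC -[X in _ <= _ * X](subr0 (2 * pi)); apply: int_le_const.
  + exact: two_pi_ge0.
  + exact: continuous_section.
  + by move=> ph _; exact: le_h.
Qed.

Lemma T_const (a : R) : T (fun th _ => sin th * a) = 4 * pi * a.
Proof.
have E th : integ 0 (2 * pi) (fun _ : R => sin th * a) = 2 * pi * a * sin th.
  apply: (@int_eq _ (fun ph => ph * (sin th * a))).
  - exact: two_pi_ge0.
  - exact: cont_cst.
  - by move=> s; apply: (isd_eq (isd_mul (isd_id s) (isd_cst _ s))); rewrite mul1r mulr0 addr0.
  - by ring.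
rewrite /T (_ : (fun th => _) = fun th => 2 * pi * a * sin th); last exact/funext.
apply: (@int_eq _ (fun th => - (2 * pi * a * cos th))).
- exact: pi_ge0.
- by cont.
- by move=> s; apply: (isd_eq (isd_opp (isd_mull _ (is_derive_cos s)))); rewrite mulrN opprK.
- by rewrite cospi cos0; ring.
Qed.

(** The divergence theorem on the sphere in polar coordinates: P is the polar component
    times sin th, which vanishes at the poles, and Q is periodic. *)
Lemma T_divergence (P P' Q Q' : R -> R -> R) : joint P -> joint P' -> joint Q' ->
  (forall th ph, is_derive th 1 (fun th => P th ph) (P' th ph)) ->
  (forall th ph, is_derive ph 1 (Q th) (Q' th ph)) ->
  (forall ph, P 0 ph = 0) -> (forall ph, P pi ph = 0) ->
  (forall th, Q th (2 * pi) = Q th 0) ->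
  T (fun th ph => P' th ph + Q' th ph) = 0.
Proof.
move=> jP jP' jQ' HP HQ P0 Ppi Qper; rewrite T_add //.
have -> : T Q' = 0.
  rewrite /T (_ : (fun th => _) = fun=> 0).
    apply: (@int_eq _ (fun=> 0)); rewrite ?subrr ?pi_ge0 //; exact: cont_cst.
  apply/funext => th; apply: (@int_eq _ (Q th)); rewrite ?Qper ?subrr ?two_pi_ge0 //.
  exact: continuous_section.
have D th : is_derive th 1 (fun th => integ 0 (2 * pi) (P th)) (integ 0 (2 * pi) (P' th)).
  apply: (@int_derive _ P P' 0 (2 * pi) (th - 1) (th + 1)) => //.
  - exact: two_pi_ge0.
  - by move=> th'; exact: continuous_section.
  - by apply/andP; split; lra.
rewrite addr0; apply: (int_eq _ _ D); rewrite ?pi_ge0 //; first exact: joint_outer.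
rewrite (_ : P pi = fun=> 0); last exact/funext.
rewrite (_ : P 0 = fun=> 0); last exact/funext.
by rewrite subrr.
Qed.

Lemma T_derive (h h' : R -> R -> R -> R) s1 s2 :
  (forall s, s1 < s < s2 -> forall th ph, is_derive s 1 (fun s => h s th ph) (h' s th ph)) ->
  continuous (fun p : R * R * R => h p.1.1 p.1.2 p.2) ->
  continuous (fun p : R * R * R => h' p.1.1 p.1.2 p.2) ->
  forall s, s1 < s < s2 -> is_derive s 1 (fun s => T (h s)) (T (h' s)).
Proof.
move=> Hh ch ch' s s12.
have sec (k : R -> R -> R -> R) (u : R) : continuous (fun p : R * R * R => k p.1.1 p.1.2 p.2) ->
    joint (k u).
  move=> ck; apply: (continuous_compose (g := fun p : R * R => (u, p.1, p.2)) ck).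
  by cont.
have sec2 (k : R -> R -> R -> R) (u : R) : continuous (fun p : R * R * R => k p.1.1 p.1.2 p.2) ->
    continuous (fun p : R * R => k p.1 u p.2).
  move=> ck; apply: (continuous_compose (g := fun p : R * R => (p.1, u, p.2)) ck).
  by cont.
apply: (@int_derive _ (fun s th => integ 0 (2 * pi) (h s th))
   (fun s th => integ 0 (2 * pi) (h' s th)) 0 pi s1 s2) => //.
- exact: pi_ge0.
- move=> s' s'in th; apply: (@int_derive _ (fun s => h s th) (fun s => h' s th) 0 (2 * pi) s1 s2) => //.
  + exact: two_pi_ge0.
  + by move=> s'' s''in ph; exact: Hh.
  + by move=> s''; apply: continuous_section; exact: sec.
  + exact: sec2.
- by move=> s'; apply: joint_outer; exact: sec.
- apply: (@int_continuous _ _ (fun (p : R * R) => h' p.1 p.2)) => //.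
  exact: two_pi_ge0.
Qed.

Lemma hess_trace v (w a b : 'rV[R]_3) p :
  (forall j k, w 0 j * w 0 k + a 0 j * a 0 k + b 0 j * b 0 k = (j == k)%:R) ->
  hess v w w p + hess v a a p + hess v b b p =
  extend (dx 0 (dx 0 v)) p + extend (dx 1 (dx 1 v)) p + extend (dx 2 (dx 2 v)) p.
Proof.
move=> F; pose E j k := extend (dx k (dx j v)) p.
rewrite /hess /grad -/(E 0 0) -/(E 0 1) -/(E 0 2) -/(E 1 0) -/(E 1 1) -/(E 1 2)
  -/(E 2 0) -/(E 2 1) -/(E 2 2).
pose B j k := w 0 j * w 0 k + a 0 j * a 0 k + b 0 j * b 0 k.
transitivity (B 0 0 * E 0 0 + B 0 1 * E 0 1 + B 0 2 * E 0 2 + B 1 0 * E 1 0 + B 1 1 * E 1 1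
  + B 1 2 * E 1 2 + B 2 0 * E 2 0 + B 2 1 * E 2 1 + B 2 2 * E 2 2).
  by rewrite /B; ring.
by rewrite /B !F /= !mul0r !mul1r !addr0.
Qed.

Section Kirchhoff.
Variables (c t : R) (z e1 e2 e3 : 'rV[R]_3).
Hypothesis on : complete_frame e1 e2 e3.
Let w := sphere e1 e2 e3.
Let a := meridian e1 e2 e3.
Let b := parallel e2 e3.
Let pt rho s th ph : PT := (s, ray z (w th ph) rho).

Lemma ray_theta_derive v rho s th ph : smooth v -> 0 < s ->
  is_derive th 1 (fun th => extend v (pt rho s th ph)) (rho * grad v (a th ph) (pt rho s th ph)).
Proof.
move=> sv s0.
have Hg j : is_derive th 1 (fun th => ray z (w th ph) rho 0 j) (rho * a th ph 0 j).
  have -> : (fun th => ray z (w th ph) rho 0 j) = (fun th => z 0 j + rho * (cos th * e1 0 j +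
      sin th * cos ph * e2 0 j + sin th * sin ph * e3 0 j)).
    by apply/funext => th'; rewrite ray_coord sphere_coord.
  have dc := is_derive_cos th; have ds := is_derive_sin th.
  have K x := isd_cst x th.
  apply: (isd_eq (isd_add (K (z 0 j)) (isd_mull rho (isd_add (isd_add (isd_mul dc (K (e1 0 j)))
    (isd_mul (isd_mul ds (K (cos ph))) (K (e2 0 j))))
    (isd_mul (isd_mul ds (K (sin ph))) (K (e3 0 j))))))).
  by rewrite /a meridian_coord; ring.
apply: (isd_eq (extend_chain (tau := fun=> s) sv s0 (isd_cst s th) Hg)).
by rewrite /grad /pt; ring.
Qed.

Lemma ray_phi_derive v rho s th ph : smooth v -> 0 < s ->
  is_derive ph 1 (fun ph => extend v (pt rho s th ph))
    (rho * sin th * grad v (b ph) (pt rho s th ph)).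
Proof.
move=> sv s0.
have Hg j : is_derive ph 1 (fun ph => ray z (w th ph) rho 0 j) (rho * sin th * b ph 0 j).
  have -> : (fun ph => ray z (w th ph) rho 0 j) = (fun ph => z 0 j + rho * (cos th * e1 0 j +
      sin th * cos ph * e2 0 j + sin th * sin ph * e3 0 j)).
    by apply/funext => ph'; rewrite ray_coord sphere_coord.
  have dc := is_derive_cos ph; have ds := is_derive_sin ph.
  have K x := isd_cst x ph.
  apply: (isd_eq (isd_add (K (z 0 j)) (isd_mull rho (isd_add (isd_add (K (cos th * e1 0 j))
    (isd_mul (isd_mull (sin th) dc) (K (e2 0 j))))
    (isd_mul (isd_mull (sin th) ds) (K (e3 0 j))))))).
  by rewrite /b parallel_coord; ring.
apply: (isd_eq (extend_chain (tau := fun=> s) sv s0 (isd_cst s ph) Hg)).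
by rewrite /grad /pt; ring.
Qed.

Let P v rho s th ph := sin th * grad v (a th ph) (pt rho s th ph).
Let P' v rho s th ph := cos th * grad v (a th ph) (pt rho s th ph) +
  sin th * (rho * hess v (a th ph) (a th ph) (pt rho s th ph) - grad v (w th ph) (pt rho s th ph)).
Let Q v rho s th ph := grad v (b ph) (pt rho s th ph).
Let Q' v rho s th ph := rho * sin th * hess v (b ph) (b ph) (pt rho s th ph)
  - (sin th * grad v (w th ph) (pt rho s th ph) + cos th * grad v (a th ph) (pt rho s th ph)).

Lemma P_derive v rho s th ph : smooth v -> 0 < s ->
  is_derive th 1 (fun th => P v rho s th ph) (P' v rho s th ph).
Proof.
move=> sv s0.
have dc := is_derive_cos th; have ds := is_derive_sin th.
have K x := isd_cst x th.
have Ha j : is_derive th 1 (fun th => a th ph 0 j) (- w th ph 0 j).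
  have -> : (fun th => a th ph 0 j) = (fun th => - sin th * e1 0 j + cos th * cos ph * e2 0 j
      + cos th * sin ph * e3 0 j).
    by apply/funext => th'; rewrite /a meridian_coord.
  apply: (isd_eq (isd_add (isd_add (isd_mul (isd_opp ds) (K (e1 0 j)))
    (isd_mul (isd_mul dc (K (cos ph))) (K (e2 0 j))))
    (isd_mul (isd_mul dc (K (sin ph))) (K (e3 0 j))))).
  by rewrite /w sphere_coord; ring.
have Dx j := ray_theta_derive rho th ph (smooth_partial (Some j) sv) s0.
apply: (isd_eq (isd_mul ds (isd_add (isd_add (isd_mul (Ha 0) (Dx 0)) (isd_mul (Ha 1) (Dx 1)))
  (isd_mul (Ha 2) (Dx 2))))).
by rewrite /P' /hess /grad; ring.
Qed.

Lemma Q_derive v rho s th ph : smooth v -> 0 < s ->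
  is_derive ph 1 (Q v rho s th) (Q' v rho s th ph).
Proof.
move=> sv s0.
have dc := is_derive_cos ph; have ds := is_derive_sin ph.
have K x := isd_cst x ph.
have Hb j : is_derive ph 1 (fun ph => b ph 0 j) (- (sin th * w th ph 0 j + cos th * a th ph 0 j)).
  have -> : (fun ph => b ph 0 j) = (fun ph => - sin ph * e2 0 j + cos ph * e3 0 j).
    by apply/funext => ph'; rewrite /b parallel_coord.
  apply: (isd_eq (isd_add (isd_mul (isd_opp ds) (K (e2 0 j))) (isd_mul dc (K (e3 0 j))))).
  rewrite /w /a sphere_coord meridian_coord.
  have c1 : sin th ^+ 2 = 1 - cos th ^+ 2 by have := sin2cos2 th; lra.
  ring: c1.
have Dx j := ray_phi_derive rho th ph (smooth_partial (Some j) sv) s0.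
apply: (isd_eq (isd_add (isd_add (isd_mul (Hb 0) (Dx 0)) (isd_mul (Hb 1) (Dx 1)))
  (isd_mul (Hb 2) (Dx 2)))).
by rewrite /Q' /hess /grad; ring.
Qed.

(** sin th times the spherical Laplacian is a divergence in the polar coordinates. *)
Lemma momentum_divergence g v s th ph : 0 < s -> (forall p, H p -> box c v p = g p) ->
  let rho := c * (t - s) in
  sin th * ray_momentum' c t z v (w th ph) s =
  sin th * (rho * extend g (pt rho s th ph)) + c ^+ 2 * (P' v rho s th ph + Q' v rho s th ph).
Proof.
move=> s0 eqv rho; rewrite /ray_momentum' -/rho -/(pt rho s th ph).
have Etr := hess_trace v (pt rho s th ph) (fun j k => moving_frame th ph j k on).
rewrite -/w -/a -/b -/(w th ph) -/(a th ph) -/(b ph) in Etr.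
have Eg : extend (dt (dt v)) (pt rho s th ph) = extend g (pt rho s th ph) + c ^+ 2 *
    (hess v (w th ph) (w th ph) (pt rho s th ph) + hess v (a th ph) (a th ph) (pt rho s th ph)
     + hess v (b ph) (b ph) (pt rho s th ph)).
  by rewrite Etr /extend -(eqv _ (clamp_in _)) /box; ring.
by rewrite Eg /P' /Q'; ring.
Qed.

Let J v s := T (fun th ph => sin th * ray_momentum c t z v (w th ph) s).

Lemma mean_momentum_derive g v s : 0 < s -> smooth v -> smooth g ->
  (forall p, H p -> box c v p = g p) ->
  is_derive s 1 (J v) (T (fun th ph =>
    sin th * (c * (t - s) * extend g (pt (c * (t - s)) s th ph)))).
Proof.
move=> s0 sv sg eqv.
have D : is_derive s 1 (J v) (T (fun th ph => sin th * ray_momentum' c t z v (w th ph) s)).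
  apply: (@T_derive (fun s th ph => sin th * ray_momentum c t z v (w th ph) s)
    (fun s th ph => sin th * ray_momentum' c t z v (w th ph) s) 0 (s + 1)).
  - by move=> s' /andP[s'0 _] th ph; apply: isd_mull; exact: ray_momentum_derive.
  - by rewrite /ray_momentum /w; cont.
  - by rewrite /ray_momentum' /w; cont.
  - by apply/andP; split => //; lra.
apply: (isd_eq D).
set rho := c * (t - s).
have jP' : joint (P' v rho s).
  by rewrite /joint /P' /pt /w /a; cont.
have jQ' : joint (Q' v rho s).
  by rewrite /joint /Q' /pt /w /a /b; cont.
have jg : joint (fun th ph => sin th * (rho * extend g (pt rho s th ph))).
  by rewrite /joint /pt /w; cont.
have jPQ : joint (fun th ph => P' v rho s th ph + Q' v rho s th ph).
  by apply: cont_add.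
transitivity (T (fun th ph => sin th * (rho * extend g (pt rho s th ph)) +
    c ^+ 2 * (P' v rho s th ph + Q' v rho s th ph))).
  by congr T; apply/funext => th; apply/funext => ph; exact: momentum_divergence.
rewrite T_add // ?T_scale //; last by apply: cont_mul => //; exact: cont_cst.
suff -> : T (fun th ph => P' v rho s th ph + Q' v rho s th ph) = 0 by rewrite mulr0 addr0.
apply: (@T_divergence (P v rho s) _ (Q v rho s)) => //.
- by rewrite /joint /P /pt /a /w; cont.
- by move=> th ph; exact: P_derive.
- by move=> th ph; exact: Q_derive.
- by move=> ph; rewrite /P sin0 mul0r.
- by move=> ph; rewrite /P sinpi mul0r.
- by move=> th; rewrite /Q /pt /w /b /sphere /parallel sin0 cos0 (mulrC 2) mulr_natr sin2pi cos2pi.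
Qed.

Lemma mean_momentum_tip v : J v t = 4 * pi * (c * extend v (t, z)).
Proof.
rewrite /J -T_const; congr T; apply/funext => th; apply/funext => ph.
by rewrite /ray_momentum subrr mulr0 mul0r add0r /ray scale0r addr0.
Qed.

Lemma mean_momentum_continuous v : smooth v -> continuous (J v).
Proof.
move=> sv; apply: int_continuous; first exact: pi_ge0.
apply: (@int_continuous _ _ (fun (p : R * R) ph => sin p.2 * ray_momentum c t z v (w p.2 ph) p.1)).
  exact: two_pi_ge0.
by rewrite /ray_momentum /w; cont.
Qed.

(** Kirchhoff's formula, in the form of an estimate: the value at the tip of
    the backward cone is governed by the means of the data over the bottom sphere
    and of the source over the spheres of the cone. *)
Lemma kirchhoff_bound g v (K dK : R -> R) : 0 < t -> smooth v -> smooth g ->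
  (forall p, H p -> box c v p = g p) ->
  {within `[0, t], continuous K} ->
  (forall s, 0 < s < t -> is_derive s 1 K (dK s)) ->
  (forall s, 0 < s < t -> `|T (fun th ph => sin th * (c * (t - s) *
     extend g (s, ray z (w th ph) (c * (t - s)))))| <= dK s) ->
  `|4 * pi * (c * v (t, z)) - J v 0| <= K t - K 0.
Proof.
move=> t0 sv sg eqv cK HK le_g.
have := @mean_momentum_tip v; rewrite extendE; last exact: ltW.
move=> <-; apply: (mean_value_bound (ltW t0) _ cK _ HK le_g).
  by apply: continuous_subspaceT; exact: mean_momentum_continuous.
by move=> s /andP[s0 _]; exact: mean_momentum_derive.
Qed.

End Kirchhoff.

End SphericalMeans.

(** * Euclidean geometry of spheres *)

Section Geometry.
Context {R : realType}.
Implicit Types (x y z w : 'rV[R]_3) (r rho th ph : R).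

Definition dot x y : R := x 0 0 * y 0 0 + x 0 1 * y 0 1 + x 0 2 * y 0 2.

Lemma dot_ge0 x : 0 <= dot x x.
Proof. by rewrite /dot -!expr2 !addr_ge0 ?sqr_ge0. Qed.

Lemma enormE x : enorm x = Num.sqrt (dot x x).
Proof. by rewrite /enorm sum3 /dot !expr2. Qed.

Lemma enorm_ge0 x : 0 <= enorm x.
Proof. exact: sqrtr_ge0. Qed.

Lemma enorm_sq x : enorm x ^+ 2 = dot x x.
Proof. by rewrite enormE sqr_sqrtr // dot_ge0. Qed.

Lemma enorm_eq x r : 0 <= r -> dot x x = r ^+ 2 -> enorm x = r.
Proof. by move=> r0 E; rewrite enormE E sqrtr_sqr ger0_norm. Qed.

Lemma dotZl (a : R) x y : dot (a *: x) y = a * dot x y.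
Proof. by rewrite /dot !mxE; ring. Qed.

Lemma dotC x y : dot x y = dot y x.
Proof. by rewrite /dot; ring. Qed.

Lemma dotDl x y z : dot (x + y) z = dot x z + dot y z.
Proof. by rewrite /dot !mxE; ring. Qed.

Lemma enorm_gt0 x : x != 0 -> 0 < enorm x.
Proof.
move=> x0; rewrite lt_def enorm_ge0 andbT; apply: contra x0 => /eqP n0.
have : dot x x = 0 by rewrite -enorm_sq n0 expr0n.
rewrite /dot -!expr2 => d0.
have := sqr_ge0 (x 0 0); have := sqr_ge0 (x 0 1); have := sqr_ge0 (x 0 2) => h2 h1 h0.
apply/eqP/rowP => j; rewrite mxE; apply/eqP; rewrite -sqrf_eq0; apply/eqP.
by case: (ord3P j) => ->; lra.
Qed.

Lemma enormZ (a : R) x : enorm (a *: x) = `|a| * enorm x.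
Proof.
apply: enorm_eq; first by rewrite mulr_ge0 ?enorm_ge0.
by rewrite dotZl dotC dotZl exprMn enorm_sq real_normK ?num_real //; ring.
Qed.

Lemma cauchy_schwarz x y : dot x y <= enorm x * enorm y.
Proof.
have [d0|d0] := leP (dot x y) 0.
  by apply: le_trans d0 _; rewrite mulr_ge0 ?enorm_ge0.
rewrite -(@ler_pXn2r _ 2) ?nnegrE ?mulr_ge0 ?enorm_ge0 ?(ltW d0) //.
rewrite exprMn !enorm_sq /dot.
have := sqr_ge0 (x 0 0 * y 0 1 - x 0 1 * y 0 0).
have := sqr_ge0 (x 0 0 * y 0 2 - x 0 2 * y 0 0).
have := sqr_ge0 (x 0 1 * y 0 2 - x 0 2 * y 0 1).
by lra.
Qed.

Lemma enormD x y : enorm (x + y) <= enorm x + enorm y.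
Proof.
rewrite -(@ler_pXn2r _ 2) ?nnegrE ?addr_ge0 ?enorm_ge0 //.
rewrite sqrrD !enorm_sq dotDl ![dot _ (x + y)]dotC !dotDl (dotC y x).
by have := cauchy_schwarz x y; lra.
Qed.

Lemma enorm_triangle x y z : enorm (x - z) <= enorm (x - y) + enorm (y - z).
Proof. by apply: le_trans (enormD _ _); rewrite addrA subrK. Qed.

Lemma enorm_le_dist x y : enorm x <= enorm y + enorm (x - y).
Proof. by rewrite addrC; apply: le_trans (enormD _ _); rewrite subrK. Qed.

Lemma coord_le_enorm x j : `|x 0 j| <= enorm x.
Proof.
rewrite -(@ler_pXn2r _ 2) ?nnegrE ?enorm_ge0 // enorm_sq real_normK ?num_real // /dot -!expr2.
have := sqr_ge0 (x 0 0); have := sqr_ge0 (x 0 1); have := sqr_ge0 (x 0 2).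
by case: (ord3P j) => ->; lra.
Qed.

Definition frame (e1 e2 e3 : 'rV[R]_3) := [/\ complete_frame e1 e2 e3,
  dot e1 e1 = 1 /\ dot e2 e2 = 1 /\ dot e3 e3 = 1 &
  dot e1 e2 = 0 /\ dot e1 e3 = 0 /\ dot e2 e3 = 0].

Definition vec3 (a b c : R) : 'rV[R]_3 := \row_j tnth [tuple a; b; c] j.

Lemma vec3_0 a b c : vec3 a b c 0 0 = a. Proof. by rewrite mxE. Qed.
Lemma vec3_1 a b c : vec3 a b c 0 1 = b. Proof. by rewrite mxE. Qed.
Lemma vec3_2 a b c : vec3 a b c 0 2 = c. Proof. by rewrite mxE. Qed.

Lemma vec3_eta x : x = vec3 (x 0 0) (x 0 1) (x 0 2).
Proof. by apply/rowP => j; case: (ord3P j) => ->; rewrite ?vec3_0 ?vec3_1 ?vec3_2. Qed.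

(** The two vectors are the unit parallel and meridian vectors of the sphere at (a, b, c),
    with the third axis as polar axis; at the poles a fixed choice is made. *)
Lemma frame_vec3 (a b c : R) : a ^+ 2 + b ^+ 2 + c ^+ 2 = 1 ->
  exists e2 e3, frame (vec3 a b c) e2 e3.
Proof.
move=> abc.
have [d0|d0] := eqVneq (a ^+ 2 + b ^+ 2) 0.
  have a0 : a = 0.
    by apply/eqP; rewrite -sqrf_eq0; have := sqr_ge0 a; have := sqr_ge0 b => ? ?; apply/eqP; lra.
  have b0 : b = 0.
    by apply/eqP; rewrite -sqrf_eq0; have := sqr_ge0 a; have := sqr_ge0 b => ? ?; apply/eqP; lra.
  exists (vec3 1 0 0), (vec3 0 1 0); move: abc; rewrite a0 b0 => abc; split.
  - by move=> j k; case: (ord3P j) => ->; case: (ord3P k) => ->;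
    rewrite ?vec3_0 ?vec3_1 ?vec3_2 /=; lra.
  - by rewrite /dot ?vec3_0 ?vec3_1 ?vec3_2; do !split; lra.
  - by rewrite /dot ?vec3_0 ?vec3_1 ?vec3_2; do !split; ring.
pose d := Num.sqrt (a ^+ 2 + b ^+ 2).
have dd : d ^+ 2 = a ^+ 2 + b ^+ 2 by rewrite sqr_sqrtr // addr_ge0 ?sqr_ge0.
have dn : d != 0 by rewrite -sqrf_eq0 dd.
have cc : c ^+ 2 = 1 - d ^+ 2 by rewrite dd; lra.
have bb : b ^+ 2 = d ^+ 2 - a ^+ 2 by rewrite dd; lra.
exists (vec3 (- b / d) (a / d) 0), (vec3 (- a * c / d) (- b * c / d) d); split.
- by move=> j k; case: (ord3P j) => ->; case: (ord3P k) => ->;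
    rewrite ?vec3_0 ?vec3_1 ?vec3_2 /=; field: cc bb.
- by rewrite /dot ?vec3_0 ?vec3_1 ?vec3_2; do !split; field: cc bb.
- by rewrite /dot ?vec3_0 ?vec3_1 ?vec3_2; do !split; field: cc bb.
Qed.

Lemma frame_exists e1 : dot e1 e1 = 1 -> exists e2 e3, frame e1 e2 e3.
Proof.
by rewrite (vec3_eta e1) /dot !vec3_0 !vec3_1 !vec3_2 -!expr2 => /frame_vec3.
Qed.

(** The distance to the origin of the point at polar angle th on the sphere of radius
    rho about a point at distance r. *)
Definition chord r rho th : R := Num.sqrt (r ^+ 2 + rho ^+ 2 + 2 * r * rho * cos th).

Lemma chord_arg_ge r rho th : 0 <= r -> 0 <= rho ->
  (r - rho) ^+ 2 <= r ^+ 2 + rho ^+ 2 + 2 * r * rho * cos th.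
Proof.
move=> r0 rho0; rewrite sqrrB.
have : 0 <= 2 * r * rho * (1 + cos th).
  by rewrite !mulr_ge0 //; have := cos_geN1 th; lra.
lra.
Qed.

Lemma chord_ge r rho th : 0 <= r -> 0 <= rho -> `|r - rho| <= chord r rho th.
Proof.
move=> r0 rho0; rewrite -sqrtr_sqr; apply: ler_wsqrtr; exact: chord_arg_ge.
Qed.

Lemma chord_sphere r rho th ph e1 e2 e3 : 0 <= r -> 0 <= rho -> frame e1 e2 e3 ->
  enorm (ray (r *: e1) (sphere e1 e2 e3 th ph) rho) = chord r rho th.
Proof.
move=> r0 rho0 [_ [n1 [n2 n3]] [n12 [n13 n23]]].
apply: enorm_eq; first exact: sqrtr_ge0.
rewrite sqr_sqrtr; last by apply: le_trans (chord_arg_ge th r0 rho0); exact: sqr_ge0.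
set w := sphere e1 e2 e3 th ph.
have w1 : dot w e1 = cos th.
  by rewrite /w /sphere !dotDl !dotZl n1 (dotC e2) (dotC e3) n12 n13; ring.
have ww : dot w w = 1.
  have s1 : sin th ^+ 2 = 1 - cos th ^+ 2 by have := sin2cos2 th; lra.
  have s2 : sin ph ^+ 2 = 1 - cos ph ^+ 2 by have := sin2cos2 ph; lra.
  rewrite {1}/w /sphere !dotDl !dotZl !(dotC _ w) w1.
  rewrite /w /sphere !dotDl !dotZl (dotC e3 e2) n12 n13 n23 n2 n3; ring: s1 s2.
rewrite /ray dotDl !dotZl !(dotC _ (r *: e1 + _)) !dotDl !dotZl n1 ww w1 (dotC e1) w1; ring.
Qed.

Lemma sphere_norm th ph e1 e2 e3 : frame e1 e2 e3 -> enorm (sphere e1 e2 e3 th ph) = 1.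
Proof.
move=> fr; have := chord_sphere th ph (lexx 0) ler01 fr.
rewrite /ray scale0r add0r scale1r => ->.
by rewrite /chord expr0n /= expr1n mulr0 !mul0r add0r addr0 sqrtr1.
Qed.

Lemma chord0 r rho : 0 <= r -> 0 <= rho -> chord r rho 0 = r + rho.
Proof.
move=> r0 rho0; rewrite /chord cos0 -[RHS]ger0_norm ?addr_ge0 // -sqrtr_sqr; congr Num.sqrt; ring.
Qed.

Lemma chord_pi r rho : chord r rho pi = `|r - rho|.
Proof. by rewrite /chord cospi -sqrtr_sqr; congr Num.sqrt; ring. Qed.

Lemma chord_derive r rho th : 0 < r -> 0 < rho -> 0 < th < pi ->
  0 < chord r rho th /\ is_derive th 1 (chord r rho) (- (r * rho * sin th / chord r rho th)).
Proof.
move=> r0 rho0 /andP[th0 thpi].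
have arg0 : 0 < r ^+ 2 + rho ^+ 2 + 2 * r * rho * cos th.
  have c1 : -1 < cos th.
    rewrite lt_def cos_geN1 andbT; apply/eqP => c1.
    have := sin2cos2 th; have : 0 < sin th ^+ 2.
      by rewrite exprn_gt0 //; apply: sin_gt0_pi; rewrite th0.
    by rewrite c1; lra.
  have := sqr_ge0 (r - rho); rewrite sqrrB.
  have : 0 < 2 * r * rho * (1 + cos th) by rewrite !mulr_gt0 //; lra.
  lra.
have ch0 : 0 < chord r rho th by rewrite sqrtr_gt0.
split => //.
have dc := is_derive_cos th.
have D := isd_add (isd_cst (r ^+ 2 + rho ^+ 2) th) (isd_mull (2 * r * rho) dc).
have Ds := @isd_comp _ Num.sqrt (fun q : R => r ^+ 2 + rho ^+ 2 + 2 * r * rho * cos q) th _ _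
  (is_derive1_sqrt arg0) D.
apply: (isd_eq Ds).
rewrite -/(chord r rho th); field; exact: lt0r_neq0.
Qed.

Lemma chord_continuous r rho : continuous (chord r rho).
Proof.
apply: (@continuous_compose _ _ _ Num.sqrt); first exact: sqrt_continuous.
by apply: cont_add; [exact: cont_cst|apply: cont_mul; [exact: cont_cst|exact: continuous_cos]].
Qed.

(** Integration over a sphere of a function of the distance to the origin: with
    lambda the distance, sin th dth = - lambda dlambda / (r rho). *)
Lemma sphere_bound r rho (h : R -> R -> R) (F k : R -> R) : 0 < r -> 0 < rho ->
  joint h -> (forall q : R, is_derive q 1 F (k q)) ->
  (forall th ph, 0 < th < pi -> `|h th ph| <= k (chord r rho th) / chord r rho th) ->
  `|T (fun th ph => sin th * h th ph)| <= 2 * pi * (F (r + rho) - F `|r - rho|) / (r * rho).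
Proof.
move=> r0 rho0 jh HF le_h.
have rr0 : 0 < r * rho by rewrite mulr_gt0.
pose Psi th := - ((r * rho)^-1 * F (chord r rho th)).
have cF : continuous F by move=> q; exact: is_derive_continuous (HF q).
have HPsi th : 0 < th < pi ->
    is_derive th 1 Psi (sin th * (k (chord r rho th) / chord r rho th)).
  move=> thin; have [ch0 dch] := chord_derive r0 rho0 thin.
  apply: (isd_eq (isd_opp (isd_mull _ (isd_comp (HF _) dch)))).
  by field; rewrite !lt0r_neq0.
have cPsi : {within `[0, pi], continuous Psi}.
  apply: continuous_subspaceT; apply: cont_opp; apply: cont_mul; first exact: cont_cst.
  by apply: continuous_compose => //; exact: chord_continuous.
have jsh : joint (fun th ph => sin th * h th ph).
  by apply: cont_mul => //; apply: cont_sin; apply: cont_fst; exact: cont_id.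
have le_sh th ph : 0 < th < pi ->
    `|sin th * h th ph| <= sin th * (k (chord r rho th) / chord r rho th).
  move=> /[dup] thin /andP[th0 thpi].
  have s0 : 0 <= sin th by apply: sin_ge0_pi; rewrite !ltW.
  by rewrite normrM ger0_norm // ler_wpM2l // le_h.
have := T_bound jsh cPsi HPsi le_sh; rewrite /Psi chord_pi (chord0 (ltW r0) (ltW rho0)) => B.
by apply: (le_trans B); rewrite le_eqVlt; apply/orP; left; apply/eqP; ring.
Qed.

Lemma sphere_bound_sup (h : R -> R -> R) (m : R) : joint h ->
  (forall th ph, 0 < th < pi -> `|h th ph| <= m) ->
  `|T (fun th ph => sin th * h th ph)| <= 4 * pi * m.
Proof.
move=> jh le_h.
have jsh : joint (fun th ph => sin th * h th ph).
  by apply: cont_mul => //; apply: cont_sin; apply: cont_fst; exact: cont_id.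
have HPsi th : 0 < th < pi -> is_derive th 1 (fun th => - (m * cos th)) (sin th * m).
  move=> _; apply: (isd_eq (isd_opp (isd_mull m (is_derive_cos th)))).
  by rewrite mulrN opprK mulrC.
have cPsi : {within `[0, pi], continuous (fun th => - (m * cos th))}.
  apply: continuous_subspaceT; apply: cont_opp; apply: cont_mul; first exact: cont_cst.
  exact: continuous_cos.
have le_sh th ph : 0 < th < pi -> `|sin th * h th ph| <= sin th * m.
  move=> /[dup] thin /andP[th0 thpi].
  have s0 : 0 <= sin th by apply: sin_ge0_pi; rewrite !ltW.
  by rewrite normrM ger0_norm // ler_wpM2l // (le_h _ ph thin).
have := T_bound jsh cPsi HPsi le_sh; rewrite cospi cos0 => B.
by apply: (le_trans B); rewrite le_eqVlt; apply/orP; left; apply/eqP; ring.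
Qed.

End Geometry.

Notation jb := japanese.

(** * Japanese brackets and their primitives *)

Section Brackets.
Context {R : realType}.
Implicit Types (a b d e m q r s t x y : R).

Lemma jb_arg_gt0 a : 0 < 1 + a ^+ 2.
Proof. by have := sqr_ge0 a; lra. Qed.

Lemma jb_ge1 a : 1 <= jb a.
Proof. by rewrite -[leLHS]sqrtr1; apply: ler_wsqrtr; have := sqr_ge0 a; lra. Qed.

Lemma jb_gt0 a : 0 < jb a.
Proof. exact: lt_le_trans (jb_ge1 a). Qed.

Lemma jb_ge0 a : 0 <= jb a.
Proof. exact: ltW (jb_gt0 a). Qed.

Lemma jb_sq a : jb a ^+ 2 = 1 + a ^+ 2.
Proof. by rewrite sqr_sqrtr // ltW // jb_arg_gt0. Qed.

Lemma jb_ge_abs a : `|a| <= jb a.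
Proof. by rewrite -sqrtr_sqr; apply: ler_wsqrtr; lra. Qed.

Lemma jb_le_add a : jb a <= 1 + `|a|.
Proof.
rewrite -(@ler_pXn2r _ 2) ?nnegrE ?addr_ge0 ?jb_ge0 //.
by rewrite jb_sq sqrrD real_normK ?num_real //; have := normr_ge0 a; lra.
Qed.

Lemma jb_ge_half a : 1 + `|a| <= 2 * jb a.
Proof. by have := jb_ge1 a; have := jb_ge_abs a; lra. Qed.

Lemma jb_scale m a b : 1 <= m -> `|a| <= m * `|b| -> jb a <= m * jb b.
Proof.
move=> m1 ab; have m0 : 0 <= m by apply: le_trans m1.
rewrite -(@ler_pXn2r _ 2) ?nnegrE ?mulr_ge0 ?jb_ge0 //.
rewrite exprMn !jb_sq mulrDr mulr1 lerD ?expr_ge1 //.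
by rewrite -exprMn -(real_normK (num_real a)) -(real_normK (num_real (m * b))) normrM (ger0_norm m0)
  lerXn2r ?nnegrE ?mulr_ge0.
Qed.

Lemma jb_mono a b : `|a| <= `|b| -> jb a <= jb b.
Proof. by move=> ab; rewrite -[leRHS]mul1r; apply: jb_scale; rewrite ?mul1r. Qed.

Lemma jb_opp a : jb (- a) = jb a.
Proof. by rewrite /japanese sqrrN. Qed.

Lemma jb_abs a : jb `|a| = jb a.
Proof. by rewrite /japanese real_normK ?num_real. Qed.

Lemma jb_lip a b : jb a <= jb b + `|a - b|.
Proof.
rewrite -(@ler_pXn2r _ 2) ?nnegrE ?addr_ge0 ?jb_ge0 //.
rewrite jb_sq sqrrD jb_sq real_normK ?num_real //.
have H1 : b * (a - b) <= jb b * `|a - b|.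
  by apply: (le_trans (ler_norm _)); rewrite normrM ler_wpM2r // jb_ge_abs.
lra.
Qed.

Lemma jb_continuous : continuous (@japanese R).
Proof.
apply: (@continuous_compose _ _ _ Num.sqrt); first exact: sqrt_continuous.
by apply: cont_add; [exact: cont_cst|exact: exprn_continuous].
Qed.

Lemma powR_anti x y e : 0 < x -> x <= y -> 0 <= e -> y `^ (- e) <= x `^ (- e).
Proof.
move=> x0 xy e0; have y0 := lt_le_trans x0 xy.
rewrite !powRN lef_pV2 ?posrE ?powR_gt0 //.
by apply: (ge0_ler_powR e0) => //; rewrite nnegrE ltW.
Qed.

Lemma powR_anti_scale m x y e : 0 < m -> 0 < x -> x <= m * y -> 0 <= e ->
  y `^ (- e) <= m `^ e * x `^ (- e).
Proof.
move=> m0 x0 xy e0.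
have y0 : 0 < y by move: (lt_le_trans x0 xy); rewrite pmulr_rgt0.
rewrite !powRN -[leLHS]mul1r ler_pdivrMr ?powR_gt0 // mulrAC ler_pdivlMr ?powR_gt0 // mul1r.
rewrite -powRM ?(ltW m0) ?(ltW y0) //.
by apply: (ge0_ler_powR e0) => //; rewrite nnegrE ?mulr_ge0 // ltW.
Qed.

Lemma powR_continuous_at e x : 0 < x -> {for x, continuous (fun y => y `^ e)}.
Proof. by move=> x0; apply: is_derive_continuous; exact: is_derive1_powR. Qed.

Lemma jb_pow_continuous e : continuous (fun q => jb q `^ e).
Proof.
move=> q; apply: (@continuous_comp _ _ _ jb (fun y => y `^ e)); first exact: jb_continuous.
by apply: powR_continuous_at; exact: jb_gt0.
Qed.

Definition bracket_primitive e (F : R -> R) := forall q : R, is_derive q 1 F (jb q `^ (- e)).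

Lemma bracket_primitive_exists e : exists F, bracket_primitive e F.
Proof. by have [F HF] := antiderivative_exists (@jb_pow_continuous (- e)); exists F. Qed.

Lemma bracket_primitive_continuous e F : bracket_primitive e F -> continuous F.
Proof. by move=> HF q; exact: is_derive_continuous (HF q). Qed.

Lemma bracket_primitive_reflect e F : bracket_primitive e F ->
  bracket_primitive e (fun q => - F (- q)).
Proof.
by move=> HF q; apply: is_derive_comp_opp; have := HF (- q); rewrite jb_opp.
Qed.

Lemma bracket_primitive_mono e F a b : bracket_primitive e F -> a <= b -> F a <= F b.
Proof.
move=> HF ab; rewrite -subr_ge0; apply: le_trans (mean_value_bound ab _ _ (fun s _ => HF s) (fun s _ => HF s) _) => //.
- by apply: continuous_subspaceT; exact: bracket_primitive_continuous HF.
- by apply: continuous_subspaceT; exact: bracket_primitive_continuous HF.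
- by move=> s _; rewrite ger0_norm ?powR_ge0.
Qed.

Lemma jb_pow_le1 e q : 0 <= e -> jb q `^ (- e) <= 1.
Proof. by move=> e0; have := powR_anti ltr01 (jb_ge1 q) e0; rewrite powR1. Qed.

Lemma bracket_primitive_lip e F a b : 0 <= e -> bracket_primitive e F -> a <= b -> F b - F a <= b - a.
Proof.
move=> e0 HF ab; apply: le_trans (ler_norm _) _.
apply: (@mean_value_bound _ F id (fun q => jb q `^ (- e)) (fun=> 1)) => //.
- by apply: continuous_subspaceT; exact: bracket_primitive_continuous HF.
- by apply: continuous_subspaceT; exact: cont_id.
- by move=> s _; rewrite ger0_norm ?powR_ge0 // jb_pow_le1.
Qed.

(** On the half-line q >= 0 the bracket is comparable to 1 + q, whose powers have
    explicit primitives. *)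
Lemma bracket_primitive_compare e F (K dK : R -> R) d b : 0 <= e -> bracket_primitive e F ->
  0 <= d -> d <= b -> (forall q, 0 <= q -> is_derive q 1 K (dK q)) ->
  (forall q, 0 <= q -> (1 + q) `^ (- e) * 2 `^ e <= dK q) -> F b - F d <= K b - K d.
Proof.
move=> e0 HF d0 db HK leK; apply: le_trans (ler_norm _) _.
apply: (@mean_value_bound _ F K (fun q => jb q `^ (- e)) dK) => //.
- by apply: continuous_subspaceT; exact: bracket_primitive_continuous HF.
- apply: derivable_within_continuous => q; rewrite in_itv /= => /andP[dq _].
  by have := HK q (le_trans d0 dq) => ?; exact: ex_derive.
- by move=> q /andP[dq _]; apply: HK; rewrite (le_trans d0) ?(ltW dq).
- move=> q /andP[dq _]; rewrite ger0_norm ?powR_ge0 //.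
  have q0 : 0 <= q by rewrite (le_trans d0) ?(ltW dq).
  apply: le_trans (leK q q0); rewrite mulrC; apply: powR_anti_scale => //; first lra.
  by have := jb_ge_half q; rewrite ger0_norm.
Qed.

Lemma one_add_pow_derive e q : 0 <= q ->
  is_derive q 1 (fun q => (1 + q) `^ e) (e * (1 + q) `^ (e - 1)).
Proof.
move=> q0; have q1 : 0 < 1 + q by lra.
have D := @isd_comp _ (fun y => y `^ e) (fun q => 1 + q) q _ _ (is_derive1_powR e q1)
  (isd_add (isd_cst 1 q) (isd_id q)).
by apply: (isd_eq D); rewrite add0r mulr1.
Qed.

Lemma bracket_primitive_pow e F d b : 0 <= e -> e != 1 -> bracket_primitive e F ->
  0 <= d -> d <= b ->
  F b - F d <= 2 `^ e / (1 - e) * ((1 + b) `^ (1 - e) - (1 + d) `^ (1 - e)).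
Proof.
move=> e0 e1 HF d0 db; rewrite mulrBr.
have e1' : 1 - e != 0 by rewrite subr_eq0 eq_sym.
apply: (@bracket_primitive_compare e F (fun q => 2 `^ e / (1 - e) * (1 + q) `^ (1 - e))
  (fun q => (1 + q) `^ (- e) * 2 `^ e)) => // q q0.
apply: (isd_eq (isd_mull _ (one_add_pow_derive (1 - e) q0))).
by rewrite (_ : 1 - e - 1 = - e); [field|lra].
Qed.

Lemma bracket_primitive_log F d b : bracket_primitive 1 F -> 0 <= d -> d <= b ->
  F b - F d <= 2 * ln (1 + b).
Proof.
move=> HF d0 db.
have l0 : 0 <= 2 * ln (1 + d) by rewrite mulr_ge0 // ln_ge0 //; lra.
suff : F b - F d <= 2 * ln (1 + b) - 2 * ln (1 + d) by lra.
apply: (@bracket_primitive_compare 1 F (fun q => 2 * ln (1 + q)) (fun q => 2 * (1 + q)^-1)) => //.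
- move=> q q0; have q1 : 0 < 1 + q by lra.
  have D := @isd_comp _ (@ln R) (fun q => 1 + q) q _ _ (is_derive1_ln q1)
    (isd_add (isd_cst 1 q) (isd_id q)).
  by apply: (isd_eq (isd_mull 2 D)); rewrite add0r mulr1.
- by move=> q q0; rewrite powR_inv1 ?powRr1 //; [rewrite mulrC|lra].
Qed.

Lemma bracket_primitive_tail e F d b : 1 < e -> bracket_primitive e F ->
  0 <= d -> d <= b -> F b - F d <= 2 `^ e / (e - 1) * jb d `^ (1 - e).
Proof.
move=> e1 HF d0 db; have e0 : 0 <= e by lra.
have en1 : e != 1 by rewrite gt_eqF.
have := bracket_primitive_pow e0 en1 HF d0 db.
have P := powR_gt0 e (ltr0n R 2).
have E : 2 `^ e / (1 - e) * ((1 + b) `^ (1 - e) - (1 + d) `^ (1 - e)) =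
  2 `^ e / (e - 1) * ((1 + d) `^ (1 - e) - (1 + b) `^ (1 - e)).
  by field; rewrite !subr_eq0 ?en1 eq_sym ?en1.
rewrite E => /le_trans; apply; apply: ler_wpM2l.
  by rewrite divr_ge0 ?(ltW P) //; lra.
have : (1 + d) `^ (1 - e) <= jb d `^ (1 - e).
  rewrite -opprB; apply: powR_anti; rewrite ?jb_gt0 //; last lra.
  by have := jb_le_add d; rewrite ger0_norm.
by have := powR_ge0 (1 + b) (1 - e); lra.
Qed.

Lemma bracket_primitive_bounded e F : 1 < e -> bracket_primitive e F ->
  exists2 M, 0 < M & forall p q, `|F p - F q| <= M.
Proof.
move=> e1 HF; set C := 2 `^ e / (e - 1).
have C0 : 0 < C by rewrite divr_gt0 ?powR_gt0 //; lra.
have half (G : R -> R) q : bracket_primitive e G -> 0 <= q -> G q - G 0 <= C.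
  move=> HG q0; have := bracket_primitive_tail e1 HG (lexx 0) q0.
  by rewrite /japanese expr0n /= addr0 sqrtr1 powR1 mulr1.
have osc q : `|F q - F 0| <= C.
  have [q0|q0] := leP 0 q.
    rewrite ger0_norm; first exact: half.
    by rewrite subr_ge0; exact: bracket_primitive_mono HF q0.
  have q0' : 0 <= - q by lra.
  rewrite ler0_norm ?subr_le0; last by apply: (bracket_primitive_mono HF); exact: ltW.
  by have := half _ _ (bracket_primitive_reflect HF) q0'; rewrite !opprK oppr0; lra.
exists (2 * C) => [|p q]; first by rewrite mulr_gt0.
have -> : F p - F q = (F p - F 0) - (F q - F 0) by lra.
by apply: le_trans (ler_normB _ _) _; have := osc p; have := osc q; lra.
Qed.

Lemma bracket_primitive_growth e F a b : 0 <= e < 1 -> bracket_primitive e F ->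
  a <= 0 -> 0 <= b ->
  F b - F a <= 2 `^ e / (1 - e) * ((1 + b) `^ (1 - e) + (1 - a) `^ (1 - e)).
Proof.
move=> /andP[e0 e1] HF a0 b0; have en1 : e != 1 by rewrite lt_eqF.
have a0' : 0 <= - a by lra.
have H1 := bracket_primitive_pow e0 en1 HF (lexx 0) b0.
have H2 := bracket_primitive_pow e0 en1 (bracket_primitive_reflect HF) (lexx 0) a0'.
have C0 : 0 <= 2 `^ e / (1 - e) by rewrite divr_ge0 ?powR_ge0 //; lra.
move: H1 H2; rewrite addr0 powR1 !opprK oppr0 mulrDr !mulrBr mulr1; lra.
Qed.

End Brackets.

(** * Decay of solutions in the backward cone *)

Section Estimates.
Context {R : realType}.
Local Notation PT := (R * 'rV[R]_3)%type.
Local Notation H := (@halfspace R).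
Implicit Types (g v Phi Psi : PT -> R) (x y z : 'rV[R]_3) (t s r rho A m : R).

Lemma isd_sum (I : Type) (l : seq I) (f : I -> R -> R) (d : I -> R) (s : R) :
  (forall i, is_derive s 1 (f i) (d i)) ->
  is_derive s 1 (fun q => \sum_(i <- l) f i q) (\sum_(i <- l) d i).
Proof.
move=> Hf; elim: l => [|i l IH].
  rewrite big_nil (_ : (fun q => _) = fun=> 0); first exact: isd_cst.
  by apply/funext => q; rewrite big_nil.
rewrite big_cons (_ : (fun q => _) = fun q => f i q + \sum_(i <- l) f i q).
  exact: isd_add.
by apply/funext => q; rewrite big_cons.
Qed.

Definition mean_momentum (c t : R) z e1 e2 e3 v s : R :=
  T (fun th ph => sin th * ray_momentum c t z v (sphere e1 e2 e3 th ph) s).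

(** The sum over the speeds takes the place of the minimum in the weight: a power of the
    minimum with negative exponent is at most the sum of the powers. *)
Definition source_bound (I : finType) (sp : I -> R) (c kappa mu t : R) x A g :=
  forall s y, cone c t x (s, y) -> enorm y * `|g (s, y)| <=
    A * (jb (s + enorm y) `^ (- kappa) * \sum_i jb (sp i * s - enorm y) `^ (- (1 + mu))).

Lemma ray_in_cone (c t s : R) x e1 e2 e3 th ph : 0 < c -> 0 <= s <= t -> frame e1 e2 e3 ->
  cone c t x (s, ray x (sphere e1 e2 e3 th ph) (c * (t - s))).
Proof.
move=> c0 st fr; split => //=.
have rho0 : 0 <= c * (t - s) by rewrite mulr_ge0 ?(ltW c0) //; case/andP: st; lra.
by rewrite /ray addrAC subrr add0r enormZ (sphere_norm _ _ fr) mulr1 ger0_norm.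
Qed.

Section Source.
Variables (I : finType) (sp : I -> R) (c mu : R).
Hypotheses (sp0 : forall i, 0 <= sp i) (c0 : 0 < c) (mu0 : 0 < mu).
Variable F : R -> R.
Hypothesis HF : bracket_primitive (1 + mu) F.

(** On the sphere at time s the bracket of s + lambda is frozen at its infimum, and the
    remaining functions of lambda are integrated by sphere_bound. *)
Lemma mean_source_bound (kappa t s r A m : R) e1 e2 e3 g : 0 < r -> 0 < s < t ->
  0 <= A -> 0 <= m -> frame e1 e2 e3 -> smooth g ->
  source_bound sp c kappa mu t (r *: e1) A g ->
  (forall l : R, `|r - c * (t - s)| <= l -> jb (s + l) `^ (- kappa) <= m) ->
  `|T (fun th ph => sin th * (c * (t - s) *
      extend g (s, ray (r *: e1) (sphere e1 e2 e3 th ph) (c * (t - s)))))| <=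
  2 * pi * A * m / r * \sum_i (F (r + c * (t - s) - sp i * s) - F (`|r - c * (t - s)| - sp i * s)).
Proof.
move=> r0 /andP[s0 st] A0 m0 fr sg Hg le_m.
set rho := c * (t - s).
have rho0 : 0 < rho by rewrite mulr_gt0 // subr_gt0.
pose Fs q := rho * A * m * \sum_i F (q - sp i * s).
pose k q := rho * A * m * \sum_i jb (q - sp i * s) `^ (- (1 + mu)).
have HFs (q : R) : is_derive q 1 Fs (k q).
  apply: isd_mull; apply: isd_sum => i.
  apply: (isd_eq (isd_comp (HF _) (isd_sub (isd_id q) (isd_cst (sp i * s) q)))).
  by rewrite subr0 mulr1.
have jh : joint (fun th ph => rho * extend g (s, ray (r *: e1) (sphere e1 e2 e3 th ph) rho)).
  by rewrite /joint; cont.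
have le_h th ph : 0 < th < pi ->
    `|rho * extend g (s, ray (r *: e1) (sphere e1 e2 e3 th ph) rho)| <=
    k (chord r rho th) / chord r rho th.
  move=> thin; have [ch0 _] := chord_derive r0 rho0 thin.
  have := Hg s _ (@ray_in_cone c t s (r *: e1) e1 e2 e3 th ph c0 _ fr).
  rewrite (ltW s0) (ltW st) -/rho => /(_ isT).
  rewrite (chord_sphere th ph (ltW r0) (ltW rho0) fr) => Hb.
  rewrite extendE; last exact: ltW.
  rewrite ler_pdivlMr // normrM (ger0_norm (ltW rho0)).
  rewrite -[leLHS]mulrA [X in rho * X <= _]mulrC /k -[rho * A * m]mulrA -[leRHS]mulrA -[A * m * _]mulrA ler_pM2l //.
  apply: (le_trans Hb); apply: ler_wpM2l => //.
  have E : \sum_i jb (sp i * s - chord r rho th) `^ (- (1 + mu)) =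
     \sum_i jb (chord r rho th - sp i * s) `^ (- (1 + mu)).
    by apply: eq_bigr => i _; rewrite -jb_opp opprB.
  rewrite E; apply: ler_wpM2r; first by apply: sumr_ge0 => i _; exact: powR_ge0.
  by apply: le_m; apply: chord_ge; exact: ltW.
have := sphere_bound r0 rho0 jh HFs le_h.
move/le_trans; apply; rewrite /Fs -mulrBr -sumrB le_eqVlt; apply/orP; left; apply/eqP.
by field; rewrite !lt0r_neq0.
Qed.

Lemma kirchhoff_estimate (kappa t r A : R) e1 e2 e3 g v (m K dK : R -> R) :
  0 < r -> 0 < t -> 0 <= A -> frame e1 e2 e3 -> smooth g -> smooth v ->
  (forall p, H p -> box c v p = g p) ->
  source_bound sp c kappa mu t (r *: e1) A g ->
  (forall s, 0 < s < t -> 0 <= m s /\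
    forall l : R, `|r - c * (t - s)| <= l -> jb (s + l) `^ (- kappa) <= m s) ->
  {within `[0, t], continuous K} ->
  (forall s, 0 < s < t -> is_derive s 1 K (dK s)) ->
  (forall s, 0 < s < t -> m s *
     \sum_i (F (r + c * (t - s) - sp i * s) - F (`|r - c * (t - s)| - sp i * s)) <= dK s) ->
  `|4 * pi * (c * v (t, r *: e1)) - mean_momentum c t (r *: e1) e1 e2 e3 v 0| <=
  2 * pi * A / r * (K t - K 0).
Proof.
move=> r0 t0 A0 fr sg sv eqv Hg Hm cK HK le_m.
have [cf _ _] := fr.
rewrite mulrBr.
apply: (kirchhoff_bound (K := fun s => 2 * pi * A / r * K s) (dK := fun s => 2 * pi * A / r * dK s)
  cf t0 sv sg eqv).
- by move=> s; apply: cvgM; [exact: cvg_cst|exact: cK].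
- by move=> s st; apply: isd_mull; exact: HK.
- move=> s st; have [m0 Hms] := Hm s st.
  apply: (le_trans (mean_source_bound r0 st A0 m0 fr sg Hg Hms)).
  have -> : 2 * pi * A * m s / r = 2 * pi * A / r * m s by ring.
  rewrite -mulrA; apply: ler_wpM2l; last exact: le_m.
  by rewrite divr_ge0 ?(ltW r0) // !mulr_ge0 ?pi_ge0.
Qed.

(** This holds because c t - r and c (t - s) - r differ by c s. *)
Lemma cone_time (t s r l : R) : 0 <= s -> `|r - c * (t - s)| <= l ->
  s + `|c * t - r| <= (1 + c) * (s + l).
Proof.
move=> s0 rl.
have : `|c * t - r| <= `|r - c * (t - s)| + c * s.
  have -> : c * t - r = - (r - c * (t - s)) + c * s by ring.
  by apply: (le_trans (ler_normD _ _)); rewrite normrN (ger0_norm (mulr_ge0 (ltW c0) s0)).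
have : 0 <= l by apply: le_trans rl.
have := mulr_ge0 (ltW c0) s0 => cs l0.
have := mulr_ge0 (ltW c0) l0; lra.
Qed.

Lemma cone_time_pow (kappa t s r l d : R) : 0 <= kappa -> 0 <= s -> 0 <= d ->
  d <= s + `|c * t - r| -> `|r - c * (t - s)| <= l ->
  jb (s + l) `^ (- kappa) <= (1 + c) `^ kappa * jb d `^ (- kappa).
Proof.
move=> k0 s0 d0 ds rl; have l0 : 0 <= l by apply: le_trans rl.
have c1 : 0 < 1 + c by rewrite addr_gt0.
apply: (powR_anti_scale c1) => //; first exact: jb_gt0.
apply: jb_scale; first by rewrite lerDl ltW.
rewrite !ger0_norm ?addr_ge0 //; apply: (le_trans ds).
exact: cone_time.
Qed.

Variable M : R.
Hypotheses (M0 : 0 < M) (HM : forall p q, `|F p - F q| <= M).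

Let card : R := #|I|%:R.

Lemma osc_sum (p q : I -> R) : \sum_i (F (p i) - F (q i)) <= card * M.
Proof.
apply: (@le_trans _ _ (\sum_(i : I) M)).
  by apply: ler_sum => i _; apply: le_trans (HM _ _); exact: ler_norm.
by rewrite sumr_const mulr_natl.
Qed.

(** Time slices: each sphere of the cone contributes at most the total oscillation of F
    divided by r, and the bracket of s + |ct - r| is integrated in time. *)
Lemma slice_estimate (kappa t r A : R) (S : R -> R) e1 e2 e3 g v :
  0 <= kappa -> bracket_primitive kappa S ->
  0 < r -> 0 < t -> 0 <= A -> frame e1 e2 e3 -> smooth g -> smooth v ->
  (forall p, H p -> box c v p = g p) ->
  source_bound sp c kappa mu t (r *: e1) A g ->
  r * `|4 * pi * (c * v (t, r *: e1)) - mean_momentum c t (r *: e1) e1 e2 e3 v 0| <=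
  2 * pi * (1 + c) `^ kappa * (card * M) * A * (S (t + `|c * t - r|) - S `|c * t - r|).
Proof.
move=> k0 HS r0 t0 A0 fr sg sv eqv Hg; pose d : R := `|c * t - r|; rewrite -/d.
have d0 : 0 <= d by exact: normr_ge0.
have C0 : 0 <= (1 + c) `^ kappa by exact: powR_ge0.
have cM0 : 0 <= card * M by rewrite mulr_ge0 ?ler0n // ltW.
pose m s := (1 + c) `^ kappa * jb (s + d) `^ (- kappa).
pose K s := (1 + c) `^ kappa * (card * M) * S (s + d).
pose dK s := (1 + c) `^ kappa * (card * M) * jb (s + d) `^ (- kappa).
have dS (s : R) : is_derive s 1 (fun s => S (s + d)) (jb (s + d) `^ (- kappa)).
  by apply: (isd_eq (isd_comp (HS _) (isd_add (isd_id s) (isd_cst d s)))); rewrite addr0 mulr1.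
have Hm s : 0 < s < t -> 0 <= m s /\
    forall l : R, `|r - c * (t - s)| <= l -> jb (s + l) `^ (- kappa) <= m s.
  move=> /andP[s0 st]; split; first by rewrite mulr_ge0 ?powR_ge0.
  move=> l rl; apply: (cone_time_pow (t := t) (r := r)) => //; rewrite ?addr_ge0 ?(ltW s0) //.
have cK : {within `[0, t], continuous K}.
  apply: continuous_subspaceT; apply: cont_mul; first exact: cont_cst.
  by move=> s; exact: is_derive_continuous (dS s).
have HK s : 0 < s < t -> is_derive s 1 K (dK s) by move=> _; exact: isd_mull.
have le_m s : 0 < s < t -> m s *
     \sum_i (F (r + c * (t - s) - sp i * s) - F (`|r - c * (t - s)| - sp i * s)) <= dK s.
  move=> _; rewrite /m /dK [leRHS]mulrAC; apply: ler_wpM2l; last exact: osc_sum.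
  by rewrite mulr_ge0 ?powR_ge0.
have B := kirchhoff_estimate r0 t0 A0 fr sg sv eqv Hg Hm cK HK le_m.
rewrite mulrC -ler_pdivlMr //; apply: (le_trans B).
by rewrite le_eqVlt /K add0r; apply/orP; left; apply/eqP; field; exact: lt0r_neq0.
Qed.

(** Strips: the sphere means of an increasing function F of distance minus sp * s are
    differences of F over intervals of length 2 r, centred at a point that moves
    with speed c + sp; integrated in time they telescope. *)
Lemma strip_estimate (kappa t r A : R) e1 e2 e3 g v :
  0 <= kappa -> 0 < r -> 0 < t -> 0 <= A -> frame e1 e2 e3 -> smooth g -> smooth v ->
  (forall p, H p -> box c v p = g p) ->
  source_bound sp c kappa mu t (r *: e1) A g ->
  `|4 * pi * (c * v (t, r *: e1)) - mean_momentum c t (r *: e1) e1 e2 e3 v 0| <=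
  4 * pi * (1 + c) `^ kappa * (card * M) / c * A * jb (c * t - r) `^ (- kappa).
Proof.
move=> k0 r0 t0 A0 fr sg sv eqv Hg.
have C0 : 0 <= (1 + c) `^ kappa by exact: powR_ge0.
(* The time integral of F (b + r) - F (b - r) is expressed by a second primitive. *)
have [F2 HF2] := antiderivative_exists (bracket_primitive_continuous HF).
pose m0 : R := (1 + c) `^ kappa * jb (c * t - r) `^ (- kappa).
have m00 : 0 <= m0 by rewrite mulr_ge0 ?powR_ge0.
pose b i s := c * t - (c + sp i) * s.
have b' i s : is_derive s 1 (b i) (- (c + sp i)).
  by apply: (isd_eq (isd_sub (isd_cst (c * t) s) (isd_mull (c + sp i) (isd_id s)))); rewrite sub0r mulr1.
pose K s := m0 * \sum_i - (c + sp i)^-1 * (F2 (b i s + r) - F2 (b i s - r)).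
pose dK s := m0 * \sum_i (F (b i s + r) - F (b i s - r)).
have HKall s : is_derive s 1 K (dK s).
  apply: isd_mull; apply: isd_sum => i.
  have ci : c + sp i != 0 by rewrite lt0r_neq0 // ltr_wpDr.
  apply: (isd_eq (isd_mull _ (isd_sub
    (isd_comp (HF2 _) (isd_add (b' i s) (isd_cst r s)))
    (isd_comp (HF2 _) (isd_sub (b' i s) (isd_cst r s)))))).
  by field.
have Hm s : 0 < s < t -> 0 <= m0 /\
    forall l : R, `|r - c * (t - s)| <= l -> jb (s + l) `^ (- kappa) <= m0.
  move=> /andP[s0 st]; split=> // l rl; rewrite /m0 -(jb_abs (c * t - r)).
  by apply: (cone_time_pow (t := t) (r := r)) => //; [exact: ltW|rewrite lerDr ltW].
have cK : {within `[0, t], continuous K}.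
  by apply: continuous_subspaceT => s; exact: is_derive_continuous (HKall s).
have le_m s : 0 < s < t -> m0 *
     \sum_i (F (r + c * (t - s) - sp i * s) - F (`|r - c * (t - s)| - sp i * s)) <= dK s.
  move=> _; apply: ler_wpM2l => //; apply: ler_sum => i _; apply: lerB.
    by rewrite le_eqVlt; apply/orP; left; apply/eqP; congr F; rewrite /b; ring.
  apply: (bracket_primitive_mono HF).
  have : c * (t - s) - r <= `|r - c * (t - s)| by rewrite distrC; exact: ler_norm.
  by rewrite /b; lra.
have B := kirchhoff_estimate r0 t0 A0 fr sg sv eqv Hg Hm cK (fun s _ => HKall s) le_m.
apply: (le_trans B).
have diff p q : (F2 (p + r) - F2 (p - r)) - (F2 (q + r) - F2 (q - r)) <= M * (2 * r).
  have rr : - r <= r by lra.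
  pose f u := F2 (p + u) - F2 (q + u).
  have Hf (u : R) : is_derive u 1 f (F (p + u) - F (q + u)).
    apply: (isd_eq (isd_sub (isd_comp (HF2 _) (isd_add (isd_cst p u) (isd_id u)))
      (isd_comp (HF2 _) (isd_add (isd_cst q u) (isd_id u))))).
    by rewrite add0r !mulr1.
  have HMu (u : R) : is_derive u 1 (fun u => M * u) M.
    by apply: (isd_eq (isd_mull M (isd_id u))); rewrite mulr1.
  have := @mean_value_bound _ f (fun u => M * u) (fun u => F (p + u) - F (q + u)) (fun=> M) (- r) r rr.
  have cf : {within `[- r, r], continuous f}.
    by apply: continuous_subspaceT => u; exact: is_derive_continuous (Hf u).
  have cM : {within `[- r, r], continuous (fun u => M * u)}.
    by apply: continuous_subspaceT => u; exact: is_derive_continuous (HMu u).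
  move=> /(_ cf cM (fun u _ => Hf u) (fun u _ => HMu u) (fun u _ => HM _ _)) /(le_trans (ler_norm _)).
  by rewrite /f; lra.
have KK : K t - K 0 <= m0 * (card * (M * (2 * r) / c)).
  rewrite /K -mulrBr -sumrB; apply: ler_wpM2l => //.
  apply: (@le_trans _ _ (\sum_(i : I) M * (2 * r) / c)); last by rewrite sumr_const -[leLHS]mulr_natl.
  apply: ler_sum => i _.
  rewrite -mulrBr mulNr -mulrN opprB mulrC -/(_ / _).
  have ci : 0 < c + sp i by rewrite ltr_wpDr.
  apply: (@le_trans _ _ (M * (2 * r) / (c + sp i))).
    by rewrite ler_wpM2r ?invr_ge0 ?(ltW ci) // diff.
  rewrite ler_wpM2l ?mulr_ge0 ?(ltW M0) ?(ltW r0) // lef_pV2 ?posrE //.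
  by rewrite lerDl.
apply: (@le_trans _ _ (2 * pi * A / r * (m0 * (card * (M * (2 * r) / c))))).
  by apply: ler_wpM2l => //; rewrite divr_ge0 ?(ltW r0) // !mulr_ge0 ?pi_ge0.
by rewrite le_eqVlt /m0; apply/orP; left; apply/eqP; field; rewrite !lt0r_neq0.
Qed.

End Source.

(** The primitive of <q>^-kappa has a logarithm exactly for kappa = 1. *)
Definition log_loss (kappa t r : R) : R := if kappa == 1 then ln (2 + t + r) else 1.

Lemma ln_ge_ln2 (t r : R) : 0 <= t -> 0 <= r -> ln 2 <= ln (2 + t + r).
Proof. by move=> t0 r0; rewrite ler_ln ?posrE; lra. Qed.

Lemma ln2_gt0 : 0 < ln 2 :> R.
Proof. by rewrite ln_gt0 // ltr1n. Qed.

Lemma log_loss_ge (kappa t r : R) : 0 <= t -> 0 <= r -> Num.min 1 (ln 2) <= log_loss kappa t r.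
Proof.
move=> t0 r0; rewrite /log_loss; case: ifP => _; rewrite ge_min ?lexx //.
by rewrite ln_ge_ln2 // orbT.
Qed.

Lemma ln_scale (a : R) : 1 <= a -> exists2 C, 0 < C &
  forall u, 0 <= u -> ln (1 + a * u) <= C * ln (2 + u).
Proof.
move=> a1; have a0 : 0 < a by exact: lt_le_trans a1.
have l0 : 0 < ln 2 :> R := ln2_gt0.
exists (ln a / ln 2 + 1) => [|u u0].
  by rewrite ltr_wpDl // divr_ge0 ?(ltW l0) // ln_ge0.
apply: (@le_trans _ _ (ln (a * (2 + u)))).
  have h := mulr_ge0 (ltW a0) u0.
  rewrite ler_ln ?posrE; [|lra|by rewrite mulr_gt0 //; lra]; lra.
rewrite lnM ?posrE //; last lra.
rewrite mulrDl mul1r lerD2r -mulrA -[leLHS]mulr1; apply: ler_wpM2l; first exact: ln_ge0.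
by rewrite mulrC ler_pdivlMr // mul1r ler_ln ?posrE; lra.
Qed.

Lemma ln_path (c : R) : 0 < c -> exists2 C, 0 < C & forall r t : R, 0 <= r -> 0 <= t ->
  ln (1 + (r + c * t)) <= C * ln (2 + t + r).
Proof.
move=> c0; have c1 : 1 <= 1 + c by rewrite lerDl ltW.
have [C C0 HC] := ln_scale c1; exists C => // r t r0 t0.
apply: (@le_trans _ _ (ln (1 + (1 + c) * (t + r)))).
  have h1 := mulr_ge0 (ltW c0) r0; have h4 := mulr_ge0 (ltW c0) t0.
  have h2 : 1 + (r + c * t) <= 1 + (1 + c) * (t + r) by lra.
  have h3 : 0 < 1 + (r + c * t) by lra.
  by rewrite ler_ln ?posrE //; exact: lt_le_trans h2.
by have := HC (t + r); rewrite addr_ge0 // addrA; apply.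
Qed.

(** t + r is at most a multiple of the larger of r and <ct - r>. *)
Lemma combine_axis (c t r X P : R) : 0 < c -> 0 < t -> 0 <= r -> 0 <= X ->
  r * X <= P -> jb (c * t - r) * X <= P -> jb (t + r) * X <= 2 * (1 + c^-1) * P.
Proof.
move=> c0 t0 r0 X0 H1 H2.
have ci : 0 < c^-1 by rewrite invr_gt0.
have J : jb (t + r) <= (1 + c^-1) * (r + jb (c * t - r)).
  have := jb_le_add (t + r); rewrite ger0_norm ?addr_ge0 ?(ltW t0) // => h1.
  have h2 := jb_ge1 (c * t - r); have h3 := jb_ge_abs (c * t - r).
  have h4 : t <= c^-1 * (jb (c * t - r) + r).
    rewrite -[leLHS]mul1r -(mulVf (lt0r_neq0 c0)) -mulrA ler_pM2l //.
    by have := ler_norm (c * t - r); lra.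
  lra.
apply: (@le_trans _ _ ((1 + c^-1) * (r + jb (c * t - r)) * X)); first by rewrite ler_wpM2r.
have -> : (1 + c^-1) * (r + jb (c * t - r)) * X = (1 + c^-1) * (r * X + jb (c * t - r) * X) by ring.
have -> : 2 * (1 + c^-1) * P = (1 + c^-1) * (P + P) by ring.
by rewrite ler_wpM2l ?addr_ge0 ?(ltW ci) // lerD.
Qed.

Lemma jb_pow_shift (kappa q : R) : jb q * jb q `^ (- kappa) = jb q `^ (1 - kappa).
Proof.
rewrite -[X in X * _](powRr1 (jb_ge0 q)) -powRD //.
by apply/implyP => _; rewrite lt0r_neq0 ?jb_gt0.
Qed.

(** Slices give a factor 1/r and strips a factor 1/<ct - r>; together they give
    1/<t + r>. *)
Lemma source_decay (I : finType) (sp : I -> R) (c kappa mu : R) :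
  (forall i, 0 <= sp i) -> 0 < c -> 0 < mu -> 1 <= kappa -> exists2 C, 0 < C &
  forall t r A e1 e2 e3 g v, 0 < r -> 0 < t -> 0 <= A -> frame e1 e2 e3 ->
  smooth g -> smooth v -> (forall p, H p -> box c v p = g p) ->
  source_bound sp c kappa mu t (r *: e1) A g ->
  jb (t + r) * `|4 * pi * (c * v (t, r *: e1)) - mean_momentum c t (r *: e1) e1 e2 e3 v 0| <=
  C * (A * (jb (c * t - r) `^ (1 - kappa) * log_loss kappa t r)).
Proof.
move=> sp0 c0 mu0 k1.
have mu1 : 1 < 1 + mu by lra.
have k0 : 0 <= kappa by lra.
have [F HF] := bracket_primitive_exists (1 + mu).
have [M M0 HM] := bracket_primitive_bounded mu1 HF.
have [S HS] := bracket_primitive_exists kappa.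
pose C1 := 2 * pi * (1 + c) `^ kappa * (#|I|%:R * M).
pose C2 := 4 * pi * (1 + c) `^ kappa * (#|I|%:R * M) / c.
have C10 : 0 <= C1 by rewrite !mulr_ge0 ?pi_ge0 ?powR_ge0 ?ler0n ?(ltW M0).
have C20 : 0 <= C2 by rewrite divr_ge0 ?(ltW c0) // !mulr_ge0 ?pi_ge0 ?powR_ge0 ?ler0n ?(ltW M0).
have L0 : 0 < Num.min 1 (ln 2) :> R by rewrite lt_min ltr01 ln2_gt0.
have [C3 C30 HC3] : exists2 C3, 0 < C3 & forall t r : R, 0 < r -> 0 < t ->
    S (t + `|c * t - r|) - S `|c * t - r| <=
    C3 * (jb (c * t - r) `^ (1 - kappa) * log_loss kappa t r).
  have [k1'|k1'] := eqVneq kappa 1.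
    have c1 : 0 < 1 + c by rewrite addr_gt0.
    have [CL CL0 HCL] := ln_path c1.
    exists (2 * CL) => [|t r r0 t0]; first by rewrite mulr_gt0.
    rewrite /log_loss k1' eqxx subrr powRr0 mul1r; rewrite k1' in HS.
    apply: (le_trans (bracket_primitive_log HS (normr_ge0 _) _)); first by rewrite lerDr ltW.
    rewrite -mulrA; apply: ler_wpM2l => //; apply: le_trans (HCL r t (ltW r0) (ltW t0)).
    have d1 : `|c * t - r| <= c * t + r.
      by apply: (le_trans (ler_normB _ _)); rewrite !ger0_norm ?mulr_ge0 ?(ltW c0) ?(ltW t0) ?(ltW r0).
    have d2 := normr_ge0 (c * t - r).
    have d3 : 0 < 1 + (t + `|c * t - r|) by lra.
    have d4 : 1 + (t + `|c * t - r|) <= 1 + (r + (1 + c) * t) by lra.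
    by rewrite ler_ln ?posrE //; exact: lt_le_trans d4.
  have k2 : 1 < kappa by rewrite lt_neqAle eq_sym k1'.
  exists (2 `^ kappa / (kappa - 1)) => [|t r r0 t0].
    by rewrite divr_gt0 ?powR_gt0 //; lra.
  rewrite /log_loss (negbTE k1') mulr1 -(jb_abs (c * t - r)).
  by apply: bracket_primitive_tail => //; rewrite lerDr ltW.
have Q1 : 0 <= C1 * C3 by rewrite mulr_ge0 // ltW.
have Q2 : 0 <= C2 / Num.min 1 (ln 2) by rewrite divr_ge0 // ltW.
exists (2 * (1 + c^-1) * (C1 * C3 + C2 / Num.min 1 (ln 2) + 1)).
  have P0 : 0 < C1 * C3 + C2 / Num.min 1 (ln 2) + 1 by lra.
  by rewrite mulr_gt0 // mulr_gt0 // addr_gt0 // invr_gt0.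
move=> t r A e1 e2 e3 g v r0 t0 A0 fr sg sv eqv Hg.
pose X : R := `|4 * pi * (c * v (t, r *: e1)) - mean_momentum c t (r *: e1) e1 e2 e3 v 0|.
rewrite -/X; set E := A * _.
have JE : 0 <= jb (c * t - r) `^ (1 - kappa) by exact: powR_ge0.
have Lge := log_loss_ge kappa (ltW t0) (ltW r0).
have Lp : 0 <= log_loss kappa t r by apply: le_trans Lge; exact: ltW.
have E0 : 0 <= E by rewrite /E !mulr_ge0.
rewrite -[leRHS]mulrA; apply: (combine_axis c0 t0 (ltW r0) (normr_ge0 _)).
- apply: (le_trans (slice_estimate c0 HF M0 HM k0 HS r0 t0 A0 fr sg sv eqv Hg)).
  rewrite -/C1; apply: (@le_trans _ _ (C1 * C3 * E)).
    rewrite -[leLHS]mulrA -[leRHS]mulrA; apply: ler_wpM2l => //.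
    by rewrite /E mulrCA; apply: ler_wpM2l => //; exact: HC3.
  by rewrite ler_wpM2r //; lra.
- have B := strip_estimate sp0 c0 HF M0 HM k0 r0 t0 A0 fr sg sv eqv Hg.
  apply: (@le_trans _ _ (jb (c * t - r) * (C2 * A * jb (c * t - r) `^ (- kappa)))).
    by rewrite ler_wpM2l ?jb_ge0.
  have -> : jb (c * t - r) * (C2 * A * jb (c * t - r) `^ (- kappa)) =
     C2 * (A * jb (c * t - r) `^ (1 - kappa)) by rewrite -jb_pow_shift; ring.
  apply: (@le_trans _ _ (C2 / Num.min 1 (ln 2) * E)).
    have -> : C2 / Num.min 1 (ln 2) * E = C2 * (E / Num.min 1 (ln 2)) by ring.
    apply: ler_wpM2l => //; rewrite ler_pdivlMr // /E -mulrA.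
    by apply: ler_wpM2l => //; apply: ler_wpM2l.
  by rewrite ler_wpM2r //; lra.
Qed.

Lemma dx_zero_trace v x j : (forall y, v (0, y) = 0) -> dx j v (0, x) = 0.
Proof.
move=> v0; rewrite (dx_trace (g := fun=> 0) j x v0); apply: partial_vanish => //; exact: H0.
Qed.

Lemma mean_momentum_zero (c t : R) z e1 e2 e3 v :
  (forall y, v (0, y) = 0) -> (forall y, dt v (0, y) = 0) ->
  mean_momentum c t z e1 e2 e3 v 0 = 0.
Proof.
move=> v0 v1; transitivity (T (fun th _ => sin th * (0 : R))); last by rewrite T_const mulr0.
congr T; apply/funext => th; apply/funext => ph; congr (_ * _).
rewrite /ray_momentum /grad !extendE ?v0 ?v1 ?(dx_zero_trace _ _ v0); try exact: H0.
by ring.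
Qed.

Lemma bottom_sphere (c t : R) x e1 e2 e3 th ph : 0 < c -> 0 < t -> frame e1 e2 e3 ->
  enorm (ray x (sphere e1 e2 e3 th ph) (c * t) - x) <= c * t.
Proof.
move=> c0 t0 fr; have := @ray_in_cone c t 0 x e1 e2 e3 th ph c0 _ fr.
by rewrite lexx (ltW t0) => /(_ isT) [_ /=]; rewrite subr0.
Qed.

(** An initial velocity that may be singular at the origin, as the source at time 0 is;
    the two cases are one time slice and one strip of source_decay. *)
Lemma velocity_decay (c kappa mu : R) : 0 < c -> 0 < mu -> 0 <= kappa -> exists2 C, 0 < C &
  forall t r A e1 e2 e3 v, 0 < r -> 0 < t -> 0 <= A -> frame e1 e2 e3 -> smooth v ->
  (forall y, v (0, y) = 0) ->
  (forall y, enorm (y - r *: e1) <= c * t ->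
     enorm y * `|dt v (0, y)| <= A * jb (enorm y) `^ (- (kappa + (1 + mu)))) ->
  jb (t + r) * `|mean_momentum c t (r *: e1) e1 e2 e3 v 0| <=
  C * (A * jb (c * t - r) `^ (1 - kappa)).
Proof.
move=> c0 mu0 k0.
have mu1 : 1 < 1 + mu by lra.
have [F HF] := bracket_primitive_exists (1 + mu).
have [M M0 HM] := bracket_primitive_bounded mu1 HF.
exists (2 * (1 + c^-1) * (2 * pi * M + 4 * pi)) => [|t r A e1 e2 e3 v r0 t0 A0 fr sv v0 v1].
  by rewrite !mulr_gt0 ?addr_gt0 ?mulr_gt0 ?invr_gt0 ?pi_gt0.
set J := mean_momentum _ _ _ _ _ _ _ _; set rho := c * t.
have rho0 : 0 < rho by rewrite mulr_gt0.
pose m := jb (rho - r) `^ (- kappa).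
have m0 : 0 <= m by exact: powR_ge0.
pose h th ph := rho * extend (dt v) (0, ray (r *: e1) (sphere e1 e2 e3 th ph) rho).
have JE : J = T (fun th ph => sin th * h th ph).
  rewrite /J /mean_momentum; congr T; apply/funext => th; apply/funext => ph; congr (_ * _).
  rewrite /ray_momentum /grad subr0 -/rho !extendE ?v0 ?(dx_zero_trace _ _ v0); try exact: H0.
  by rewrite /h extendE; [ring|exact: H0].
have jh : joint h by rewrite /joint /h; cont.
have HFs (q : R) : is_derive q 1 (fun q => rho * A * m * F q)
    (rho * A * m * jb q `^ (- (1 + mu))) by exact: isd_mull.
have le_h th ph : 0 < th < pi -> `|h th ph| <=
    rho * A * m * jb (chord r rho th) `^ (- (1 + mu)) / chord r rho th.
  move=> thin; have [ch0 _] := chord_derive r0 rho0 thin.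
  have := v1 _ (@bottom_sphere c t (r *: e1) e1 e2 e3 th ph c0 t0 fr).
  rewrite -/rho (chord_sphere th ph (ltW r0) (ltW rho0) fr) => Hb.
  rewrite /h extendE; last exact: H0.
  rewrite ler_pdivlMr // normrM (ger0_norm (ltW rho0)).
  rewrite -[leLHS]mulrA [X in rho * X <= _]mulrC -[rho * A * m]mulrA -[leRHS]mulrA
    -[A * m * _]mulrA ler_pM2l //.
  apply: (le_trans Hb); apply: ler_wpM2l => //.
  rewrite opprD powRD; last by apply/implyP => _; rewrite lt0r_neq0 ?jb_gt0.
  apply: ler_wpM2r; first exact: powR_ge0.
  apply: powR_anti => //; first exact: jb_gt0.
  apply: jb_mono; rewrite [leRHS]ger0_norm ?(ltW ch0) // distrC.
  by apply: chord_ge; exact: ltW.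
have := sphere_bound r0 rho0 jh HFs le_h; rewrite -JE -mulrBr => B.
have {}B : `|J| <= 2 * pi * A * m / r * (F (r + rho) - F `|r - rho|).
  by apply: (le_trans B); rewrite le_eqVlt; apply/orP; left; apply/eqP; field; rewrite !lt0r_neq0.
have Cm : 0 <= 2 * pi * A * m / r by rewrite divr_ge0 ?(ltW r0) // !mulr_ge0 ?pi_ge0.
have mm : m <= jb (rho - r) `^ (1 - kappa).
  by rewrite -jb_pow_shift ler_peMl ?jb_ge1 ?powR_ge0.
rewrite -[leRHS]mulrA; apply: (combine_axis c0 t0 (ltW r0) (normr_ge0 _)).
- rewrite mulrC -ler_pdivlMr //; apply: (le_trans B).
  apply: (@le_trans _ _ (2 * pi * A * m / r * M)).
    by apply: ler_wpM2l => //; apply: le_trans (HM _ _); exact: ler_norm.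
  rewrite mulrAC ler_pM2r ?invr_gt0 //.
  apply: (@le_trans _ _ (2 * pi * M * (A * jb (rho - r) `^ (1 - kappa)))).
    have -> : 2 * pi * A * m * M = 2 * pi * M * (A * m) by ring.
    by apply: ler_wpM2l; [rewrite !mulr_ge0 ?pi_ge0 ?(ltW M0)|apply: ler_wpM2l].
  by apply: ler_wpM2r; [rewrite mulr_ge0 ?powR_ge0|have := pi_ge0 R; lra].
- apply: (@le_trans _ _ (jb (rho - r) * (2 * pi * A * m / r * (2 * r)))).
    apply: ler_wpM2l; first exact: jb_ge0.
    apply: (le_trans B); apply: ler_wpM2l => //.
    apply: (@le_trans _ _ (F (r + rho) - F (rho - r))).
      apply: lerB => //; apply: (bracket_primitive_mono HF).
      by rewrite distrC; exact: ler_norm.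
    have rr : rho - r <= r + rho by lra.
    by have := bracket_primitive_lip (ltW (lt_trans ltr01 mu1)) HF rr; lra.
  have -> : jb (rho - r) * (2 * pi * A * m / r * (2 * r)) =
     4 * pi * (A * jb (rho - r) `^ (1 - kappa)).
    by rewrite -jb_pow_shift -/m; field; exact: lt0r_neq0.
  apply: ler_wpM2r; first by rewrite mulr_ge0 ?powR_ge0.
  by rewrite lerDr !mulr_ge0 ?pi_ge0 ?(ltW M0).
Qed.

Lemma grad_bound v w p b : enorm w <= 1 -> 0 <= b ->
  (forall j, `|extend (dx j v) p| <= b) -> `|grad v w p| <= 3 * b.
Proof.
move=> w1 b0 Hb.
have K j : `|w 0 j * extend (dx j v) p| <= b.
  rewrite normrM -[leRHS]mul1r; apply: ler_pM => //.
  exact: le_trans (coord_le_enorm _ _) w1.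
apply: (le_trans (ler_normD _ _)); have := ler_normD (w 0 0 * extend (dx 0 v) p) (w 0 1 * extend (dx 1 v) p).
by have := K 0; have := K 1; have := K 2; lra.
Qed.

(** This shows that a mean bounded by (1 + rho) / d^2 and by (1 + rho) / (r rho) is bounded
    by a multiple of 1 / (r + d). *)
Lemma sphere_weight (r rho d : R) : 0 < r -> 0 < rho -> 1 <= d -> `|rho - r| <= d ->
  (1 + rho) * (r + d) <= 6 * (d ^+ 2 + r * rho).
Proof.
move=> r0 rho0 d1; rewrite ler_norml => /andP[h1 h2].
have dd : d <= d ^+ 2 by rewrite expr2 ler_peMl //; lra.
have rd : r <= r * d by rewrite ler_peMr // ltW.
have rhod : rho * d <= r * d + d ^+ 2.
  by rewrite expr2 -mulrDl ler_wpM2r; lra.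
have rd2 : r * d <= 2 * d ^+ 2 + r * rho.
  have rr : 0 < r * rho by rewrite mulr_gt0.
  have d2 : 0 <= d ^+ 2 by exact: sqr_ge0.
  have [rd'|rd'] := leP r (2 * d).
    have : r * d <= 2 * d * d by rewrite ler_wpM2r //; lra.
    by rewrite -mulrA -expr2; lra.
  have : r * d <= r * rho by rewrite ler_pM2l //; lra.
  lra.
have -> : (1 + rho) * (r + d) = r + d + (r * rho + rho * d) by ring.
have := mulr_gt0 r0 rho0; lra.
Qed.

(** The mean over the bottom sphere of <lambda>^-(kappa+1+mu) is bounded in two ways: by
    its maximum, as lambda >= |ct - r|, and by integration in lambda, which gains
    1/(r rho); sphere_weight combines the two. *)
Lemma data_decay (c kappa mu : R) : 0 < c -> 0 < mu -> 1 <= kappa -> exists2 C, 0 < C &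
  forall t r B e1 e2 e3 v, 0 < r -> 0 < t -> 0 <= B -> frame e1 e2 e3 -> smooth v ->
  (forall y, enorm (y - r *: e1) <= c * t ->
     [/\ `|v (0, y)| <= B * jb (enorm y) `^ (- (kappa + (1 + mu))),
         forall j, `|dx j v (0, y)| <= B * jb (enorm y) `^ (- (kappa + (1 + mu))) &
         `|dt v (0, y)| <= B * jb (enorm y) `^ (- (kappa + (1 + mu)))]) ->
  jb (t + r) * `|mean_momentum c t (r *: e1) e1 e2 e3 v 0| <=
  C * (B * jb (c * t - r) `^ (1 - kappa)).
Proof.
move=> c0 mu0 k1.
have mu1 : 1 < 1 + mu by lra.
have [F HF] := bracket_primitive_exists (1 + mu).
have [M M0 HM] := bracket_primitive_bounded mu1 HF.
pose C5 := 1 + 4 * c; pose C6 := 4 * pi * C5 + 2 * pi * C5 * M.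
have C50 : 0 < C5 by rewrite /C5; lra.
have C60 : 0 < C6 by rewrite /C6 addr_gt0 // !mulr_gt0 // pi_gt0.
exists (2 * (1 + c^-1) * (12 * C6)) => [|t r B e1 e2 e3 v r0 t0 B0 fr sv Hv].
  have c1 : 0 < 1 + c^-1 by rewrite addr_gt0 // invr_gt0.
  by apply: mulr_gt0; apply: mulr_gt0.
set J := mean_momentum _ _ _ _ _ _ _ _; set rho := c * t.
have rho0 : 0 < rho by rewrite mulr_gt0.
pose p := kappa + (1 + mu).
pose D := jb (rho - r) `^ (1 - kappa).
have D0 : 0 <= D by exact: powR_ge0.
pose h th ph := ray_momentum c t (r *: e1) v (sphere e1 e2 e3 th ph) 0.
have jh : joint h by rewrite /joint /h /ray_momentum; cont.
have le_h th ph : `|h th ph| <= C5 * (1 + rho) * B * jb (chord r rho th) `^ (- p).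
  have [] := Hv _ (@bottom_sphere c t (r *: e1) e1 e2 e3 th ph c0 t0 fr).
  rewrite -/rho (chord_sphere th ph (ltW r0) (ltW rho0) fr) -/p.
  set b := B * _ => Hv0 Hvj Hv1.
  have b0 : 0 <= b by apply: le_trans Hv0.
  rewrite /h /ray_momentum subr0 -/rho.
  set q := (0, _).
  have Hq : H q by exact: H0.
  have Hg : `|grad v (sphere e1 e2 e3 th ph) q| <= 3 * b.
    by apply: grad_bound => // [|j]; rewrite ?(sphere_norm _ _ fr) // extendE //; exact: Hvj.
  rewrite !extendE //.
  have H1 : `|rho * (dt v q + c * grad v (sphere e1 e2 e3 th ph) q)| <= rho * (b + c * (3 * b)).
    rewrite normrM (ger0_norm (ltW rho0)) ler_pM2l //.
    apply: (le_trans (ler_normD _ _)); apply: lerD => //.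
    by rewrite normrM (ger0_norm (ltW c0)) ler_pM2l.
  have H2 : `|c * v q| <= c * b by rewrite normrM (ger0_norm (ltW c0)) ler_pM2l.
  apply: (le_trans (ler_normD _ _)); apply: (le_trans (lerD H1 H2)).
  rewrite -[leRHS]mulrA -/b /C5.
  have := mulr_ge0 (mulr_ge0 (ltW rho0) (ltW c0)) b0; have := mulr_ge0 (ltW c0) b0.
  by lra.
have JE : J = T (fun th ph => sin th * h th ph) by [].
pose dl := jb (rho - r).
have dl1 : 1 <= dl by exact: jb_ge1.
have ch_dl th : dl <= jb (chord r rho th).
  apply: jb_mono; rewrite distrC [leRHS]ger0_norm ?sqrtr_ge0 //.
  by apply: chord_ge; exact: ltW.
pose P := C6 * (B * D).
have P0 : 0 <= P by rewrite !mulr_ge0 // ltW.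
have Ha : `|J| * dl ^+ 2 <= P * (1 + rho).
  have Hsup : `|J| <= 4 * pi * (C5 * (1 + rho) * B * (D * dl `^ (- 2))).
    rewrite JE; apply: sphere_bound_sup => // th ph _; apply: (le_trans (le_h th ph)).
    apply: ler_wpM2l; first by rewrite !mulr_ge0 ?(ltW C50) // addr_ge0 ?(ltW rho0).
    apply: (@le_trans _ _ (dl `^ (- p))).
      by apply: powR_anti => //; [exact: jb_gt0|rewrite /p; lra].
    rewrite -powRD; last by apply/implyP => _; rewrite lt0r_neq0 ?jb_gt0.
    by apply: ler_powR => //; rewrite /p; lra.
  apply: (@le_trans _ _ (4 * pi * (C5 * (1 + rho) * B * (D * dl `^ (- 2))) * dl ^+ 2)).
    by apply: ler_wpM2r => //; exact: sqr_ge0.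
  have -> : dl `^ (-2) = (dl ^+ 2)^-1 by rewrite powRN -powR_mulrn // jb_ge0.
  have -> : 4 * pi * (C5 * (1 + rho) * B * (D / dl ^+ 2)) * dl ^+ 2 =
     4 * pi * C5 * (B * D * (1 + rho)) by field; rewrite lt0r_neq0 // jb_gt0.
  rewrite /P -[leRHS]mulrA; apply: ler_wpM2r; first by rewrite mulr_ge0 ?mulr_ge0 // addr_ge0 // ltW.
  by rewrite /C6 lerDl !mulr_ge0 ?pi_ge0 ?(ltW C50) ?(ltW M0).
have Hb : `|J| * (r * rho) <= P * (1 + rho).
  pose k0 := C5 * (1 + rho) * B * D.
  have k00 : 0 <= k0 by rewrite !mulr_ge0 ?(ltW C50) // addr_ge0 ?(ltW rho0).
  have HFs (q : R) : is_derive q 1 (fun q => k0 * F q) (k0 * jb q `^ (- (1 + mu))) by exact: isd_mull.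
  have le_k th ph : 0 < th < pi -> `|h th ph| <=
      k0 * jb (chord r rho th) `^ (- (1 + mu)) / chord r rho th.
    move=> thin; have [ch0 _] := chord_derive r0 rho0 thin.
    apply: (le_trans (le_h th ph)); rewrite ler_pdivlMr // /k0 -!mulrA.
    do 3 (apply: ler_wpM2l; first by rewrite ?(ltW C50) ?addr_ge0 ?(ltW rho0)).
    apply: (@le_trans _ _ (jb (chord r rho th) `^ (- p) * jb (chord r rho th))).
      apply: ler_wpM2l; first exact: powR_ge0.
      by apply: le_trans (jb_ge_abs _); exact: ler_norm.
    rewrite mulrC jb_pow_shift.
    have -> : 1 - p = (1 - kappa) + - (1 + mu) by rewrite /p; ring.
    rewrite powRD; last by apply/implyP => _; rewrite lt0r_neq0 ?jb_gt0.
    apply: ler_wpM2r; first exact: powR_ge0.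
    by rewrite /D -(opprB kappa 1); apply: powR_anti; [exact: jb_gt0|exact: ch_dl|lra].
  have := sphere_bound r0 rho0 jh HFs le_k; rewrite -JE -mulrBr => BB.
  rewrite -ler_pdivlMr ?mulr_gt0 //; apply: (le_trans BB).
  apply: ler_wpM2r; first by rewrite invr_ge0 mulr_ge0 // ltW.
  apply: (@le_trans _ _ (2 * pi * (k0 * M))).
    apply: ler_wpM2l; first by rewrite mulr_ge0 ?pi_ge0.
    by apply: ler_wpM2l => //; apply: le_trans (HM _ _); exact: ler_norm.
  have -> : 2 * pi * (k0 * M) = 2 * pi * C5 * M * (B * D * (1 + rho)) by rewrite /k0; ring.
  rewrite /P -[leRHS]mulrA; apply: ler_wpM2r; first by rewrite mulr_ge0 ?mulr_ge0 // addr_ge0 // ltW.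
  by rewrite /C6 lerDr !mulr_ge0 ?pi_ge0 ?(ltW C50).
have dist : `|rho - r| <= dl by exact: jb_ge_abs.
have sum : (r + dl) * `|J| <= 12 * P.
  have rho1 : 0 < 1 + rho by lra.
  rewrite -(ler_pM2l rho1).
  have sw := sphere_weight r0 rho0 dl1 dist.
  apply: (@le_trans _ _ (6 * (dl ^+ 2 + r * rho) * `|J|)).
    by rewrite mulrA; apply: ler_wpM2r.
  by lra.
have JJ := normr_ge0 J.
rewrite -[leRHS]mulrA -[12 * C6 * _]mulrA -/D -/P; apply: (combine_axis c0 t0 (ltW r0) (normr_ge0 _)).
- apply: le_trans sum; apply: ler_wpM2r => //; lra.
- rewrite -/rho -/dl; apply: le_trans sum; apply: ler_wpM2r => //; lra.
Qed.

End Estimates.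

(** * The outgoing derivative along a ray through the origin *)

Section Outgoing.
Context {R : realType}.
Local Notation PT := (R * 'rV[R]_3)%type.
Local Notation H := (@halfspace R).
Implicit Types (g v Phi Psi : PT -> R) (x y z w : 'rV[R]_3) (c t s r rho A m : R) (j k : 'I_3).

Lemma rot_rot v j k p : smooth v -> H p -> j != k ->
  rotf j k (rotf j k v) p = p.2 0 j ^+ 2 * dx k (dx k v) p + p.2 0 k ^+ 2 * dx j (dx j v) p
    - 2 * p.2 0 j * p.2 0 k * dx j (dx k v) p - p.2 0 j * dx j v p - p.2 0 k * dx k v p.
Proof.
move=> sv Hp jk; rewrite {1}/rotf !partial_rot //.
have C : dx k (dx j v) p = dx j (dx k v) p by exact: partial_commute.
have E1 : (Some k == Some j) = false by apply/negbTE; apply: contra jk => /eqP[->].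
have E2 : (Some j == Some k) = false by apply/negbTE; apply: contra jk => /eqP[->].
by rewrite E1 E2 !eqxx mulr1n mulr0n /rotf C; ring.
Qed.

(** The Laplacian without its radial part is, up to the factor rho^2, the sum of the
    squares of the rotation fields. *)
Lemma ray_momentum_origin c tau v g w s : smooth v -> 0 <= s -> enorm w = 1 ->
  (forall p, H p -> box c v p = g p) ->
  let rho := c * (tau - s) in let p := (s, rho *: w) in
  rho * ray_momentum' c tau 0 v w s = rho ^+ 2 * g p + c ^+ 2 *
    (rotf 0 1 (rotf 0 1 v) p + rotf 0 2 (rotf 0 2 v) p + rotf 1 2 (rotf 1 2 v) p).
Proof.
move=> sv s0 w1 eqv rho p.
have Hp : H p by [].
have ray0 : ray 0 w rho = rho *: w by rewrite /ray add0r.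
have ww : w 0 0 ^+ 2 = 1 - w 0 1 ^+ 2 - w 0 2 ^+ 2.
  have := enorm_sq w; rewrite w1 /dot -!expr2; lra.
have Eg : dt (dt v) p = g p + c ^+ 2 * (dx 0 (dx 0 v) p + dx 1 (dx 1 v) p + dx 2 (dx 2 v) p).
  by rewrite -(eqv p Hp) /box; ring.
have C01 : dx 1 (dx 0 v) p = dx 0 (dx 1 v) p by exact: partial_commute.
have C02 : dx 2 (dx 0 v) p = dx 0 (dx 2 v) p by exact: partial_commute.
have C12 : dx 2 (dx 1 v) p = dx 1 (dx 2 v) p by exact: partial_commute.
rewrite /ray_momentum' -/rho ray0 -/p !extendE // Eg /hess /grad !extendE // C01 C02 C12.
have pj j : p.2 0 j = rho * w 0 j by rewrite mxE.
by rewrite !rot_rot // !pj; ring: ww.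
Qed.

Definition outgoing c v x t : R :=
  dt v (t, x) + c * ((enorm x)^-1 * (x 0 0 * dx 0 v (t, x) + x 0 1 * dx 1 v (t, x)
    + x 0 2 * dx 2 v (t, x))).

Lemma DplusE c v x t : Dplus c v (t, x) = outgoing c v x t.
Proof.
rewrite /Dplus /pdr /outgoing sum3 !pdxE pdtE /=; ring.
Qed.

Lemma outgoing_bound c v x t b : 0 < c -> x != 0 -> `|dt v (t, x)| <= b ->
  (forall j, `|dx j v (t, x)| <= b) -> `|outgoing c v x t| <= (1 + 3 * c) * b.
Proof.
move=> c0 x0 Ht Hj; have r0 := enorm_gt0 x0.
have K j : `|x 0 j * dx j v (t, x)| <= enorm x * b.
  by rewrite normrM; apply: ler_pM => //; exact: coord_le_enorm.
have S : `|x 0 0 * dx 0 v (t, x) + x 0 1 * dx 1 v (t, x) + x 0 2 * dx 2 v (t, x)| <= 3 * (enorm x * b).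
  apply: (le_trans (ler_normD _ _)).
  have := ler_normD (x 0 0 * dx 0 v (t, x)) (x 0 1 * dx 1 v (t, x)).
  by have := K 0; have := K 1; have := K 2; lra.
apply: (le_trans (ler_normD _ _)); rewrite normrM (ger0_norm (ltW c0)) normrM ger0_norm; last first.
  by rewrite invr_ge0 ltW.
apply: (@le_trans _ _ (b + c * ((enorm x)^-1 * (3 * (enorm x * b))))).
  apply: lerD => //; apply: ler_wpM2l; first exact: ltW.
  by apply: ler_wpM2l => //; rewrite invr_ge0 ltW.
by rewrite le_eqVlt; apply/orP; left; apply/eqP; field; exact: lt0r_neq0.
Qed.

Definition rot_square_sum v p : R := `|rotf 0 1 (rotf 0 1 v) p| + `|rotf 0 2 (rotf 0 2 v) p|
  + `|rotf 1 2 (rotf 1 2 v) p|.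

Definition unit_of x : 'rV[R]_3 := (enorm x)^-1 *: x.

Lemma enorm_unit x : x != 0 -> enorm (unit_of x) = 1.
Proof.
move=> x0; have r0 := enorm_gt0 x0.
by rewrite enormZ ger0_norm ?invr_ge0 ?(ltW r0) // mulVf // lt0r_neq0.
Qed.

Lemma unit_frame x : x != 0 -> exists e2 e3, frame (unit_of x) e2 e3.
Proof. by move=> x0; apply: frame_exists; rewrite -enorm_sq enorm_unit // expr1n. Qed.

Lemma unitK x : x != 0 -> enorm x *: unit_of x = x.
Proof.
by move=> x0; rewrite scalerA divff ?scale1r // lt0r_neq0 // enorm_gt0.
Qed.

(** The incoming ray with tip at the origin and at time t + |x|/c passes through (t, x),
    where its momentum is |x| D_+ v + c v. *)
Lemma ray_estimate c t x v g (K dK : R -> R) : 0 < c -> 0 < t -> x != 0 -> smooth v ->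
  (forall p, H p -> box c v p = g p) ->
  (forall s, 0 <= s <= t -> is_derive s 1 K (dK s)) ->
  (forall s, 0 < s < t -> let rho := enorm x + c * (t - s) in
     let p := (s, rho *: unit_of x) in
     rho * `|g p| + c ^+ 2 / rho * rot_square_sum v p <= dK s) ->
  enorm x * `|outgoing c v x t| <= c * `|v (t, x)| +
    `|ray_momentum c (t + enorm x / c) 0 v (unit_of x) 0| + (K t - K 0).
Proof.
move=> c0 t0 x0 sv eqv HK le_K.
have cK : {within `[0, t], continuous K}.
  apply: derivable_within_continuous => s; rewrite in_itv /= => st.
  by have := HK s st => ?; exact: ex_derive.
have {}HK s : 0 < s < t -> is_derive s 1 K (dK s).
  by move=> /andP[s0 st]; apply: HK; rewrite !ltW.
set tau := t + enorm x / c; set w := unit_of x.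
have r0 := enorm_gt0 x0.
have w1 : enorm w = 1 by exact: enorm_unit.
have rhoE s : c * (tau - s) = enorm x + c * (t - s).
  by rewrite /tau; field; exact: lt0r_neq0.
pose J := ray_momentum c tau 0 v w.
have cJ : continuous J.
  by rewrite /J /ray_momentum; cont; exact: cont_vcst.
have HJ s : 0 < s < t -> is_derive s 1 J (ray_momentum' c tau 0 v w s).
  by move=> /andP[s0 _]; exact: ray_momentum_derive.
have le_J s : 0 < s < t -> `|ray_momentum' c tau 0 v w s| <= dK s.
  move=> /[dup] st /andP[s0 st']; apply: le_trans (le_K s st).
  have := ray_momentum_origin tau sv (ltW s0) w1 eqv; rewrite /= rhoE.
  set rho := enorm x + c * (t - s); set p := (s, _).
  have rho0 : 0 < rho by rewrite addr_gt0 // mulr_gt0 // subr_gt0.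
  move=> E.
  have -> : ray_momentum' c tau 0 v w s = rho * g p + c ^+ 2 / rho *
      (rotf 0 1 (rotf 0 1 v) p + rotf 0 2 (rotf 0 2 v) p + rotf 1 2 (rotf 1 2 v) p).
    by apply: (mulfI (lt0r_neq0 rho0)); rewrite E; field; exact: lt0r_neq0.
  apply: (le_trans (ler_normD _ _)); apply: lerD.
    by rewrite normrM (ger0_norm (ltW rho0)).
  have cr : 0 <= c ^+ 2 / rho by rewrite divr_ge0 ?sqr_ge0 // ltW.
  rewrite normrM (ger0_norm cr); apply: ler_wpM2l => //.
  apply: (le_trans (ler_normD _ _)); rewrite lerD2r; exact: ler_normD.
have B := mean_value_bound (ltW t0) (continuous_subspaceT cJ) cK HJ HK le_J.
have Jt : J t = enorm x * outgoing c v x t + c * v (t, x).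
  rewrite /J /ray_momentum rhoE subrr mulr0 addr0 /ray add0r /w unitK // /grad.
  rewrite !extendE; try exact: ltW.
  by rewrite /outgoing !mxE; field; exact: lt0r_neq0.
rewrite -[X in X * _ <= _](ger0_norm (ltW r0)) -normrM.
have -> : enorm x * outgoing c v x t = (J t - J 0) + J 0 - c * v (t, x) by rewrite Jt; ring.
apply: (le_trans (ler_normB _ _)); have := ler_normD (J t - J 0) (J 0).
by rewrite [`|c * _|]normrM (ger0_norm (ltW c0)) -/(J 0); lra.
Qed.

(** * Comparison of the brackets along an incoming ray *)

Section Comparison.
Variables c t s r rho q : R.
Hypotheses (c0 : 0 < c) (r0 : 0 < r) (s0 : 0 <= s) (st : s <= t).
Hypotheses (rhoE : rho = r + c * (t - s)) (qE : q = c * s - rho).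

Lemma rho_gt0 : 0 < rho.
Proof. by rewrite rhoE ltr_pwDl // mulr_ge0 ?subr_ge0 // ltW. Qed.

Lemma rho_ge_r : r <= rho.
Proof. by rewrite rhoE lerDl mulr_ge0 ?subr_ge0 // ltW. Qed.

Let t0 : 0 <= t. Proof. exact: le_trans st. Qed.
Let ci : 0 < c^-1. Proof. by rewrite invr_gt0. Qed.

Lemma time_split : t = s + c^-1 * (rho - r).
Proof. by rewrite rhoE; field; exact: lt0r_neq0. Qed.

Lemma bracket_future_le : jb (t + r) <= (1 + c^-1) * jb (s + rho).
Proof.
have rr := rho_ge_r; have r00 := rho_gt0.
apply: jb_scale; first by rewrite lerDl ltW.
rewrite !ger0_norm ?addr_ge0 ?(ltW r0) ?(ltW r00) //.
have h1 : c^-1 * (rho - r) <= c^-1 * rho by rewrite mulrBr gerBl mulr_ge0 // ltW.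
have h2 : 0 <= c^-1 * s by rewrite mulr_ge0 // ltW.
have h3 : c^-1 * (rho - r) + r <= (1 + c^-1) * rho.
  have := mulr_gt0 ci r0 => h4; rewrite mulrDl mul1r mulrBr; lra.
rewrite time_split; lra.
Qed.

Lemma bracket_past_le : jb (s + rho) <= (1 + c) * jb (t + r).
Proof.
have r00 := rho_gt0.
apply: jb_scale; first by rewrite lerDl ltW.
rewrite !ger0_norm ?addr_ge0 ?(ltW r0) ?(ltW r00) //.
have h1 := mulr_ge0 (ltW c0) s0; have h2 := mulr_gt0 c0 r0; have h3 := st; rewrite rhoE; lra.
Qed.

Lemma bracket_total_le : jb (t + r) <= (1 + c^-1) * (jb q + 2 * rho).
Proof.
have rr := rho_ge_r; have r00 := rho_gt0; have r1 := r0.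
apply: (le_trans (jb_le_add _)); rewrite ger0_norm ?addr_ge0 ?(ltW r0) //.
have h0 := jb_ge1 q; have h1 : q <= jb q by apply: le_trans (jb_ge_abs q); exact: ler_norm.
have h2 : s = c^-1 * (q + rho) by rewrite qE; field; exact: lt0r_neq0.
have h3 : t <= c^-1 * (jb q + 2 * rho).
  have h4 : q + rho + (rho - r) <= jb q + 2 * rho by lra.
  rewrite time_split {1}h2 -mulrDr; apply: ler_wpM2l h4; exact: ltW.
rewrite mulrDl mul1r; lra.
Qed.

Lemma bracket_cone_le : jb (c * t - r) <= jb q + 2 * rho.
Proof.
have rr := rho_ge_r; have r00 := rho_gt0; have r1 := r0.
have -> : c * t - r = q + 2 * (rho - r) by rewrite qE rhoE; ring.
apply: (le_trans (jb_lip _ q)); rewrite addrAC subrr add0r ger0_norm ?mulr_ge0 ?subr_ge0 //.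
lra.
Qed.

Lemma bracket_cone_total : jb (c * t - r) <= (1 + c) * jb (t + r).
Proof.
apply: jb_scale; first by rewrite lerDl ltW.
apply: (le_trans (ler_normB _ _)); rewrite !ger0_norm ?addr_ge0 ?mulr_ge0 ?(ltW c0) ?(ltW r0) //.
have h := mulr_gt0 c0 r0; have h3 := r0; have h4 := t0; lra.
Qed.

(** Up to a constant, both <t+r> and <ct-r> exceed <q> by at most the factor
    1 + 2 rho / <q>; the exponents sum to at most 1, so that only one such factor is lost. *)
Lemma interpolation (kappa theta : R) : 1 <= kappa -> 0 <= theta -> kappa - 1 + theta <= 1 ->
  jb (t + r) `^ theta * jb q `^ (- (kappa - 1 + theta)) <=
  (1 + c^-1) * ((1 + 2 * rho / jb q) * jb (c * t - r) `^ (1 - kappa)).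
Proof.
move=> k1 th0 kth.
set X := 1 + 2 * rho / jb q; set Q := jb q; set N := jb (t + r); set d := jb (c * t - r).
have Q0 : 0 < Q by exact: jb_gt0.
have d0 : 0 < d by exact: jb_gt0.
have X1 : 1 <= X by rewrite lerDl divr_ge0 ?mulr_ge0 ?(ltW rho_gt0) // ltW.
have X0 : 0 < X by exact: lt_le_trans X1.
have m1 : 1 <= 1 + c^-1 by rewrite lerDl ltW.
have m0 : 0 < 1 + c^-1 by exact: lt_le_trans m1.
have QX : Q * X = jb q + 2 * rho by rewrite /X /Q; field; rewrite lt0r_neq0 ?jb_gt0.
have NQ : N <= (1 + c^-1) * (Q * X) by rewrite QX; exact: bracket_total_le.
have dQ : d <= Q * X by rewrite QX; exact: bracket_cone_le.
have QX0 : 0 < Q * X by rewrite mulr_gt0.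
have HN : N `^ theta <= (1 + c^-1) * (Q * X) `^ theta.
  apply: (@le_trans _ _ (((1 + c^-1) * (Q * X)) `^ theta)).
    by apply: (ge0_ler_powR th0) => //; rewrite nnegrE ?jb_ge0 // mulr_ge0 // ltW.
  rewrite (powRM _ (ltW m0) (ltW QX0)); apply: ler_wpM2r; first exact: powR_ge0.
  by apply: ler1_powR => //; lra.
have Hd : d `^ (kappa - 1) <= (Q * X) `^ (kappa - 1).
  by apply: ge0_ler_powR; rewrite ?nnegrE ?subr_ge0 // ltW.
have P : N `^ theta * d `^ (kappa - 1) <= (1 + c^-1) * (Q `^ (kappa - 1 + theta) * X).
  apply: (@le_trans _ _ ((1 + c^-1) * (Q * X) `^ theta * (Q * X) `^ (kappa - 1))).
    by apply: ler_pM => //; exact: powR_ge0.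
  rewrite -mulrA -powRD; last by apply/implyP => _; rewrite lt0r_neq0.
  rewrite [theta + _]addrC ler_pM2l // powRM ?(ltW Q0) ?(ltW X0) //.
  apply: ler_wpM2l; first exact: powR_ge0.
  exact: ler1_powR.
have dk : 0 < d `^ (kappa - 1) by rewrite powR_gt0.
have -> : (1 - kappa) = - (kappa - 1) by ring.
rewrite !powRN mulrA ler_pdivrMr ?powR_gt0 //.
rewrite [X in _ <= X]mulrAC ler_pdivlMr //.
apply: (le_trans P); rewrite le_eqVlt; apply/orP; left; apply/eqP; ring.
Qed.

End Comparison.

Lemma cone_sub c t x s y : 0 < c -> cone c t x (s, y) -> cone c s y `<=` cone c t x.
Proof.
move=> c0 [/= /andP[s0 st] ys] [s' y'] [/= /andP[s'0 s's] y's]; split => /=.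
  by rewrite s'0 (le_trans s's).
apply: (le_trans (enorm_triangle y' y x)); lra.
Qed.

Lemma source_bound_sub (I : finType) (sp : I -> R) c kappa mu t x A g s y : 0 < c ->
  cone c t x (s, y) -> source_bound sp c kappa mu t x A g -> source_bound sp c kappa mu s y A g.
Proof. by move=> c0 Hc Hg s' y' H'; apply: Hg; exact: (cone_sub c0 Hc H'). Qed.

Lemma ray_cone c t x s : 0 < c -> x != 0 -> 0 <= s <= t ->
  cone c t x (s, (enorm x + c * (t - s)) *: unit_of x).
Proof.
move=> c0 x0 st; split => //=.
have -> : (enorm x + c * (t - s)) *: unit_of x - x = (c * (t - s)) *: unit_of x.
  by rewrite scalerDl unitK // addrAC subrr add0r.
rewrite enormZ enorm_unit // mulr1 ger0_norm // mulr_ge0 ?(ltW c0) //.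
by case/andP: st => _; rewrite subr_ge0.
Qed.

Lemma zero_cauchy_decay (I : finType) (sp : I -> R) c kappa mu :
  (forall i, 0 <= sp i) -> 0 < c -> 0 < mu -> 1 <= kappa -> exists2 C, 0 < C &
  forall t x A g v, x != 0 -> 0 < t -> 0 <= A -> smooth g ->
  cauchy_problem c g (fun=> 0) (fun=> 0) v -> source_bound sp c kappa mu t x A g ->
  jb (t + enorm x) * `|v (t, x)| <=
  C * (A * (jb (c * t - enorm x) `^ (1 - kappa) * log_loss kappa t (enorm x))).
Proof.
move=> sp0 c0 mu0 k1; have [C C0 HC] := source_decay sp0 c0 mu0 k1.
have pc : 0 < 4 * pi * c :> R by rewrite !mulr_gt0 ?pi_gt0.
exists (C / (4 * pi * c)) => [|t x A g v x0 t0 A0 sg [sv eqv v0 v1] Hg].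
  by rewrite divr_gt0.
have r0 := enorm_gt0 x0.
have [e2 [e3 fr]] := unit_frame x0.
rewrite -[in source_bound _ _ _ _ _ _ _ _](unitK x0) in Hg.
have := HC t _ A _ e2 e3 g v r0 t0 A0 fr sg sv eqv Hg.
rewrite unitK // mean_momentum_zero // subr0 mulrA normrM (ger0_norm (ltW pc)) => X.
rewrite -(ler_pM2l pc) [leRHS]mulrA [_ * (C / _)]mulrC divfK ?lt0r_neq0 //.
by apply: le_trans X; rewrite mulrCA.
Qed.

End Outgoing.

(** * Estimates for the source problem *)

Section Source.
Context {R : realType}.
Local Notation PT := (R * 'rV[R]_3)%type.
Local Notation H := (@halfspace R).
Implicit Types (g v Phi Psi : PT -> R) (x y z w : 'rV[R]_3) (c t s r rho A m : R) (j k : 'I_3).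

Lemma zero_cauchy_dx c g v j : smooth g -> cauchy_problem c g (fun=> 0) (fun=> 0) v ->
  cauchy_problem c (dx j g) (fun=> 0) (fun=> 0) (dx j v).
Proof.
move=> sg /(cauchy_dx j sg) [s e a b]; split => // x; rewrite ?a ?b dx_zero_trace //.
Qed.

Lemma zero_cauchy_rot c g v j k : smooth g -> j != k -> cauchy_problem c g (fun=> 0) (fun=> 0) v ->
  cauchy_problem c (rotf j k g) (fun=> 0) (fun=> 0) (rotf j k v).
Proof.
move=> sg jk /(cauchy_rot sg jk) [s e a b].
have z x : rotf j k (fun=> 0 : R) (0, x) = 0 by rewrite /rotf !dx_zero_trace // !mulr0 subrr.
by split => // x; rewrite ?a ?b z.
Qed.

Lemma cone_total c t x s y : 0 < c -> cone c t x (s, y) ->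
  jb (s + enorm y) <= (1 + c) * jb (t + enorm x).
Proof.
move=> c0 [/= /andP[s0 st] yx].
have h := enorm_le_dist y x; have x0 := enorm_ge0 x; have y0 := enorm_ge0 y.
apply: jb_scale; first by rewrite lerDl ltW.
rewrite !ger0_norm ?addr_ge0 //; last exact: le_trans st.
have h1 := mulr_ge0 (ltW c0) s0; have h2 := mulr_ge0 (ltW c0) x0; lra.
Qed.

(** At the endpoint kappa = 1 half a power of <t + r>, which dominates <s + |y|> in the
    cone up to a constant, is spent to pass to kappa = 3/2; this avoids a logarithm
    in the bound of v, which would be squared by the integration along the ray. *)
Lemma zero_cauchy_power (I : finType) (sp : I -> R) c kappa mu :
  (forall i, 0 <= sp i) -> 0 < c -> 0 < mu -> 1 <= kappa <= 2 -> exists theta C,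
  [/\ 0 < C, 0 <= theta, kappa - 1 + theta <= 1, 1 < kappa -> theta = 0 &
  forall t x A g v, x != 0 -> 0 < t -> 0 <= A -> smooth g ->
  cauchy_problem c g (fun=> 0) (fun=> 0) v -> source_bound sp c kappa mu t x A g ->
  jb (t + enorm x) * `|v (t, x)| <=
  C * (A * (jb (t + enorm x) `^ theta * jb (c * t - enorm x) `^ (- (kappa - 1 + theta))))].
Proof.
move=> sp0 c0 mu0 /andP[k1 k2]; have [kE|kN] := eqVneq kappa 1; last first.
  have [C C0 HC] := zero_cauchy_decay sp0 c0 mu0 k1.
  exists 0, C; split => //; first lra.
  move=> t x A g v x0 t0 A0 sg sv Hg; have := HC _ _ _ _ _ x0 t0 A0 sg sv Hg.
  rewrite /log_loss (negbTE kN) powRr0 mul1r mulr1.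
  by rewrite (_ : 1 - kappa = - (kappa - 1 + 0)) //; ring.
have h1 : 1 <= 3 / 2 :> R by lra.
have [C C0 HC] := zero_cauchy_decay sp0 c0 mu0 h1.
have m0 : 0 < 1 + c by rewrite addr_gt0.
exists (1 / 2), (C * (1 + c) `^ (1 / 2)).
split; rewrite ?kE; [by rewrite mulr_gt0 // powR_gt0|lra|lra|lra|].
move=> t x A g v x0 t0 A0 sg sv Hg; set N := jb (t + enorm x).
have Hg' : source_bound sp c (3 / 2) mu t x (A * ((1 + c) `^ (1 / 2) * N `^ (1 / 2))) g.
  move=> s y Hc; have := Hg _ _ Hc => /le_trans; apply.
  rewrite -mulrA; apply: ler_wpM2l => //; rewrite mulrA; apply: ler_wpM2r.
    by apply: sumr_ge0 => i _; exact: powR_ge0.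
  rewrite -powRM ?(ltW m0) ?jb_ge0 //.
  have -> : - 1 = 1 / 2 + - (3 / 2) :> R by field.
  rewrite powRD; last by apply/implyP => _; rewrite lt0r_neq0 ?jb_gt0.
  apply: ler_wpM2r; first exact: powR_ge0.
  apply: ge0_ler_powR; rewrite ?nnegrE ?jb_ge0 ?mulr_ge0 ?jb_ge0 ?(ltW m0) //.
  exact: cone_total Hc.
have A'0 : 0 <= A * ((1 + c) `^ (1 / 2) * N `^ (1 / 2)) by rewrite !mulr_ge0 ?powR_ge0.
have := HC _ _ _ _ _ x0 t0 A'0 sg sv Hg' => /le_trans; apply.
rewrite /log_loss (_ : (3 / 2 == 1 :> R) = false); last by apply/eqP; lra.
rewrite mulr1 (_ : 1 - 3 / 2 = - (1 - 1 + 1 / 2)); last by field.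
by rewrite le_eqVlt; apply/orP; left; apply/eqP; ring.
Qed.

Definition source_family (I : finType) (sp : I -> R) c kappa mu t x A g : Prop :=
  [/\ source_bound sp c kappa mu t x A g,
      source_bound sp c kappa mu t x A (dt g),
      forall j, source_bound sp c kappa mu t x A (dx j g) &
      forall j k, (j < k)%N -> source_bound sp c kappa mu t x A (rotf j k (rotf j k g))].

(** The brackets <s+rho> and <t+r> are comparable along the ray, and the squares of the
    rotations of v solve the equation with the rotated source, so that
    zero_cauchy_power applies to them at each point of the ray. *)
Lemma ray_rate (I : finType) (sp : I -> R) c kappa mu :
  (forall i, 0 <= sp i) -> 0 < c -> 0 < mu -> 1 <= kappa <= 2 -> exists theta C,
  [/\ 0 < C, 0 <= theta, kappa - 1 + theta <= 1, 1 < kappa -> theta = 0 &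
  forall t x A g v s, x != 0 -> 0 < s < t -> 0 <= A -> smooth g ->
  cauchy_problem c g (fun=> 0) (fun=> 0) v -> source_family sp c kappa mu t x A g ->
  let rho := enorm x + c * (t - s) in let q := c * s - rho in
  let p := (s, rho *: unit_of x) in let N := jb (t + enorm x) in
  rho * `|g p| + c ^+ 2 / rho * rot_square_sum v p <= C * (A * (N^-1 *
    (jb (c * t - enorm x) `^ (1 - kappa) * \sum_i jb (sp i * s - rho) `^ (- (1 + mu))
     + rho^-1 * (N `^ theta * jb q `^ (- (kappa - 1 + theta))))))].
Proof.
move=> sp0 c0 mu0 k12; have /andP[k1 k2] := k12.
have [theta [C [C0 th0 kth kth0 HC]]] := zero_cauchy_power sp0 c0 mu0 k12.
have ci : 0 < c^-1 by rewrite invr_gt0.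
have m0 : 0 < 1 + c by rewrite addr_gt0.
have n0 : 0 < 1 + c^-1 by rewrite addr_gt0.
pose C1 := (1 + c^-1) `^ kappa * (1 + c) `^ (kappa - 1).
pose C2 := 3 * c ^+ 2 * (C * ((1 + c^-1) * (1 + c))).
have C10 : 0 < C1 by rewrite mulr_gt0 // powR_gt0.
have C20 : 0 < C2 by rewrite !mulr_gt0 ?exprn_gt0.
exists theta, (C1 + C2); split => //; first exact: addr_gt0.
cbv zeta; move=> t x A g v s x0 st A0 sg Cv [Hg _ _ Hr].
set rho := _ + c * (t - s); set q := c * s - rho; set p := (s, rho *: _); set N := jb (t + _).
have r0 := enorm_gt0 x0; have /andP[s0 st'] := st.
have Hc : cone c t x p by apply: ray_cone => //; rewrite !ltW.
have rho0 : 0 < rho by rewrite addr_gt0 // mulr_gt0 // subr_gt0.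
have pE : enorm p.2 = rho by rewrite enormZ enorm_unit // mulr1 gtr0_norm.
set S := \sum_i _; have S0 : 0 <= S by apply: sumr_ge0 => i _; exact: powR_ge0.
have N0 : 0 < N by exact: jb_gt0.
set d := jb (c * t - enorm x); have d0 : 0 < d by exact: jb_gt0.
set M := jb (s + rho); have M0 : 0 < M by exact: jb_gt0.
have NM : N <= (1 + c^-1) * M by exact: (bracket_future_le c0 r0 (ltW s0) (ltW st') (erefl rho)).
have MN : M <= (1 + c) * N by exact: (bracket_past_le c0 r0 (ltW s0) (ltW st') (erefl rho)).
have dN : d <= (1 + c) * N by exact: (bracket_cone_total c0 r0 (ltW s0) (ltW st')).
set Q := jb q `^ _; have Q0 : 0 <= Q by exact: powR_ge0.
have T1 : rho * `|g p| <= C1 * (A * (N^-1 * (d `^ (1 - kappa) * S))).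
  have := Hg _ _ Hc; rewrite pE -/M -/S => /le_trans; apply.
  rewrite [leRHS]mulrCA; apply: ler_wpM2l => //; rewrite !mulrA; apply: ler_wpM2r => //.
  have k0 : 0 <= kappa by lra.
  have H1 := powR_anti_scale n0 N0 NM k0.
  apply: (le_trans H1); rewrite /C1 -!mulrA; apply: ler_wpM2l; first exact: powR_ge0.
  have km : 0 <= kappa - 1 by lra.
  have H2 := powR_anti_scale m0 d0 dN km.
  rewrite mulrCA.
  have -> : N `^ (- kappa) = N `^ (- 1) * N `^ (- (kappa - 1)).
    rewrite -powRD; last by apply/implyP => _; rewrite lt0r_neq0.
    by congr (_ `^ _); ring.
  rewrite powRN powRr1 ?(ltW N0) //; apply: ler_wpM2l; first by rewrite invr_ge0 ltW.
  by rewrite (_ : 1 - kappa = - (kappa - 1)) //; ring.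
have T2 j k : (j < k)%N -> `|rotf j k (rotf j k v) p| <=
    C * ((1 + c^-1) * (1 + c)) * (A * (N^-1 * (N `^ theta * Q))).
  move=> jk; have jk' : j != k by rewrite neq_ltn jk.
  have Cr := zero_cauchy_rot (smooth_rot j k sg) jk' (zero_cauchy_rot sg jk' Cv).
  have p0 : rho *: unit_of x != 0 by rewrite !scaler_eq0 invr_eq0 !negb_or x0 !lt0r_neq0.
  have := HC s _ A _ _ p0 s0 A0 (smooth_rot j k (smooth_rot j k sg)) Cr
    (source_bound_sub c0 Hc (Hr _ _ jk)).
  rewrite -[enorm (rho *: _)]/(enorm p.2) pE -/M -/q -/Q => HM.
  have Mth : M `^ theta <= (1 + c) * N `^ theta.
    apply: (@le_trans _ _ (((1 + c) * N) `^ theta)).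
      by apply: (ge0_ler_powR th0) => //; rewrite nnegrE ?jb_ge0 // mulr_ge0 // ltW.
    rewrite (powRM _ (ltW m0) (ltW N0)); apply: ler_wpM2r; first exact: powR_ge0.
    by apply: ler1_powR => //; [rewrite lerDl ltW|lra].
  set X := `|_| in HM *.
  have Mi : M^-1 <= (1 + c^-1) * N^-1.
    by rewrite -[leLHS]mul1r ler_pdivrMr // mulrAC ler_pdivlMr // mul1r.
  rewrite -ler_pdivlMl // in HM; apply: (le_trans HM).
  apply: (@le_trans _ _ ((1 + c^-1) * N^-1 * (C * (A * ((1 + c) * N `^ theta * Q))))).
    apply: ler_pM => //; rewrite ?invr_ge0 ?mulr_ge0 ?powR_ge0 ?(ltW C0) ?(ltW M0) //.
    apply: ler_wpM2l; first exact: ltW.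
    by apply: ler_wpM2l => //; apply: ler_wpM2r.
  by rewrite le_eqVlt; apply/orP; left; apply/eqP; ring.
have P0 : 0 <= A * (N^-1 * (d `^ (1 - kappa) * S)).
  by rewrite !mulr_ge0 ?invr_ge0 ?powR_ge0 // ltW.
have R0 : 0 <= A * (N^-1 * (rho^-1 * (N `^ theta * Q))).
  by rewrite !mulr_ge0 ?invr_ge0 ?powR_ge0 // ltW.
have T3 : c ^+ 2 / rho * rot_square_sum v p <= C2 * (A * (N^-1 * (rho^-1 * (N `^ theta * Q)))).
  have h : rot_square_sum v p <= 3 * (C * ((1 + c^-1) * (1 + c)) * (A * (N^-1 * (N `^ theta * Q)))).
    have h1 := T2 0 1 isT; have h2 := T2 0 2 isT; have h3 := T2 1 2 isT.
    rewrite /rot_square_sum; lra.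
  apply: (@le_trans _ _ (c ^+ 2 / rho * (3 * (C * ((1 + c^-1) * (1 + c)) *
      (A * (N^-1 * (N `^ theta * Q))))))).
    by apply: ler_wpM2l => //; rewrite divr_ge0 ?sqr_ge0 // ltW.
  by rewrite le_eqVlt; apply/orP; left; apply/eqP; rewrite /C2; ring.
apply: (le_trans (lerD T1 T3)).
rewrite !mulrDr !mulrDl.
have E1 := mulr_ge0 (ltW C20) P0; have E2 := mulr_ge0 (ltW C10) R0.
lra.
Qed.

Lemma log_loss_le (kappa t r : R) : 0 <= t -> 0 <= r ->
  log_loss kappa t r <= (1 + (ln 2)^-1) * ln (2 + t + r).
Proof.
move=> t0 r0; have h := ln_ge_ln2 t0 r0; have l0 : 0 < ln 2 :> R := ln2_gt0.
have L0 : 0 <= ln (2 + t + r) by apply: le_trans h; exact: ltW.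
have h1 : 1 <= (ln 2)^-1 * ln (2 + t + r) by rewrite mulrC ler_pdivlMr // mul1r.
rewrite /log_loss mulrDl mul1r; case: ifP => _; lra.
Qed.

Lemma ray_momentum_zero c T z v w : (forall y, v (0, y) = 0) -> (forall y, dt v (0, y) = 0) ->
  ray_momentum c T z v w 0 = 0.
Proof.
move=> v0 v1; rewrite /ray_momentum /grad !extendE ?v0 ?v1 ?(dx_zero_trace _ _ v0); try exact: H0.
by ring.
Qed.

Lemma bracket_path (e a b s : R) F : a != 0 -> bracket_primitive e F ->
  is_derive s 1 (fun s => a^-1 * F (a * s - b)) (jb (a * s - b) `^ (- e)).
Proof.
move=> a0 HF; have D := isd_comp (HF _) (isd_sub (isd_mull a (isd_id s)) (isd_cst b s)).
by apply: (isd_eq (isd_mull a^-1 D)); rewrite subr0 mulr1 mulrC mulfK.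
Qed.

(** Along an incoming ray every c_i s - rho moves with positive speed c_i + c, so the
    integral of its bracket to an integrable power is bounded uniformly in the ray. *)
Lemma source_path (I : finType) (sp : I -> R) c mu :
  (forall i, 0 <= sp i) -> 0 < c -> 0 < mu -> exists2 C, 0 <= C & forall r t, 0 <= t ->
  exists2 K : R -> R,
    forall s : R, is_derive s 1 K (\sum_i jb (sp i * s - (r + c * (t - s))) `^ (- (1 + mu))) &
    K t - K 0 <= C.
Proof.
move=> sp0 c0 mu0; have [F HF] := @bracket_primitive_exists R (1 + mu).
have mu1 : 1 < 1 + mu by rewrite ltrDl.
have [M M0 HM] := bracket_primitive_bounded mu1 HF.
have ci : 0 < c^-1 by rewrite invr_gt0.
exists (c^-1 * (#|I|%:R * M)) => [|r t t0]; first by rewrite !mulr_ge0 // ltW.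
have spc i : 0 < sp i + c by rewrite ltr_wpDl.
exists (fun s => \sum_i (sp i + c)^-1 * F ((sp i + c) * s - (r + c * t))) => [s|].
  apply: isd_sum => i; have -> : sp i * s - (r + c * (t - s)) = (sp i + c) * s - (r + c * t) by ring.
  by apply: bracket_path => //; exact: lt0r_neq0.
rewrite -sumrB; apply: (@le_trans _ _ (\sum_(i : I) c^-1 * M)); last first.
  by rewrite sumr_const -mulrnAr mulr_natl.
apply: ler_sum => i _; rewrite -mulrBr; apply: ler_pM => //.
- by rewrite invr_ge0 ltW.
- rewrite subr_ge0; apply: (bracket_primitive_mono HF); rewrite mulr0 lerD2r.
  by rewrite mulr_ge0 // ltW.
- by rewrite lef_pV2 ?posrE // lerDr.
- exact: le_trans (ler_norm _) (HM _ _).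
Qed.

(** The critical power of rho; r >= 1 makes the logarithm at the near end nonnegative. *)
Lemma reciprocal_path c : 0 < c -> exists2 C, 0 < C & forall r t, 1 <= r -> 0 <= t ->
  exists2 K : R -> R,
    forall s : R, s <= t -> is_derive s 1 K (r + c * (t - s))^-1 &
    K t - K 0 <= C * ln (2 + t + r).
Proof.
move=> c0; have [C C0 HC] := ln_path c0; have ci : 0 < c^-1 by rewrite invr_gt0.
exists (c^-1 * C) => [|r t r1 t0]; first by rewrite mulr_gt0.
have r0 : 0 < r by exact: lt_le_trans r1.
exists (fun s => - (c^-1 * ln (r + c * (t - s)))) => [s st|].
  have rho0 : 0 < r + c * (t - s) by rewrite ltr_pwDl // mulr_ge0 ?subr_ge0 // ltW.
  have D := @isd_comp _ (@ln R) (fun q => r + c * (t - q)) s _ _ (is_derive1_ln rho0)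
    (isd_add (isd_cst r s) (isd_mull c (isd_sub (isd_cst t s) (isd_id s)))).
  by apply: (isd_eq (isd_opp (isd_mull c^-1 D))); field; rewrite !lt0r_neq0.
rewrite subrr mulr0 addr0 subr0 opprK addrC -mulrBr -mulrA; apply: ler_wpM2l; first exact: ltW.
have l0 := ln_ge0 r1; have b0 : 0 < r + c * t by rewrite ltr_pwDl // mulr_ge0 // ltW.
have b1 : 0 < 1 + (r + c * t) by rewrite addr_gt0.
have h : ln (r + c * t) <= ln (1 + (r + c * t)) by rewrite ler_ln // lerDr.
by have := HC r t (ltW r0) t0; lra.
Qed.

(** The bracket of c s - rho covers the interval between - (r + c t) and c t - r. *)
Lemma incoming_path (c e r t G : R) F : 0 < c -> 0 <= r -> 0 <= t -> bracket_primitive e F ->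
  F (r + c * t) - F (- (r + c * t)) <= G ->
  exists2 K : R -> R,
    forall s : R, is_derive s 1 K (jb (c * s - (r + c * (t - s))) `^ (- e)) &
    K t - K 0 <= (2 * c)^-1 * G.
Proof.
move=> c0 r0 t0 HF HG; have c2 : 0 < 2 * c by rewrite mulr_gt0.
exists (fun s => (2 * c)^-1 * F (2 * c * s - (r + c * t))) => [s|].
  have -> : c * s - (r + c * (t - s)) = 2 * c * s - (r + c * t) by ring.
  by apply: bracket_path => //; exact: lt0r_neq0.
rewrite -mulrBr; apply: ler_wpM2l; first by rewrite invr_ge0 ltW.
apply: le_trans HG; rewrite mulr0 sub0r lerD2r; apply: (bracket_primitive_mono HF).
lra.
Qed.

Lemma log_path c : 0 < c -> exists2 C, 0 < C & forall r t, 0 <= r -> 0 <= t ->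
  exists2 K : R -> R,
    forall s : R, is_derive s 1 K (jb (c * s - (r + c * (t - s))) `^ (-1)) &
    K t - K 0 <= C * ln (2 + t + r).
Proof.
move=> c0; have [C C0 HC] := ln_path c0; have c2 : 0 < 2 * c by rewrite mulr_gt0.
have [F HF] := @bracket_primitive_exists R 1.
exists ((2 * c)^-1 * (4 * C)) => [|r t r0 t0]; first by rewrite !mulr_gt0 // invr_gt0.
rewrite -mulrA; apply: (incoming_path c0 r0 t0 HF); rewrite -mulrA.
have b0 : 0 <= r + c * t by rewrite addr_ge0 // mulr_ge0 // ltW.
have h2 := bracket_primitive_log HF (lexx 0) b0.
have h3 := bracket_primitive_log (bracket_primitive_reflect HF) (lexx 0) b0.
have h4 := HC r t r0 t0; rewrite oppr0 in h3; lra.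
Qed.

Lemma power_path c e : 0 < c -> 0 <= e < 1 -> exists2 C, 0 < C & forall r t, 0 <= r -> 0 <= t ->
  exists2 K : R -> R,
    forall s : R, is_derive s 1 K (jb (c * s - (r + c * (t - s))) `^ (- e)) &
    K t - K 0 <= C * jb (t + r) `^ (1 - e).
Proof.
move=> c0 e01; have /andP[e0 e1] := e01; have c2 : 0 < 2 * c by rewrite mulr_gt0.
have [F HF] := @bracket_primitive_exists R e.
pose E := 2 `^ e / (1 - e).
have E0 : 0 < E by rewrite divr_gt0 ?powR_gt0 ?subr_gt0.
have c3 : 0 < 2 + c by rewrite addr_gt0.
have P0 : 0 < (2 + c) `^ (1 - e) by rewrite powR_gt0.
have D0 : 0 < E * (2 * (2 + c) `^ (1 - e)) by rewrite (mulr_gt0 E0) // mulr_gt0.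
exists ((2 * c)^-1 * (E * (2 * (2 + c) `^ (1 - e)))) => [|r t r0 t0].
  by rewrite mulr_gt0 // invr_gt0.
rewrite -[_^-1 * _ * _]mulrA; apply: (incoming_path c0 r0 t0 HF).
have b0 : 0 <= r + c * t by rewrite addr_ge0 // mulr_ge0 // ltW.
have nb0 : - (r + c * t) <= 0 by rewrite oppr_le0.
have := bracket_primitive_growth e01 HF nb0 b0; rewrite opprK -/E => /le_trans; apply.
have bN : 1 + (r + c * t) <= (2 + c) * jb (t + r).
  have g1 := jb_ge1 (t + r); have g2 := jb_ge_abs (t + r); rewrite ger0_norm ?addr_ge0 // in g2.
  have c1 : 0 <= 1 + c by rewrite addr_ge0 // ltW.
  have g3 := ler_wpM2l c1 g2; have g4 := mulr_ge0 (ltW c0) r0; lra.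
have h : (1 + (r + c * t)) `^ (1 - e) <= (2 + c) `^ (1 - e) * jb (t + r) `^ (1 - e).
  have b1 : 0 <= 1 + (r + c * t) by apply: addr_ge0.
  have e2 : 0 <= 1 - e by rewrite subr_ge0 ltW.
  rewrite -(powRM _ (ltW c3) (jb_ge0 _)).
  by apply: (ge0_ler_powR e2) => //; rewrite nnegrE //; exact: le_trans bN.
rewrite -[leRHS]mulrA -[2 * _ * _]mulrA; apply: ler_wpM2l; first exact: ltW.
lra.
Qed.

(** Away from the axis the momentum estimate along the incoming ray loses only the
    logarithms produced by the two critical terms 1/rho and 1/<q>. *)
Lemma outgoing_far_log (I : finType) (sp : I -> R) c kappa mu :
  (forall i, 0 <= sp i) -> 0 < c -> 0 < mu -> 1 <= kappa <= 2 -> exists2 C, 0 < C &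
  forall t x A g v, 1 <= enorm x -> x != 0 -> 0 < t -> 0 <= A -> smooth g ->
  cauchy_problem c g (fun=> 0) (fun=> 0) v -> source_family sp c kappa mu t x A g ->
  jb (t + enorm x) * (enorm x * `|outgoing c v x t|) <=
  C * (A * (jb (c * t - enorm x) `^ (1 - kappa) * ln (2 + t + enorm x))).
Proof.
move=> sp0 c0 mu0 k12; have /andP[k1 k2] := k12.
have [theta [C1 [C10 th0 kth kth0 HC1]]] := ray_rate sp0 c0 mu0 k12.
have [C2 C20 HC2] := zero_cauchy_decay sp0 c0 mu0 k1.
have [CS CS0 HS] := source_path sp0 c0 mu0.
have [CR CR0 HR] := reciprocal_path c0.
have [CQ CQ0 HQ] := log_path c0.
have ci : 0 < c^-1 by rewrite invr_gt0.
have l0 : 0 < ln 2 :> R := ln2_gt0.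
have li : 0 < (ln 2 : R)^-1 by rewrite invr_gt0.
set m := 1 + c^-1; have m0 : 0 < m by rewrite addr_gt0.
pose C3 := CS * (ln 2)^-1 + (CR + 2 * CQ).
have C30 : 0 < C3.
  by apply: ltr_wpDl; [rewrite mulr_ge0 // ltW|rewrite addr_gt0 // mulr_gt0].
exists (c * C2 * (1 + (ln 2)^-1) + C1 * m * C3) => [|t x A g v r1 x0 t0 A0 sg Cv Hg].
  by rewrite addr_gt0 //; [rewrite !mulr_gt0 // addr_gt0|rewrite (mulr_gt0 _ C30) // mulr_gt0].
set r := enorm x in r1 *; set N := jb (t + r); set D := jb _ `^ (1 - kappa); set L := ln (2 + t + r).
have r0 : 0 < r by exact: lt_le_trans r1.
have N0 : 0 < N by exact: jb_gt0.
have D0 : 0 <= D by exact: powR_ge0.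
have L2 : ln 2 <= L by apply: ln_ge_ln2; exact: ltW.
have L0 : 0 < L by exact: lt_le_trans L2.
have [sv eqv v0 v1] := Cv.
pose k0 := C1 * m * (A * (N^-1 * D)).
have k00 : 0 <= k0 by rewrite !mulr_ge0 ?invr_ge0 // ltW.
have [KS DS BS] := HS r t (ltW t0).
have [KR DR BR] := HR r t r1 (ltW t0).
have [KQ DQ BQ] := HQ r t (ltW r0) (ltW t0).
pose K s := k0 * (KS s + (KR s + 2 * KQ s)).
pose dK s := k0 * (\sum_i jb (sp i * s - (r + c * (t - s))) `^ (- (1 + mu))
  + ((r + c * (t - s))^-1 + 2 * jb (c * s - (r + c * (t - s))) `^ (-1))).
have HK s : 0 <= s <= t -> is_derive s 1 K (dK s).
  by move=> /andP[_ st]; exact: (isd_mull _ (isd_add (DS s) (isd_add (DR s st) (isd_mull 2 (DQ s))))).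
have leK s : 0 < s < t -> let rho := enorm x + c * (t - s) in
     let p := (s, rho *: unit_of x) in
     rho * `|g p| + c ^+ 2 / rho * rot_square_sum v p <= dK s.
  move=> st; apply: (le_trans (HC1 _ _ _ _ _ _ x0 st A0 sg Cv Hg)); have /andP[s0 st'] := st.
  rewrite -/r -/N -/D /dK; set rho := r + c * (t - s); set q := c * s - rho.
  have rho0 : 0 < rho by rewrite addr_gt0 // mulr_gt0 // subr_gt0.
  have IN := interpolation c0 r0 (ltW s0) (ltW st') (erefl rho) (erefl q) k1 th0 kth.
  set S := \sum_i _; have S0 : 0 <= S by apply: sumr_ge0 => i _; exact: powR_ge0.
  rewrite -/N -/D in IN; set W := N `^ theta * _ in IN *.
  have -> : k0 * (S + (rho^-1 + 2 * jb q `^ (-1))) = C1 * (A * (N^-1 * (m * D * S +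
      rho^-1 * (m * ((1 + 2 * rho / jb q) * D))))).
    rewrite powRN powRr1 ?jb_ge0 // /k0; field.
    by rewrite !lt0r_neq0 ?jb_gt0.
  apply: ler_wpM2l; first exact: ltW.
  apply: ler_wpM2l => //; apply: ler_wpM2l; first by rewrite invr_ge0 ltW.
  apply: lerD; last by apply: ler_wpM2l IN; rewrite invr_ge0 ltW.
  apply: ler_wpM2r => //; rewrite -[leLHS]mul1r; apply: ler_wpM2r => //.
  by rewrite lerDl ltW.
have RE := ray_estimate c0 t0 x0 sv eqv HK leK.
rewrite ray_momentum_zero // normr0 addr0 -/r in RE.
have KK : K t - K 0 <= k0 * (C3 * L).
  rewrite /K -mulrBr; apply: ler_wpM2l => //.
  have MM : CS <= CS * (ln 2)^-1 * L.
    rewrite -mulrA -[leLHS]mulr1; apply: ler_wpM2l => //.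
    by rewrite mulrC ler_pdivlMr // mul1r.
  rewrite -/L in BR BQ; rewrite /C3; lra.
have VV := HC2 _ _ _ _ _ x0 t0 A0 sg Cv (let: And4 h _ _ _ := Hg in h).
rewrite -/r -/N -/D in VV.
have LL := log_loss_le kappa (ltW t0) (ltW r0).
apply: (@le_trans _ _ (N * (c * `|v (t, x)| + k0 * (C3 * L)))).
  apply: ler_wpM2l; first exact: ltW.
  by apply: (le_trans RE); rewrite lerD2l.
rewrite [leLHS]mulrDr [leRHS]mulrDl; apply: lerD.
  rewrite mulrCA -!mulrA; apply: ler_wpM2l; first exact: ltW.
  apply: (le_trans VV); apply: ler_wpM2l; first exact: ltW.
  rewrite [leRHS]mulrCA; apply: ler_wpM2l => //; rewrite mulrCA; apply: ler_wpM2l => //.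
by rewrite le_eqVlt; apply/orP; left; apply/eqP; rewrite /k0; field; rewrite lt0r_neq0.
Qed.

End Source.

Section SourceFinal.
Context {R : realType}.
Local Notation PT := (R * 'rV[R]_3)%type.
Local Notation H := (@halfspace R).
Implicit Types (g v Phi Psi : PT -> R) (x y z w : 'rV[R]_3) (c t s r rho A m : R) (j k : 'I_3).

(** Where |x| > e t the radius rho is comparable to t + r.  This yields a second factor
    1/<t+r>, and the subcritical power <q>^(1-kappa) costs only <t+r>^(2-kappa). *)
Lemma outgoing_far_power (I : finType) (sp : I -> R) c kappa mu e :
  (forall i, 0 <= sp i) -> 0 < c -> 0 < mu -> 1 < kappa < 2 -> 0 < e -> exists2 C, 0 < C &
  forall t x A g v, e * t < enorm x -> 1 <= enorm x -> x != 0 -> 0 < t -> 0 <= A -> smooth g ->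
  cauchy_problem c g (fun=> 0) (fun=> 0) v -> source_family sp c kappa mu t x A g ->
  jb (t + enorm x) * (jb (t + enorm x) * `|outgoing c v x t|) <=
  C * (A * jb (c * t - enorm x) `^ (1 - kappa)).
Proof.
move=> sp0 c0 mu0 k12 e0; have /andP[k1 k2] := k12.
have k12' : 1 <= kappa <= 2 by rewrite !ltW.
have [theta [C1 [C10 th0 kth /(_ k1) thE HC1]]] := ray_rate sp0 c0 mu0 k12'.
rewrite {}thE {theta} in th0 kth HC1.
have [C2 C20 HC2] := zero_cauchy_decay sp0 c0 mu0 (ltW k1).
have km : 0 <= kappa - 1 < 1 by apply/andP; split; lra.
have [CS CS0 HS] := source_path sp0 c0 mu0.
have [CQ CQ0 HQ] := power_path c0 km.
have ci : 0 < c^-1 by rewrite invr_gt0.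
have ei : 0 < e^-1 by rewrite invr_gt0.
have m0 : 0 < 1 + c by rewrite addr_gt0.
(* This makes <t+r> <= 1 + t + r <= a r, as 1 <= r and t < r / e. *)
pose a := 2 + e^-1; have a0 : 0 < a by rewrite addr_gt0.
pose C3 := CS + a * CQ * (1 + c) `^ (kappa - 1).
have C30 : 0 <= C3.
  by apply: addr_ge0 => //; apply: mulr_ge0; [rewrite mulr_ge0 // ltW|exact: powR_ge0].
have Cp : 0 < a * (c * C2 + C1 * C3).
  by apply: mulr_gt0 => //; rewrite ltr_pwDl ?mulr_gt0 // mulr_ge0 // ltW.
exists (a * (c * C2 + C1 * C3)) => // t x A g v et r1 x0 t0 A0 sg Cv Hg.
set r := enorm x in r1 et *; set N := jb (t + r); set D := jb _ `^ (1 - kappa).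
have r0 : 0 < r by exact: lt_le_trans r1.
have N0 : 0 < N by exact: jb_gt0.
have D0 : 0 <= D by exact: powR_ge0.
have [sv eqv v0 v1] := Cv.
have Na : N <= a * r.
  have h1 := jb_le_add (t + r); rewrite ger0_norm ?addr_ge0 ?(ltW t0) ?(ltW r0) // in h1.
  have h2 : t <= e^-1 * r by rewrite ler_pdivlMl // ltW.
  apply: (le_trans h1); rewrite /a; lra.
pose k0 := C1 * (A * N^-1).
have k00 : 0 <= k0 by rewrite !mulr_ge0 ?invr_ge0 // ltW.
have [KS DS BS] := HS r t (ltW t0).
have [KQ DQ BQ] := HQ r t (ltW r0) (ltW t0).
pose K s := k0 * (D * KS s + a * N^-1 * KQ s).
pose dK s := k0 * (D * (\sum_i jb (sp i * s - (r + c * (t - s))) `^ (- (1 + mu)))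
  + a * N^-1 * jb (c * s - (r + c * (t - s))) `^ (- (kappa - 1))).
have HK s : 0 <= s <= t -> is_derive s 1 K (dK s).
  by move=> _; exact: (isd_mull _ (isd_add (isd_mull _ (DS s)) (isd_mull _ (DQ s)))).
have leK s : 0 < s < t -> let rho := enorm x + c * (t - s) in
     let p := (s, rho *: unit_of x) in
     rho * `|g p| + c ^+ 2 / rho * rot_square_sum v p <= dK s.
  move=> st; apply: (le_trans (HC1 _ _ _ _ _ _ x0 st A0 sg Cv Hg)); have /andP[s0 st'] := st.
  rewrite -/r -/N -/D /dK; set rho := r + c * (t - s); set q := c * s - rho.
  have rr : r <= rho by exact: (rho_ge_r c0 (ltW st') (erefl rho)).
  have rho0 : 0 < rho by exact: lt_le_trans rr.
  rewrite powRr0 mul1r addr0 /k0 -!mulrA; apply: ler_wpM2l; first exact: ltW.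
  apply: ler_wpM2l => //; apply: ler_wpM2l; first by rewrite invr_ge0 ltW.
  rewrite lerD2l mulrA; apply: ler_wpM2r; first exact: powR_ge0.
  rewrite -[leLHS]mul1r ler_pdivrMr // mulrAC ler_pdivlMr // mul1r.
  by apply: (le_trans Na); apply: ler_wpM2l => //; exact: ltW.
have RE := ray_estimate c0 t0 x0 sv eqv HK leK.
rewrite ray_momentum_zero // normr0 addr0 -/r in RE.
have KK : K t - K 0 <= k0 * (C3 * D).
  rewrite /K -mulrBr; apply: ler_wpM2l => //.
  have h4 : N^-1 * N `^ (1 - (kappa - 1)) <= (1 + c) `^ (kappa - 1) * D.
    have k1' : 0 <= kappa - 1 by case/andP: km.
    have dN : jb (c * t - r) <= (1 + c) * N by exact: (bracket_cone_total c0 r0 (lexx 0) (ltW t0)).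
    have := powR_anti_scale m0 (jb_gt0 _) dN k1'.
    rewrite opprB -/D; apply: le_trans.
    rewrite -[X in X * _]powR_inv1 ?(ltW N0) // -powRD; last by apply/implyP => _; rewrite lt0r_neq0.
    by rewrite (_ : - 1 + (1 + (1 - kappa)) = 1 - kappa) //; ring.
  have aN : 0 <= a * N^-1 by rewrite mulr_ge0 ?invr_ge0 // ltW.
  have aC : 0 <= a * CQ by rewrite mulr_ge0 // ltW.
  have g1 := ler_wpM2l aN BQ; have g2 := ler_wpM2l aC h4; have g3 := ler_wpM2l D0 BS.
  rewrite /C3 -/N in g1 *; lra.
have VV := HC2 _ _ _ _ _ x0 t0 A0 sg Cv (let: And4 h _ _ _ := Hg in h).
rewrite -/r -/N -/D /log_loss gt_eqF // mulr1 in VV.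
have RN : N * (r * `|outgoing c v x t|) <= (c * C2 + C1 * C3) * (A * D).
  apply: (@le_trans _ _ (N * (c * `|v (t, x)| + k0 * (C3 * D)))).
    apply: ler_wpM2l; first exact: ltW.
    by apply: (le_trans RE); rewrite lerD2l.
  rewrite [leLHS]mulrDr [leRHS]mulrDl; apply: lerD.
    by rewrite mulrCA -!mulrA; apply: ler_wpM2l VV; exact: ltW.
  by rewrite le_eqVlt; apply/orP; left; apply/eqP; rewrite /k0; field; rewrite lt0r_neq0.
rewrite -mulrA; apply: le_trans (ler_wpM2l (ltW a0) RN).
rewrite [leRHS]mulrCA; apply: ler_wpM2l; first exact: ltW.
by rewrite mulrA; exact: ler_wpM2r.
Qed.

(** The outgoing derivative is bounded by the first derivatives, which solve the wave
    equation themselves: those in space with zero data, that in time with the source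
    at time 0 as initial velocity. *)
Lemma outgoing_near (I : finType) (sp : I -> R) c kappa mu :
  (forall i, 0 <= sp i) -> 0 < c -> 0 < mu -> 1 <= kappa -> exists2 C, 0 < C &
  forall t x A g v, x != 0 -> 0 < t -> 0 <= A -> smooth g ->
  cauchy_problem c g (fun=> 0) (fun=> 0) v -> source_family sp c kappa mu t x A g ->
  jb (t + enorm x) * `|outgoing c v x t| <=
  C * (A * (jb (c * t - enorm x) `^ (1 - kappa) * log_loss kappa t (enorm x))).
Proof.
move=> sp0 c0 mu0 k1.
have [C1 C10 HC1] := zero_cauchy_decay sp0 c0 mu0 k1.
have [C2 C20 HC2] := source_decay sp0 c0 mu0 k1.
have [C3 C30 HC3] := velocity_decay c0 mu0 (le_trans ler01 k1).
pose l : R := Num.min 1 (ln 2).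
have l0 : 0 < l by rewrite lt_min ltr01 ln2_gt0.
have pc : 0 < 4 * pi * c :> R by rewrite !mulr_gt0 ?pi_gt0.
have li : 0 < l^-1 by rewrite invr_gt0.
pose C4 := (4 * pi * c)^-1 * (C2 + C3 * #|I|%:R * l^-1).
have C40 : 0 < C4.
  by rewrite mulr_gt0 ?invr_gt0 // ltr_pwDl // !mulr_ge0 // ltW.
exists ((1 + 3 * c) * (C1 + C4)) => [|t x A g v x0 t0 A0 sg Cv [Hg Hdt Hdx _]].
  by rewrite mulr_gt0 // addr_gt0 // mulr_gt0.
have [sv eqv v0 v1] := Cv.
have r0 := enorm_gt0 x0.
set N := jb (t + enorm x); have N0 : 0 < N by exact: jb_gt0.
set D := jb _ `^ (1 - kappa); have D0 : 0 <= D by exact: powR_ge0.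
set L := log_loss _ _ _.
have lL : l <= L by apply: log_loss_ge; exact: ltW.
have L0 : 0 < L by exact: lt_le_trans lL.
have DL : D <= l^-1 * (D * L).
  by rewrite mulrCA -[leLHS]mulr1; apply: ler_wpM2l => //; rewrite mulrC ler_pdivlMr // mul1r.
have X0 : 0 <= A * (D * L) by rewrite !mulr_ge0 // ltW.
have Bx j : N * `|dx j v (t, x)| <= C1 * (A * (D * L)).
  exact: (HC1 _ _ _ _ _ x0 t0 A0 (smooth_partial _ sg) (zero_cauchy_dx j sg Cv) (Hdx j)).
have Bt : N * `|dt v (t, x)| <= C4 * (A * (D * L)).
  have [e2 [e3 fr]] := unit_frame x0.
  have sdv : smooth (dt v) by exact: smooth_partial.
  have sdg : smooth (dt g) by exact: smooth_partial.
  have [_ edv _ Hvel] := cauchy_dt sg Cv.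
  rewrite -[in source_bound _ _ _ _ _ _ _ (dt g)](unitK x0) in Hdt.
  have S1 := HC2 t _ A _ e2 e3 _ _ r0 t0 A0 fr sdg sdv edv Hdt.
  have A1 : 0 <= A * #|I|%:R by rewrite mulr_ge0.
  have Hv0 y : enorm (y - enorm x *: unit_of x) <= c * t ->
      enorm y * `|dt (dt v) (0, y)| <= A * #|I|%:R * jb (enorm y) `^ (- (kappa + (1 + mu))).
    rewrite unitK // => yx; have Hc : cone c t x (0, y) by split => /=; rewrite ?subr0 // lexx ltW.
    have := Hg _ _ Hc; rewrite Hvel.
    have zz2 j : dx j (dx j (fun=> 0 : R)) (0, y) = 0.
      by apply: partial_vanish => [|q Hq]; [exact: H0|exact: partial_vanish].
    rewrite !zz2 !addr0 mulr0 addr0 => /le_trans; apply.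
    rewrite -mulrA; apply: ler_wpM2l => //; rewrite add0r.
    under eq_bigr do rewrite mulr0 sub0r jb_opp.
    have J0 := jb_gt0 (enorm y); set J := jb (enorm y) in J0 *.
    have -> : J `^ (- (kappa + (1 + mu))) = J `^ (- kappa) * J `^ (- (1 + mu)).
      rewrite -powRD; last by apply/implyP => _; rewrite lt0r_neq0.
      by rewrite opprD.
    by rewrite sumr_const -[X in _ * X <= _]mulr_natl mulrCA.
  have S2 := HC3 t _ _ _ e2 e3 _ r0 t0 A1 fr sdv v1 Hv0.
  rewrite unitK // -/N -/D -/L in S1 S2.
  set Y := mean_momentum _ _ _ _ _ _ _ _ in S1 S2.
  rewrite /C4 -mulrA ler_pdivlMl // mulrCA -[X in _ * (X * _) <= _](ger0_norm (ltW pc)) -normrM.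
  have S3 : N * `|4 * pi * c * dt v (t, x)| <= N * `|4 * pi * (c * dt v (t, x)) - Y| + N * `|Y|.
    rewrite -mulrDr; apply: ler_wpM2l; first exact: ltW.
    by rewrite [4 * pi * (c * _)]mulrA -{1}[4 * pi * c * _](subrK Y); exact: ler_normD.
  apply: (le_trans S3); rewrite [leRHS]mulrDl; apply: lerD => //.
  apply: (le_trans S2); rewrite -!mulrA; apply: ler_wpM2l; first exact: ltW.
  rewrite mulrCA; apply: ler_wpM2l => //; rewrite [leRHS]mulrCA; exact: ler_wpM2l.
have b1 : `|dt v (t, x)| <= N^-1 * ((C1 + C4) * (A * (D * L))).
  rewrite ler_pdivlMl //; apply: (le_trans Bt); rewrite [leRHS]mulrDl lerDr mulr_ge0 // ltW //.
have b2 j : `|dx j v (t, x)| <= N^-1 * ((C1 + C4) * (A * (D * L))).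
  rewrite ler_pdivlMl //; apply: (le_trans (Bx j)); rewrite [leRHS]mulrDl lerDl mulr_ge0 // ltW //.
rewrite -ler_pdivlMl //; apply: (le_trans (outgoing_bound c0 x0 b1 b2)).
by rewrite mulrCA -[in leRHS]mulrA.
Qed.

End SourceFinal.

Section Final.
Context {R : realType}.
Local Notation PT := (R * 'rV[R]_3)%type.
Local Notation H := (@halfspace R).
Implicit Types (g v f Phi Psi : PT -> R) (x y z w : 'rV[R]_3) (c t s r rho A m : R) (j k : 'I_3).

(** For r >= 1 the bracket of r is comparable to r, for r < 1 it is comparable to 1. *)
Lemma source_log_estimate (I : finType) (sp : I -> R) c kappa mu :
  (forall i, 0 <= sp i) -> 0 < c -> 0 < mu -> 1 <= kappa <= 2 -> exists2 C, 0 < C &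
  forall t x A g v, x != 0 -> 0 < t -> 0 <= A -> smooth g ->
  cauchy_problem c g (fun=> 0) (fun=> 0) v -> source_family sp c kappa mu t x A g ->
  jb (enorm x) * (jb (t + enorm x) * `|outgoing c v x t|) <=
  C * (A * (jb (c * t - enorm x) `^ (1 - kappa) * ln (2 + t + enorm x))).
Proof.
move=> sp0 c0 mu0 k12; have /andP[k1 k2] := k12.
have [C1 C10 HC1] := outgoing_far_log sp0 c0 mu0 k12.
have [C2 C20 HC2] := outgoing_near sp0 c0 mu0 k1.
have li : 0 < (ln 2 : R)^-1 by rewrite invr_gt0 ln2_gt0.
exists (2 * (C1 + C2 * (1 + (ln 2)^-1))) => [|t x A g v x0 t0 A0 sg Cv Hg].
  by rewrite mulr_gt0 // addr_gt0 // mulr_gt0 // addr_gt0.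
have r0 := enorm_gt0 x0; set r := enorm x in r0 *.
set D := jb _ `^ (1 - kappa); set L := ln (2 + t + r); set X := `|_|; have X0 : 0 <= X by exact: normr_ge0.
have D0 : 0 <= D by exact: powR_ge0.
have N0 : 0 < jb (t + r) by exact: jb_gt0.
have LL := log_loss_le kappa (ltW t0) (ltW r0).
have L0 : 0 <= L by rewrite ln_ge0 //; have := ltW t0; have := ltW r0; lra.
have Y0 : 0 <= A * (D * L) by rewrite !mulr_ge0.
have h1 := jb_le_add r; rewrite (gtr0_norm r0) in h1.
have NX : 0 <= jb (t + r) * X by rewrite mulr_ge0 // ltW.
have P1 : 0 <= C1 * (A * (D * L)) by rewrite mulr_ge0 // ltW.
have P2 : 0 <= C2 * (1 + (ln 2)^-1) * (A * (D * L)).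
  by rewrite mulr_ge0 // mulr_ge0 ?addr_ge0 // ltW.
rewrite -mulrA mulrDl.
have [r1|r1] := leP 1 r.
  have h2 := HC1 _ _ _ _ _ r1 x0 t0 A0 sg Cv Hg; rewrite -/r -/D -/L -/X in h2.
  have h3 : jb r <= 2 * r by lra.
  have := ler_wpM2r NX h3; rewrite -mulrA [r * _]mulrCA; lra.
have h2 := HC2 _ _ _ _ _ x0 t0 A0 sg Cv Hg; rewrite -/r -/D -/X in h2.
have h3 : jb r <= 2 by lra.
have h4 : C2 * (A * (D * log_loss kappa t r)) <= C2 * (1 + (ln 2)^-1) * (A * (D * L)).
  rewrite -mulrA; apply: ler_wpM2l; first exact: ltW.
  rewrite [leRHS]mulrCA; apply: ler_wpM2l => //; rewrite [leRHS]mulrCA; exact: ler_wpM2l.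
have := ler_wpM2r NX h3; lra.
Qed.

Lemma source_power_estimate (I : finType) (sp : I -> R) c kappa mu e :
  (forall i, 0 <= sp i) -> 0 < c -> 0 < mu -> 1 < kappa < 2 -> 0 < e -> exists2 C, 0 < C &
  forall t x A g v, e * t < enorm x -> x != 0 -> 0 < t -> 0 <= A -> smooth g ->
  cauchy_problem c g (fun=> 0) (fun=> 0) v -> source_family sp c kappa mu t x A g ->
  jb (t + enorm x) * (jb (t + enorm x) * `|outgoing c v x t|) <=
  C * (A * jb (c * t - enorm x) `^ (1 - kappa)).
Proof.
move=> sp0 c0 mu0 k12 e0; have /andP[k1 k2] := k12.
have [C1 C10 HC1] := outgoing_far_power sp0 c0 mu0 k12 e0.
have [C2 C20 HC2] := outgoing_near sp0 c0 mu0 (ltW k1).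
have ei : 0 < e^-1 by rewrite invr_gt0.
(* This bounds <t+r> where r < 1, as then t < 1/e. *)
pose a := 2 + e^-1; have a0 : 0 < a by rewrite addr_gt0.
exists (C1 + a * C2) => [|t x A g v et x0 t0 A0 sg Cv Hg].
  by rewrite addr_gt0 // mulr_gt0.
have r0 := enorm_gt0 x0; set r := enorm x in et r0 *.
set D := jb _ `^ (1 - kappa); set X := `|_|; have X0 : 0 <= X by exact: normr_ge0.
have D0 : 0 <= D by exact: powR_ge0.
have N0 : 0 < jb (t + r) by exact: jb_gt0.
have NX : 0 <= jb (t + r) * X by rewrite mulr_ge0 // ltW.
have AD : 0 <= A * D by exact: mulr_ge0.
have P1 := mulr_ge0 (ltW C10) AD; have P2 := mulr_ge0 (ltW (mulr_gt0 a0 C20)) AD.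
rewrite [leRHS]mulrDl.
have [r1|r1] := leP 1 r.
  have h2 := HC1 _ _ _ _ _ et r1 x0 t0 A0 sg Cv Hg; rewrite -/r -/D -/X in h2; lra.
have h2 := HC2 _ _ _ _ _ x0 t0 A0 sg Cv Hg.
rewrite -/r -/D -/X /log_loss gt_eqF // mulr1 in h2.
have h1 := jb_le_add (t + r); rewrite ger0_norm ?addr_ge0 ?(ltW t0) ?(ltW r0) // in h1.
have h3 : t <= e^-1 by rewrite -[e^-1]mulr1 ler_pdivlMl //; lra.
have h4 : jb (t + r) <= a by rewrite /a; lra.
have h5 : jb (t + r) * (jb (t + r) * X) <= a * (C2 * (A * D)).
  by apply: ler_pM => //; exact: ltW.
lra.
Qed.

(** * Estimates for the free problem *)

Definition data_bound c e t x B v := forall y, enorm (y - x) <= c * t ->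
  [/\ `|v (0, y)| <= B * jb (enorm y) `^ (- e),
      forall j, `|dx j v (0, y)| <= B * jb (enorm y) `^ (- e) &
      `|dt v (0, y)| <= B * jb (enorm y) `^ (- e)].

Lemma data_bound_sub c e t x B v s y : cone c t x (s, y) -> data_bound c e t x B v ->
  data_bound c e s y B v.
Proof.
move=> [/= _ yx] Hv y' y'y; apply: Hv; apply: (le_trans (enorm_triangle y' y x)); lra.
Qed.

(** Without a source, the value at the tip is the mean of the data over the bottom sphere
    (source_decay for the empty family of speeds). *)
Lemma free_decay c kappa mu : 0 < c -> 0 < mu -> 1 <= kappa -> exists2 C, 0 < C &
  forall t x B v, x != 0 -> 0 < t -> 0 <= B -> smooth v -> (forall p, H p -> box c v p = 0) ->
  data_bound c (kappa + (1 + mu)) t x B v ->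
  jb (t + enorm x) * `|v (t, x)| <= C * (B * jb (c * t - enorm x) `^ (1 - kappa)).
Proof.
move=> c0 mu0 k1; have [C C0 HC] := data_decay c0 mu0 k1.
have sp0 (i : 'I_0) : 0 <= (fun _ : 'I_0 => 0 : R) i by [].
have [C1 _ HC1] := source_decay sp0 c0 mu0 k1.
have pc : 0 < 4 * pi * c :> R by rewrite !mulr_gt0 ?pi_gt0.
exists (C / (4 * pi * c)) => [|t x B v x0 t0 B0 sv eqv Hv]; first by rewrite divr_gt0.
have r0 := enorm_gt0 x0.
have [e2 [e3 fr]] := unit_frame x0.
have Hg : source_bound (fun _ : 'I_0 => 0 : R) c kappa mu t (enorm x *: unit_of x) 0 (fun=> 0).
  by move=> s y _; rewrite normr0 mulr0 mul0r.
have E := HC1 t _ _ _ e2 e3 _ v r0 t0 (lexx 0) fr (smooth_cst0) sv eqv Hg.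
rewrite unitK // mul0r mulr0 pmulr_rle0 ?jb_gt0 // normr_le0 subr_eq0 in E.
rewrite -[in data_bound _ _ _ _ _ _](unitK x0) in Hv.
have := HC t _ _ _ e2 e3 _ r0 t0 B0 fr sv Hv.
rewrite unitK // -(eqP E) mulrA normrM (gtr0_norm pc) => X.
rewrite -(ler_pM2l pc) [leRHS]mulrA [_ * (C / _)]mulrC divfK ?lt0r_neq0 //.
by apply: le_trans X; rewrite mulrCA.
Qed.

Definition data_family c e t x B v : Prop :=
  [/\ data_bound c e t x B v,
      data_bound c e t x B (dt v),
      forall j, data_bound c e t x B (dx j v) &
      forall j k, (j < k)%N -> data_bound c e t x B (rotf j k (rotf j k v))].

Lemma box_partial_vanish c i v p : smooth v -> (forall q, H q -> box c v q = 0) -> H p ->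
  box c (partial i v) p = 0.
Proof. by move=> sv v0 Hp; rewrite -partial_box // partial_vanish. Qed.

Lemma box_rot_vanish c j k v p : smooth v -> j != k -> (forall q, H q -> box c v q = 0) -> H p ->
  box c (rotf j k v) p = 0.
Proof. by move=> sv jk v0 Hp; rewrite box_rot // /rotf !partial_vanish // !mulr0 subrr. Qed.

Lemma free_near c kappa mu : 0 < c -> 0 < mu -> 1 <= kappa -> exists2 C, 0 < C &
  forall t x B v, x != 0 -> 0 < t -> 0 <= B -> smooth v -> (forall p, H p -> box c v p = 0) ->
  data_family c (kappa + (1 + mu)) t x B v ->
  jb (t + enorm x) * `|outgoing c v x t| <= C * (B * jb (c * t - enorm x) `^ (1 - kappa)).
Proof.
move=> c0 mu0 k1; have [C C0 HC] := free_decay c0 mu0 k1.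
exists ((1 + 3 * c) * C) => [|t x B v x0 t0 B0 sv eqv [_ Ht Hx _]].
  by rewrite mulr_gt0 // addr_gt0 // mulr_gt0.
have N0 := jb_gt0 (t + enorm x).
have b1 := HC _ _ _ _ x0 t0 B0 (smooth_partial None sv) (fun p => @box_partial_vanish c _ v p sv eqv) Ht.
have b2 j := HC _ _ _ _ x0 t0 B0 (smooth_partial (Some j) sv) (fun p => @box_partial_vanish c _ v p sv eqv) (Hx j).
rewrite -ler_pdivlMl // in b1.
have {}b2 j : `|dx j v (t, x)| <= (jb (t + enorm x))^-1 * (C * (B * jb (c * t - enorm x) `^ (1 - kappa))).
  by rewrite ler_pdivlMl.
rewrite -ler_pdivlMl //; apply: (le_trans (outgoing_bound c0 x0 b1 b2)).
by rewrite mulrCA -[in leRHS]mulrA.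
Qed.

(** The surplus mu of decay of the data is split between the two critical terms: with
    nu = mu / 2, the product of 1/rho and <q>^-nu is dominated by the larger of
    rho^-(1+nu) and <q>^-(1+nu). *)
Lemma free_ray_rate c kappa mu : 0 < c -> 0 < mu -> 1 <= kappa <= 2 -> exists2 C, 0 < C &
  forall t x B v s, 1 <= enorm x -> x != 0 -> 0 < s < t -> 0 <= B -> smooth v ->
  (forall p, H p -> box c v p = 0) -> data_family c (kappa + (1 + mu)) t x B v ->
  let rho := enorm x + c * (t - s) in let p := (s, rho *: unit_of x) in
  c ^+ 2 / rho * rot_square_sum v p <= C * (B * ((jb (t + enorm x))^-1 *
    (jb (c * t - enorm x) `^ (1 - kappa) *
     \sum_(b : bool) jb ((if b then c else 0) * s - rho) `^ (- (1 + mu / 2))))).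
Proof.
move=> c0 mu0 /andP[k1 k2].
pose nu := mu / 2; have nu0 : 0 < nu by rewrite divr_gt0.
have k1' : 1 <= kappa + nu by rewrite (le_trans k1) // lerDl ltW.
have [C2 C20 HC2] := free_decay c0 nu0 k1'.
have ci : 0 < c^-1 by rewrite invr_gt0.
pose m := 1 + c^-1; have m0 : 0 < m by rewrite addr_gt0.
pose P := 2 `^ (1 + nu) : R; have P0 : 0 < P by rewrite powR_gt0.
have C30 : 0 < 3 * c ^+ 2 * C2 * m ^+ 2 by rewrite !mulr_gt0 // exprn_gt0.
have C40 : 0 < 3 * c ^+ 2 * C2 * m ^+ 2 * (P + 3) by rewrite (mulr_gt0 C30) // addr_gt0.
exists (3 * c ^+ 2 * C2 * m ^+ 2 * (P + 3)) => // t x B v s r1 x0 st B0 sv eqv [_ _ _ Hr].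
set r := enorm x in r1 *; set N := jb (t + r); set D := jb _ `^ (1 - kappa).
have r0 : 0 < r by exact: lt_le_trans r1.
have N0 : 0 < N by exact: jb_gt0.
have D0 : 0 <= D by exact: powR_ge0.
have /andP[s0 st'] := st; cbv zeta.
set rho := r + c * (t - s); set q := c * s - rho; set p := (s, _).
have rr : r <= rho by exact: (rho_ge_r c0 (ltW st') (erefl rho)).
have rho0 : 0 < rho by exact: lt_le_trans rr.
have pE : enorm p.2 = rho by rewrite enormZ enorm_unit // mulr1 gtr0_norm.
have Hc : cone c t x p by apply: ray_cone => //; rewrite !ltW.
set Q := jb q; have Q0 : 0 < Q by exact: jb_gt0.
set M1 := jb (s + rho); have M10 : 0 < M1 by exact: jb_gt0.
have NM : N <= m * M1 by exact: (bracket_future_le c0 r0 (ltW s0) (ltW st') (erefl rho)).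
have Mi : M1^-1 <= m * N^-1.
  by rewrite -[leLHS]mul1r ler_pdivrMr // mulrAC ler_pdivlMr // mul1r.
have T2 j k : (j < k)%N -> `|rotf j k (rotf j k v) p| <=
    C2 * m * (B * (N^-1 * (Q `^ (- nu) * Q `^ (- (kappa - 1))))).
  move=> jk; have jk' : j != k by rewrite neq_ltn jk.
  have p0 : rho *: unit_of x != 0 by rewrite !scaler_eq0 invr_eq0 !negb_or x0 !lt0r_neq0.
  have HB := data_bound_sub Hc (Hr _ _ jk).
  rewrite (_ : kappa + (1 + mu) = (kappa + nu) + (1 + nu)) in HB; last by rewrite /nu; field.
  have s1 := smooth_rot j k sv.
  have e1 q' : H q' -> box c (rotf j k v) q' = 0 by exact: box_rot_vanish.
  have e2 q' : H q' -> box c (rotf j k (rotf j k v)) q' = 0 by exact: box_rot_vanish.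
  have := HC2 s _ B _ p0 s0 B0 (smooth_rot j k s1) e2 HB.
  rewrite -[enorm (rho *: _)]/(enorm p.2) pE -/M1 -/q -/Q => HQ.
  rewrite -ler_pdivlMl // in HQ; apply: (le_trans HQ).
  have -> : 1 - (kappa + nu) = - nu + - (kappa - 1) by ring.
  rewrite powRD; last by apply/implyP => _; rewrite lt0r_neq0.
  set Y := Q `^ (- nu) * _; have Y0 : 0 <= Y by rewrite mulr_ge0 ?powR_ge0.
  have Z0 : 0 <= C2 * (B * Y) by rewrite mulr_ge0 ?(ltW C20) // mulr_ge0.
  have := ler_wpM2r Z0 Mi; congr (is_true (_ <= _)); ring.
have IN := interpolation c0 r0 (ltW s0) (ltW st') (erefl rho) (erefl q) k1 (lexx 0).
rewrite addr0 powRr0 mul1r -/D -/Q in IN.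
have {}IN : Q `^ (- (kappa - 1)) <= m * ((1 + 2 * rho / Q) * D) by apply: IN; lra.
have young : rho^-1 * Q `^ (- nu) <= P * jb rho `^ (- (1 + nu)) + Q `^ (- (1 + nu)).
  have sp (y : R) : 0 < y -> y `^ (- (1 + nu)) = y^-1 * y `^ (- nu).
    by move=> y0; rewrite opprD powRD ?powR_inv1 ?(ltW y0) //; apply/implyP => _; rewrite lt0r_neq0.
  have [le|lt] := leP rho Q.
    apply: (@le_trans _ _ (rho `^ (- (1 + nu)))).
      rewrite sp //; apply: ler_wpM2l; first by rewrite invr_ge0 ltW.
      by apply: powR_anti => //; exact: ltW.
    have h : jb rho <= 2 * rho.
      by have := jb_le_add rho; rewrite gtr0_norm // => h; have r1' := le_trans r1 rr; lra.
    have nu' : 0 <= 1 + nu by lra.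
    have h2 := powR_anti_scale (ltr0n R 2) (jb_gt0 rho) h nu'.
    by apply: (le_trans h2); rewrite lerDl powR_ge0.
  rewrite [Q `^ (- (1 + nu))]sp // ler_wpDl ?mulr_ge0 ?powR_ge0 ?(ltW P0) //.
  apply: ler_wpM2r; first exact: powR_ge0.
  by rewrite lef_pV2 ?posrE // ltW.
have Qs : Q `^ (- (1 + nu)) = Q^-1 * Q `^ (- nu).
  by rewrite opprD powRD ?powR_inv1 ?(ltW Q0) //; apply/implyP => _; rewrite lt0r_neq0.
set W := rho^-1 * (Q `^ (- nu) * Q `^ (- (kappa - 1))).
have HW : W <= m * D * (P * jb rho `^ (- (1 + nu)) + 3 * Q `^ (- (1 + nu))).
  have g0 : 0 <= rho^-1 * Q `^ (- nu) by rewrite mulr_ge0 ?powR_ge0 // invr_ge0 ltW.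
  rewrite /W mulrA; apply: (le_trans (ler_wpM2l g0 IN)).
  have -> : rho^-1 * Q `^ (- nu) * (m * ((1 + 2 * rho / Q) * D)) =
     m * D * (rho^-1 * Q `^ (- nu) + 2 * Q `^ (- (1 + nu))).
    by rewrite Qs; field; rewrite !lt0r_neq0.
  apply: ler_wpM2l; first by rewrite mulr_ge0 // ltW.
  lra.
have h : rot_square_sum v p <= 3 * (C2 * m * (B * (N^-1 * (Q `^ (- nu) * Q `^ (- (kappa - 1)))))).
  have h1 := T2 0 1 isT; have h2 := T2 0 2 isT; have h3 := T2 1 2 isT.
  rewrite /rot_square_sum; lra.
have cr : 0 <= c ^+ 2 / rho by rewrite divr_ge0 ?sqr_ge0 // ltW.
apply: (le_trans (ler_wpM2l cr h)).
pose kk := 3 * c ^+ 2 * C2 * m * (B * N^-1).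
have kk0 : 0 <= kk by rewrite !mulr_ge0 ?sqr_ge0 ?invr_ge0 // ltW.
rewrite big_bool /= mul0r sub0r jb_opp -/nu -/Q.
have S : P * jb rho `^ (- (1 + nu)) + 3 * Q `^ (- (1 + nu)) <=
    (P + 3) * (Q `^ (- (1 + nu)) + jb rho `^ (- (1 + nu))).
  have g1 := powR_ge0 (jb rho) (- (1 + nu)); have g2 := powR_ge0 Q (- (1 + nu)).
  have g3 := mulr_ge0 (ltW P0) g2; lra.
have mD : 0 <= m * D by rewrite mulr_ge0 // ltW.
have := ler_wpM2l kk0 (le_trans HW (ler_wpM2l mD S)).
congr (is_true (_ <= _)); rewrite /kk /W; ring.
Qed.

(** At time 0 the ray is at distance r + ct from the origin, where the data are of order
    <r + ct>^-(kappa+1+mu); two of these powers are absorbed by <t+r> and rho. *)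
Lemma free_initial_momentum c kappa mu t x B v :
  0 < c -> 0 < mu -> 1 <= kappa -> x != 0 -> 0 < t -> 0 <= B -> smooth v ->
  data_bound c (kappa + (1 + mu)) t x B v ->
  jb (t + enorm x) * `|ray_momentum c (t + enorm x / c) 0 v (unit_of x) 0| <=
  (1 + 4 * c) * (1 + c^-1) * (B * jb (c * t - enorm x) `^ (1 - kappa)).
Proof.
move=> c0 mu0 k1 x0 t0 B0 sv Hv.
have r0 := enorm_gt0 x0; set r := enorm x in r0 *; set N := jb (t + r).
set D := jb _ `^ (1 - kappa); set m := 1 + c^-1.
have m0 : 0 < m by rewrite addr_gt0 // invr_gt0.
have N0 : 0 < N by exact: jb_gt0.
have c4 : 0 <= 1 + 4 * c by rewrite addr_ge0 // mulr_ge0 // ltW.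
pose b := r + c * t.
have b0 : 0 < b by rewrite addr_gt0 // mulr_gt0.
set J := jb b; have J0 : 0 < J by exact: jb_gt0.
have rE : c * (t + r / c - 0) = b by rewrite /b; field; exact: lt0r_neq0.
have bE : r + c * (t - 0) = b by rewrite subr0.
have NJ : N <= m * J.
  have := bracket_future_le c0 r0 (lexx 0) (ltW t0) (erefl _).
  by rewrite add0r bE.
have dJ : jb (c * t - r) <= J.
  apply: jb_mono; rewrite (gtr0_norm b0); apply: (le_trans (ler_normB _ _)).
  by rewrite !gtr0_norm ?mulr_gt0 // addrC.
have bx : enorm (b *: unit_of x - x) <= c * t.
  have -> : b *: unit_of x - x = (c * t) *: unit_of x.
    by rewrite /b scalerDl unitK // addrAC subrr add0r.
  by rewrite enormZ enorm_unit // mulr1 gtr0_norm // mulr_gt0.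
have [] := Hv _ bx; rewrite enormZ enorm_unit // mulr1 (gtr0_norm b0) -/J.
set Y := B * J `^ _ => y1 y2 y3.
have Y0 : 0 <= Y by rewrite mulr_ge0 ?powR_ge0.
have bJ : b <= J by apply: le_trans (jb_ge_abs _); exact: ler_norm.
have J1 : 1 <= J by exact: jb_ge1.
have E : `|ray_momentum c (t + r / c) 0 v (unit_of x) 0| <= (1 + 4 * c) * (J * Y).
  rewrite /ray_momentum rE /ray add0r !extendE; try exact: H0.
  apply: (le_trans (ler_normD _ _)).
  have g1 : `|dt v (0, b *: unit_of x) + c * grad v (unit_of x) (0, b *: unit_of x)| <= (1 + 3 * c) * Y.
    apply: (le_trans (ler_normD _ _)); rewrite mulrDl mul1r; apply: lerD; first exact: y3.
    rewrite normrM (gtr0_norm c0) [3 * c]mulrC -mulrA; apply: ler_wpM2l; first exact: ltW.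
    apply: grad_bound; rewrite ?enorm_unit // => j; rewrite extendE //; exact: H0.
  have g2 : b * `|dt v (0, b *: unit_of x) + c * grad v (unit_of x) (0, b *: unit_of x)| <= J * ((1 + 3 * c) * Y).
    by apply: ler_pM => //; exact: ltW.
  have g3 : c * `|v (0, b *: unit_of x)| <= c * (J * Y).
    apply: ler_wpM2l; first exact: ltW.
    apply: (le_trans y1); rewrite -[leLHS]mul1r; exact: ler_wpM2r.
  rewrite normrM (gtr0_norm b0) [`|c * _|]normrM (gtr0_norm c0).
  apply: (le_trans (lerD g2 g3)); rewrite le_eqVlt; apply/orP; left; apply/eqP; ring.
have F0 : 0 <= (1 + 4 * c) * (J * Y).
  by rewrite (mulr_ge0 c4) // mulr_ge0 // ltW.
apply: (le_trans (ler_pM (ltW N0) (normr_ge0 _) NJ E)).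
have JJ : J * J * J `^ (- (kappa + (1 + mu))) <= D.
  have -> : J * J * J `^ (- (kappa + (1 + mu))) = J `^ (- (kappa - 1 + mu)).
    rewrite -[X in X * X * _](powRr1 (ltW J0)) -!powRD; try by apply/implyP => _; rewrite lt0r_neq0.
    by congr (_ `^ _); ring.
  have k1m : 0 <= kappa - 1 by rewrite subr_ge0.
  apply: (@le_trans _ _ (J `^ (- (kappa - 1)))).
    by apply: ler_powR => //; rewrite lerN2 lerDl ltW.
  have := powR_anti (jb_gt0 _) dJ k1m.
  by rewrite /D (_ : - (kappa - 1) = 1 - kappa) //; ring.
have G0 : 0 <= (1 + 4 * c) * m * B.
  by rewrite (mulr_ge0 _ B0) // (mulr_ge0 c4) // ltW.
have := ler_wpM2l G0 JJ; rewrite /Y; congr (is_true (_ <= _)); ring.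
Qed.

(** The two terms of free_ray_rate are brackets of c s - rho and of 0 s - rho, so that
    source_path applies with the speeds c and 0. *)
Lemma free_far c kappa mu : 0 < c -> 0 < mu -> 1 <= kappa <= 2 -> exists2 C, 0 < C &
  forall t x B v, 1 <= enorm x -> x != 0 -> 0 < t -> 0 <= B -> smooth v ->
  (forall p, H p -> box c v p = 0) -> data_family c (kappa + (1 + mu)) t x B v ->
  jb (t + enorm x) * (enorm x * `|outgoing c v x t|) <=
  C * (B * jb (c * t - enorm x) `^ (1 - kappa)).
Proof.
move=> c0 mu0 k12; have /andP[k1 k2] := k12.
have [C1 C10 HC1] := free_decay c0 mu0 k1.
have [C2 C20 HC2] := free_ray_rate c0 mu0 k12.
have sp0 (b : bool) : 0 <= if b then c else 0 by case: b => //; exact: ltW.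
have nu0 : 0 < mu / 2 by rewrite divr_gt0.
have [CS CS0 HS] := source_path sp0 c0 nu0.
have Cp : 0 < c * C1 + ((1 + 4 * c) * (1 + c^-1) + C2 * CS).
  have h1 := mulr_gt0 c0 C10; have h3 := mulr_ge0 (ltW C20) CS0.
  have h2 : 0 < (1 + 4 * c) * (1 + c^-1) by rewrite mulr_gt0 ?addr_gt0 ?mulr_gt0 ?invr_gt0.
  lra.
exists (c * C1 + ((1 + 4 * c) * (1 + c^-1) + C2 * CS)) => // t x B v r1 x0 t0 B0 sv eqv Hv.
have [Hv0 _ _ _] := Hv.
have IM := free_initial_momentum c0 mu0 k1 x0 t0 B0 sv Hv0.
have VV := HC1 _ _ _ _ x0 t0 B0 sv eqv Hv0.
have [KS DS BS] := HS (enorm x) t (ltW t0).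
set r := enorm x in r1 IM VV BS DS *; set N := jb (t + r) in IM VV *.
set D := jb _ `^ (1 - kappa) in IM VV *.
have N0 : 0 < N by exact: jb_gt0.
have D0 : 0 <= D by exact: powR_ge0.
pose k0 := C2 * (B * (N^-1 * D)).
have k00 : 0 <= k0.
  by apply: mulr_ge0; [exact: ltW|rewrite !mulr_ge0 // invr_ge0 ltW].
have HK s : 0 <= s <= t -> is_derive s 1 (fun s => k0 * KS s) _ := fun _ => isd_mull k0 (DS s).
have leK s : 0 < s < t -> let rho := enorm x + c * (t - s) in
     let p := (s, rho *: unit_of x) in
     rho * `|(fun=> 0 : R) p| + c ^+ 2 / rho * rot_square_sum v p <=
     k0 * \sum_(b : bool) jb ((if b then c else 0) * s - (r + c * (t - s))) `^ (- (1 + mu / 2)).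
  move=> st; have := HC2 _ _ _ _ _ r1 x0 st B0 sv eqv Hv.
  by cbv zeta; rewrite normr0 mulr0 add0r /k0 -!mulrA.
have RE := ray_estimate c0 t0 x0 sv eqv HK leK; rewrite -/r -mulrBr in RE.
have KK : N * (k0 * (KS t - KS 0)) <= C2 * CS * (B * D).
  apply: (le_trans (ler_wpM2l (ltW N0) (ler_wpM2l k00 BS))).
  by rewrite le_eqVlt; apply/orP; left; apply/eqP; rewrite /k0; field; rewrite lt0r_neq0.
apply: (le_trans (ler_wpM2l (ltW N0) RE)); rewrite -addrA [leLHS]mulrDr [leRHS]mulrDl.
apply: lerD; first by rewrite mulrCA -mulrA; apply: ler_wpM2l VV; exact: ltW.
by rewrite [leLHS]mulrDr [leRHS]mulrDl; apply: lerD.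
Qed.

Lemma free_estimate c kappa mu : 0 < c -> 0 < mu -> 1 <= kappa <= 2 -> exists2 C, 0 < C &
  forall t x B v, x != 0 -> 0 < t -> 0 <= B -> smooth v -> (forall p, H p -> box c v p = 0) ->
  data_family c (kappa + (1 + mu)) t x B v ->
  jb (enorm x) * (jb (t + enorm x) * `|outgoing c v x t|) <=
  C * (B * jb (c * t - enorm x) `^ (1 - kappa)).
Proof.
move=> c0 mu0 k12; have /andP[k1 k2] := k12.
have [C1 C10 HC1] := free_far c0 mu0 k12.
have [C2 C20 HC2] := free_near c0 mu0 k1.
exists (2 * (C1 + C2)) => [|t x B v x0 t0 B0 sv eqv Hv].
  by rewrite mulr_gt0 // addr_gt0.
have r0 := enorm_gt0 x0; set r := enorm x in r0 *.
set D := jb _ `^ (1 - kappa); set X := `|_|; have X0 : 0 <= X by exact: normr_ge0.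
have D0 : 0 <= D by exact: powR_ge0.
have N0 : 0 < jb (t + r) by exact: jb_gt0.
have BD : 0 <= B * D by exact: mulr_ge0.
have h1 := jb_le_add r; rewrite (gtr0_norm r0) in h1.
have NX : 0 <= jb (t + r) * X by rewrite mulr_ge0 // ltW.
have P1 := mulr_ge0 (ltW C10) BD; have P2 := mulr_ge0 (ltW C20) BD.
rewrite -mulrA [leRHS]mulrCA !mulrDl.
have [r1|r1] := leP 1 r.
  have h2 := HC1 _ _ _ _ r1 x0 t0 B0 sv eqv Hv; rewrite -/r -/D -/X in h2.
  have h3 : jb r <= 2 * r by lra.
  have := ler_wpM2r NX h3; rewrite -mulrA [r * _]mulrCA; lra.
have h2 := HC2 _ _ _ _ x0 t0 B0 sv eqv Hv; rewrite -/r -/D -/X in h2.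
have h3 : jb r <= 2 by lra.
have := ler_wpM2r NX h3; lra.
Qed.

End Final.

(** * From the suprema to pointwise bounds *)

Section Glue.
Context {R : realType}.
Local Notation PT := (R * 'rV[R]_3)%type.
Local Notation H := (@halfspace R).
Implicit Types (g v f Phi Psi : PT -> R) (x y z w : 'rV[R]_3) (c t s r rho A m : R) (j k : 'I_3).

Lemma weight_attained N (cs : 'I_N -> R) t r :
  exists i, weight cs t r = jb (odflt 0 (omap cs i) * t - r).
Proof.
pose K m := exists i, m = jb (odflt 0 (omap cs i) * t - r).
rewrite -/(K _) /weight; elim/big_ind: _.
- by exists None.
- by move=> a b [i ->] [j ->]; rewrite minElt; case: ifP => _; [exists i|exists j].
- by move=> j _; exists (Some j).
Qed.

Lemma weight_pow_le N (cs : 'I_N -> R) t r e :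
  weight cs t r `^ (- e) <= \sum_(i : option 'I_N) jb (odflt 0 (omap cs i) * t - r) `^ (- e).
Proof.
have [i ->] := weight_attained cs t r.
by rewrite (bigD1 i) //= lerDl; apply: sumr_ge0 => j _; exact: powR_ge0.
Qed.

Lemma weight_gt0 N (cs : 'I_N -> R) t r : 0 < weight cs t r.
Proof. by have [i ->] := weight_attained cs t r; exact: jb_gt0. Qed.

Lemma enum7 : enum 'I_7 = [:: @Ordinal 7 0 isT; @Ordinal 7 1 isT; @Ordinal 7 2 isT;
  @Ordinal 7 3 isT; @Ordinal 7 4 isT; @Ordinal 7 5 isT; @Ordinal 7 6 isT].
Proof. by apply: (inj_map val_inj); rewrite val_enum_ord. Qed.

(** The multi-index is given by the list l of its entries, so that the iterated vector
    field of an explicit list computes. *)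
Lemma Znorm_ge (s : nat) (l : seq nat) f p : size l = 7%N -> (sumn l <= s)%N ->
  `|Zpow (fun i => nth 0%N l i) f p| <= Znorm s f p.
Proof.
move=> sl ls.
have sE : (\sum_(i < 7) nth 0 l i = sumn l)%N.
  by rewrite sumnE (big_nth 0%N) sl big_mkord.
have li (i : 'I_7) : (nth 0 l i < s.+1)%N.
  by rewrite ltnS (leq_trans _ ls) // -sE (bigD1 i) //= leq_addr.
pose al := [ffun i : 'I_7 => Ordinal (li i)].
have alE : (fun i => al i : nat) = (fun i : 'I_7 => nth 0%N l i).
  by apply/funext => i; rewrite ffunE.
rewrite /Znorm (bigD1 al) /=; last first.
  by under eq_bigr => i _ do rewrite ffunE /=; rewrite sE.
by rewrite alE lerDl; apply: sumr_ge0.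
Qed.

Lemma Znorm_ge0 (s : nat) f p : 0 <= Znorm s f p.
Proof. exact: sumr_ge0. Qed.

Lemma Znorm_pieces (s : nat) f p : (2 <= s)%N ->
  [/\ `|f p| <= Znorm s f p, `|dt f p| <= Znorm s f p,
      forall j, `|dx j f p| <= Znorm s f p &
      forall j k, (j < k)%N -> `|rotf j k (rotf j k f) p| <= Znorm s f p].
Proof.
move=> s2; have Z l := @Znorm_ge s l f p.
split.
- by have := Z [:: 0; 0; 0; 0; 0; 0; 0]%N erefl isT; rewrite /Zpow enum7.
- by have := Z [:: 1; 0; 0; 0; 0; 0; 0]%N erefl (ltnW s2); rewrite /Zpow enum7 /= -pdtE.
- move=> j; rewrite -pdxE; case: (ord3P j) => ->.
  + by have := Z [:: 0; 1; 0; 0; 0; 0; 0]%N erefl (ltnW s2); rewrite /Zpow enum7.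
  + by have := Z [:: 0; 0; 1; 0; 0; 0; 0]%N erefl (ltnW s2); rewrite /Zpow enum7.
  + by have := Z [:: 0; 0; 0; 1; 0; 0; 0]%N erefl (ltnW s2); rewrite /Zpow enum7.
- move=> j k; rewrite -!rotationE; case: (ord3P j) => ->; case: (ord3P k) => -> // _.
  + by have := Z [:: 0; 0; 0; 0; 2; 0; 0]%N erefl s2; rewrite /Zpow enum7.
  + by have := Z [:: 0; 0; 0; 0; 0; 2; 0]%N erefl s2; rewrite /Zpow enum7.
  + by have := Z [:: 0; 0; 0; 0; 0; 0; 2]%N erefl s2; rewrite /Zpow enum7.
Qed.

(** In the ordered products defining the norm the spatial derivatives occur in one order
    only, whence the alternative. *)
Lemma Znorm_third f p :
  [/\ forall j k, `|dx j (dx k f) p| <= Znorm 3 f p \/ `|dx k (dx j f) p| <= Znorm 3 f p &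
      forall i j k, (j < k)%N -> `|dx i (rotf j k (rotf j k f)) p| <= Znorm 3 f p].
Proof.
have Z l := @Znorm_ge 3 l f p.
split.
- move=> j k; rewrite -!pdxE; case: (ord3P j) => ->; case: (ord3P k) => ->.
  + by left; have := Z [:: 0; 2; 0; 0; 0; 0; 0]%N erefl isT; rewrite /Zpow enum7.
  + by left; have := Z [:: 0; 1; 1; 0; 0; 0; 0]%N erefl isT; rewrite /Zpow enum7.
  + by left; have := Z [:: 0; 1; 0; 1; 0; 0; 0]%N erefl isT; rewrite /Zpow enum7.
  + by right; have := Z [:: 0; 1; 1; 0; 0; 0; 0]%N erefl isT; rewrite /Zpow enum7.
  + by left; have := Z [:: 0; 0; 2; 0; 0; 0; 0]%N erefl isT; rewrite /Zpow enum7.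
  + by left; have := Z [:: 0; 0; 1; 1; 0; 0; 0]%N erefl isT; rewrite /Zpow enum7.
  + by right; have := Z [:: 0; 1; 0; 1; 0; 0; 0]%N erefl isT; rewrite /Zpow enum7.
  + by right; have := Z [:: 0; 0; 1; 1; 0; 0; 0]%N erefl isT; rewrite /Zpow enum7.
  + by left; have := Z [:: 0; 0; 0; 2; 0; 0; 0]%N erefl isT; rewrite /Zpow enum7.
- move=> i j k; rewrite -pdxE -!rotationE.
  case: (ord3P i) => ->; case: (ord3P j) => ->; case: (ord3P k) => -> // _.
  + by have := Z [:: 0; 1; 0; 0; 2; 0; 0]%N erefl isT; rewrite /Zpow enum7.
  + by have := Z [:: 0; 1; 0; 0; 0; 2; 0]%N erefl isT; rewrite /Zpow enum7.
  + by have := Z [:: 0; 1; 0; 0; 0; 0; 2]%N erefl isT; rewrite /Zpow enum7.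
  + by have := Z [:: 0; 0; 1; 0; 2; 0; 0]%N erefl isT; rewrite /Zpow enum7.
  + by have := Z [:: 0; 0; 1; 0; 0; 2; 0]%N erefl isT; rewrite /Zpow enum7.
  + by have := Z [:: 0; 0; 1; 0; 0; 0; 2]%N erefl isT; rewrite /Zpow enum7.
  + by have := Z [:: 0; 0; 0; 1; 2; 0; 0]%N erefl isT; rewrite /Zpow enum7.
  + by have := Z [:: 0; 0; 0; 1; 0; 2; 0]%N erefl isT; rewrite /Zpow enum7.
  + by have := Z [:: 0; 0; 0; 1; 0; 0; 2]%N erefl isT; rewrite /Zpow enum7.
Qed.

(** An infinite supremum bounds everything, and a finite one is itself a majorant. *)
Lemma le_scaled_sup (U : Type) (S : set U) (f : U -> R) (C L : R) : 0 < C ->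
  (exists q, S q) -> (forall q, S q -> 0 <= f q) ->
  (forall A, 0 <= A -> (forall q, S q -> f q <= A) -> L <= C * A) ->
  (L%:E <= C%:E * ereal_sup [set (f q)%:E | q in S])%E.
Proof.
move=> C0 [q0 Sq0] f0 HL.
have ub q : S q -> ((f q)%:E <= ereal_sup [set (f q)%:E | q in S])%E.
  by move=> Sq; apply: ereal_sup_ubound; exists q.
have pos : (0%:E <= ereal_sup [set (f q)%:E | q in S])%E.
  by apply: le_trans (ub _ Sq0); rewrite lee_fin f0.
move: ub pos; case: (ereal_sup _) => [A| |] ub pos //.
- rewrite -EFinM lee_fin; apply: HL => [|q Sq]; first by rewrite -lee_fin.
  by rewrite -lee_fin; exact: ub.
- by rewrite gt0_muley ?lte_fin // leey.
Qed.

Lemma source_family_of_sup N (cs : 'I_N -> R) c kappa mu t x A g : 0 < mu ->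
  (forall q, cone c t x q -> enorm q.2 * jb (q.1 + enorm q.2) `^ kappa *
     weight cs q.1 (enorm q.2) `^ (1 + mu) * Znorm 2 g q <= A) ->
  source_family (fun i => odflt 0 (omap cs i)) c kappa mu t x A g.
Proof.
move=> mu0 HA.
have key f : (forall p, `|f p| <= Znorm 2 g p) ->
    source_bound (fun i => odflt 0 (omap cs i)) c kappa mu t x A f.
  move=> fg s y Hc; have := HA _ Hc; rewrite /=.
  set W := weight _ _ _; set J := jb _; set Z := Znorm _ _ _ => h.
  have W0 : 0 < W by exact: weight_gt0.
  have J0 : 0 < J by exact: jb_gt0.
  have P0 : 0 < J `^ kappa by rewrite powR_gt0.
  have Q0 : 0 < W `^ (1 + mu) by rewrite powR_gt0.
  have PQ : J `^ kappa * W `^ (1 + mu) * (enorm y * `|f (s, y)|) <= A.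
    apply: le_trans h.
    have -> : enorm y * J `^ kappa * W `^ (1 + mu) * Z = J `^ kappa * W `^ (1 + mu) * (enorm y * Z).
      by ring.
    apply: ler_wpM2l; first by rewrite ltW // mulr_gt0.
    by apply: ler_wpM2l; [exact: enorm_ge0|exact: fg].
  have A0 : 0 <= A.
    by apply: le_trans PQ; rewrite !mulr_ge0 ?enorm_ge0 // ltW.
  rewrite -ler_pdivlMl ?mulr_gt0 // in PQ; apply: (le_trans PQ).
  rewrite mulrC; apply: ler_wpM2l => //; rewrite invfM powRN; apply: ler_wpM2l.
    by rewrite invr_ge0 ltW.
  by rewrite -powRN; exact: weight_pow_le.
split.
- by apply: key => p; have [] := @Znorm_pieces 2 g p isT.
- by apply: key => p; have [] := @Znorm_pieces 2 g p isT.
- by move=> j; apply: key => p; have [_ _ h _] := @Znorm_pieces 2 g p isT; exact: h.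
- by move=> j k jk; apply: key => p; have [_ _ _ h] := @Znorm_pieces 2 g p isT; exact: h.
Qed.

Lemma data_bound_of_cauchy c e t x B g Phi Psi v : cauchy_problem c g Phi Psi v ->
  (forall y, enorm (y - x) <= c * t ->
    [/\ `|Phi (0, y)| <= B * jb (enorm y) `^ (- e),
        forall j, `|dx j Phi (0, y)| <= B * jb (enorm y) `^ (- e) &
        `|Psi (0, y)| <= B * jb (enorm y) `^ (- e)]) ->
  data_bound c e t x B v.
Proof.
move=> [sv _ v0 v1] Hd y /Hd [h1 h2 h3]; split; rewrite ?v0 ?v1 // => j.
by rewrite (dx_trace _ _ v0).
Qed.

(** The second time derivative at time 0 is expressed by the Laplacian of the first datum;
    this is where the factor 3 c^2 comes from. *)
Lemma data_family_of_sup c kappa mu t x A (phi psi : 'rV[R]_3 -> R) v : 0 < c ->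
  smooth_on setT phi -> smooth_on setT psi ->
  cauchy_problem c (fun=> 0) (static phi) (static psi) v ->
  (forall y, enorm (y - x) <= c * t -> jb (enorm y) `^ (kappa + mu + 1) *
     (Znorm 3 (static phi) (0, y) + Znorm 2 (static psi) (0, y)) <= A) ->
  data_family c (kappa + (1 + mu)) t x ((1 + 3 * c ^+ 2) * A) v.
Proof.
move=> c0 /static_smooth sphi /static_smooth spsi Cv HA.
set e := kappa + (1 + mu); set a := 1 + 3 * c ^+ 2.
have cc : 0 <= c ^+ 2 by exact: sqr_ge0.
have a1 : 1 <= a by rewrite lerDl mulr_ge0.
set Phi := static phi in sphi Cv HA *; set Psi := static psi in spsi Cv HA *.
have key y X : enorm (y - x) <= c * t ->
    X <= a * (Znorm 3 Phi (0, y) + Znorm 2 Psi (0, y)) -> X <= a * A * jb (enorm y) `^ (- e).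
  move=> yx; have := HA _ yx; set Z := _ + _ => hZ hX; apply: (le_trans hX).
  rewrite -mulrA; apply: ler_wpM2l; first exact: le_trans a1.
  have J0 : 0 < jb (enorm y) `^ (kappa + mu + 1) by rewrite powR_gt0 // jb_gt0.
  rewrite -ler_pdivlMl // in hZ; apply: (le_trans hZ).
  have -> : e = kappa + mu + 1 by rewrite /e; ring.
  by rewrite powRN [leLHS]mulrC.
have weak y X : X <= Znorm 3 Phi (0, y) \/ X <= Znorm 2 Psi (0, y) ->
    X <= a * (Znorm 3 Phi (0, y) + Znorm 2 Psi (0, y)).
  have z1 := Znorm_ge0 3 Phi (0, y); have z2 := Znorm_ge0 2 Psi (0, y) => h.
  have S : X <= Znorm 3 Phi (0, y) + Znorm 2 Psi (0, y) by case: h; lra.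
  apply: (le_trans S); rewrite -[leLHS]mul1r; apply: ler_wpM2r => //; exact: addr_ge0.
have P3 y := @Znorm_pieces 3 Phi (0, y) isT; have P2 y := @Znorm_pieces 2 Psi (0, y) isT.
have T3 y := Znorm_third Phi (0, y).
have dxdx y j k : `|dx j (dx k Phi) (0, y)| <= Znorm 3 Phi (0, y).
  have [h _] := T3 y; case: (h j k) => //.
  by rewrite (partial_commute (Some k) (Some j) sphi (H0 y)).
have sz : smooth (fun _ : PT => 0 : R) by exact: smooth_cst0.
split.
- apply: (data_bound_of_cauchy Cv) => y yx; split => [|j|]; apply: (key y _ yx); apply: weak.
  + by left; have [] := P3 y.
  + by left; have [_ _ h _] := P3 y.
  + by right; have [] := P2 y.
- apply: (data_bound_of_cauchy (cauchy_dt sz Cv)) => y yx; split => [|j|]; apply: (key y _ yx).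
  + by apply: weak; right; have [] := P2 y.
  + by apply: weak; right; have [_ _ h _] := P2 y.
  + rewrite add0r normrM (ger0_norm cc).
    have h : `|dx 0 (dx 0 Phi) (0, y) + dx 1 (dx 1 Phi) (0, y) + dx 2 (dx 2 Phi) (0, y)| <=
        3 * Znorm 3 Phi (0, y).
      apply: (le_trans (ler_normD _ _)).
      have h1 := ler_normD (dx 0 (dx 0 Phi) (0, y)) (dx 1 (dx 1 Phi) (0, y)).
      have h2 := dxdx y 0 0; have h3 := dxdx y 1 1; have h4 := dxdx y 2 2; lra.
    apply: (le_trans (ler_wpM2l cc h)).
    have z1 := Znorm_ge0 3 Phi (0, y); have z2 := Znorm_ge0 2 Psi (0, y).
    have z3 := mulr_ge0 cc z2; rewrite /a; lra.
- move=> j; apply: (data_bound_of_cauchy (cauchy_dx j sz Cv)) => y yx.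
  split => [|k|]; apply: (key y _ yx); apply: weak.
  + by left; have [_ _ h _] := P3 y.
  + by left; exact: dxdx.
  + by right; have [_ _ h _] := P2 y.
- move=> j k jk; have jk' : j != k by rewrite neq_ltn jk.
  have Cr := cauchy_rot (smooth_rot j k sz) jk' (cauchy_rot sz jk' Cv).
  apply: (data_bound_of_cauchy Cr) => y yx; split => [|i|]; apply: (key y _ yx); apply: weak.
  + by left; have [_ _ _ h] := P3 y; exact: h.
  + by left; have [_ h] := T3 y; exact: h.
  + by right; have [_ _ _ h] := P2 y; exact: h.
Qed.

Lemma enorm_zero : enorm (0 : 'rV[R]_3) = 0.
Proof. by have := enormZ (0 : R) (0 : 'rV[R]_3); rewrite scale0r normr0 mul0r. Qed.

Lemma distribute_weights (a d L X C A e : R) : 0 < d -> 0 < L ->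
  a * X <= C * (A * (d `^ (1 - e) * L)) -> a * d `^ (e - 1) * L^-1 * X <= C * A.
Proof.
move=> d0 L0 h; have P0 : 0 < d `^ (e - 1) by rewrite powR_gt0.
have PP : d `^ (e - 1) * d `^ (1 - e) = 1.
  by rewrite -(opprB e 1) powRN mulfV // lt0r_neq0.
have Li : 0 < L^-1 by rewrite invr_gt0.
have := ler_wpM2l (ltW (mulr_gt0 P0 Li)) h.
have -> : d `^ (e - 1) * L^-1 * (C * (A * (d `^ (1 - e) * L))) = C * A * (d `^ (e - 1) * d `^ (1 - e)).
  by field; rewrite lt0r_neq0.
by rewrite PP mulr1; apply: le_trans; rewrite le_eqVlt; apply/orP; left; apply/eqP; ring.
Qed.

Lemma distribute_weight (a d X C A e : R) : 0 < d ->
  a * X <= C * (A * d `^ (1 - e)) -> a * d `^ (e - 1) * X <= C * A.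
Proof.
move=> d0 h; have := @distribute_weights a d 1 X C A e d0 ltr01.
by rewrite invr1 !mulr1; exact.
Qed.

End Glue.

Theorem theorem2p1 (R : realType) (c kappa mu : R)
    (hc : 0 < c) (hkappa : 1 <= kappa <= 2) (hmu : 0 < mu) :
  (forall (N : nat) (cs : 'I_N -> R), (forall j, 0 < cs j) ->
    (exists C : R, 0 < C /\
      forall G u : R * 'rV[R]_3 -> R, smooth G ->
        solves_wave c G (fun=> 0) (fun=> 0) u ->
      forall (t : R) (x : 'rV[R]_3), 0 < t -> x != 0 ->
        ((japanese (enorm x) * japanese (t + enorm x)
            * japanese (c * t - enorm x) `^ (kappa - 1)
            * (ln (2 + t + enorm x))^-1
            * `|Dplus c u (t, x)|)%:E
         <= C%:E * normA cs kappa mu 2 G c t x)%E) /\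
    (1 < kappa < 2 ->
      forall delta : R, 0 < delta ->
      exists C : R, 0 < C /\
        forall G u : R * 'rV[R]_3 -> R, smooth G ->
          solves_wave c G (fun=> 0) (fun=> 0) u ->
        forall (t : R) (x : 'rV[R]_3), 0 < t -> delta * t < enorm x ->
          ((japanese (t + enorm x) ^+ 2
              * japanese (c * t - enorm x) `^ (kappa - 1)
              * `|Dplus c u (t, x)|)%:E
           <= C%:E * normA cs kappa mu 2 G c t x)%E)) /\
  (exists C : R, 0 < C /\
    forall (phi psi : 'rV[R]_3 -> R) (u : R * 'rV[R]_3 -> R),
      smooth_on setT phi -> smooth_on setT psi ->
      solves_wave c (fun=> 0) phi psi u ->
    forall (t : R) (x : 'rV[R]_3), 0 < t -> x != 0 ->
      ((japanese (enorm x) * japanese (t + enorm x)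
          * japanese (c * t - enorm x) `^ (kappa - 1)
          * `|Dplus c u (t, x)|)%:E
       <= C%:E * normB (kappa + mu + 1) 2 phi psi c t x)%E).
Proof.
have apex (t : R) (x : 'rV[R]_3) : 0 < t -> enorm (x - x) <= c * t.
  by move=> t0; rewrite subrr enorm_zero mulr_ge0 // ltW.
split=> [N cs cs0|].
  have sp0 i : 0 <= odflt 0 (omap cs i) by case: i => [j|] //=; exact: ltW.
  have coneN (t : R) (x : 'rV[R]_3) : 0 < t -> exists q, cone c t x q.
    move=> t0; exists (0, x); split => /=; first by rewrite lexx ltW.
    by rewrite subr0; exact: apex.
  have A_ge0 (t : R) (x : 'rV[R]_3) G q : cone c t x q -> 0 <= enorm q.2 *
      japanese (q.1 + enorm q.2) `^ kappa * weight cs q.1 (enorm q.2) `^ (1 + mu) * Znorm 2 G q.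
    by rewrite !mulr_ge0 ?powR_ge0 ?enorm_ge0 ?Znorm_ge0.
  split=> [|k12 delta delta0].
    have [C C0 HC] := source_log_estimate sp0 hc hmu hkappa.
    exists C; split => // G u sG /(cauchy_of_solution sG) Cu t x t0 x0.
    apply: le_scaled_sup => // [|q|A A0 HA]; [exact: coneN|exact: A_ge0|].
    have r0 := enorm_gt0 x0.
    rewrite DplusE; apply: distribute_weights; first exact: jb_gt0.
      by rewrite ln_gt0 //; have := ltW t0; lra.
    rewrite -mulrA; apply: (HC _ _ _ G) => //; exact: source_family_of_sup.
  have [C C0 HC] := source_power_estimate sp0 hc hmu k12 delta0.
  exists C; split => // G u sG /(cauchy_of_solution sG) Cu t x t0 tx.
  have x0 : x != 0.
    apply: contraTneq tx => ->; rewrite -leNgt enorm_zero.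
    by rewrite mulr_ge0 // ltW.
  apply: le_scaled_sup => // [|q|A A0 HA]; [exact: coneN|exact: A_ge0|].
  rewrite DplusE; apply: distribute_weight; first exact: jb_gt0.
  rewrite expr2 -mulrA; apply: (HC _ _ _ G) => //; exact: source_family_of_sup.
have [C C0 HC] := free_estimate hc hmu hkappa.
have a0 : 0 < 1 + 3 * c ^+ 2 by rewrite ltr_pwDl // mulr_ge0 // sqr_ge0.
exists (C * (1 + 3 * c ^+ 2)); split; first by rewrite mulr_gt0.
move=> phi psi u sphi spsi Su t x t0 x0.
have Cu := cauchy_of_solution smooth_cst0 Su.
apply: le_scaled_sup => [|||A A0 HA].
- by rewrite mulr_gt0.
- by exists x; exact: apex.
- by move=> y _; rewrite mulr_ge0 ?powR_ge0 // addr_ge0 ?Znorm_ge0.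
rewrite DplusE -[C * _ * A]mulrA; apply: distribute_weight; first exact: jb_gt0.
have [su eu _ _] := Cu.
rewrite -mulrA; apply: HC => //; first by rewrite mulr_ge0 // ltW.
exact: data_family_of_sup Cu HA.
Qed.
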